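(* Let $n\geq 2$ be an integer, let $\Sigma$ be a smooth surface diffeomorphic to the $2$-dimensional real torus, and let $\ell:\Sigma\to\mathbb{R}^{2n}$ be a smooth isotropic immersion (resp. embedding). Then there exist piecewise linear isotropic topological immersions (resp. topological embeddings) $f:\Sigma\to\mathbb{R}^{2n}$ arbitrarily close to $\ell$ in the $C^1$-sense; that is, for every $\epsilon>0$ there is a piecewise linear isotropic topological immersion (resp. embedding) $f:\Sigma\to\mathbb{R}^{2n}$ with $\|\ell-f\|_{C^1}\leq\epsilon$.
   Context: $\mathbb{R}^{2n}$ has coordinates $x_1,y_1,\dots,x_n,y_n$, its canonical Euclidean norm, and the symplectic form $\omega=\sum_{j=1}^n dx_j\wedge dy_j$. A smooth map $\ell:\Sigma\to\mathbb{R}^{2n}$ is isotropic if $\ell^*\omega=0$. A smooth triangulation of a closed smooth surface $\Sigma$ is a finite simplicial complex $\mathscr{K}$ in some $\mathbb{R}^d$ with a homeomorphism $\phi:|\mathscr{K}|\to\Sigma$ whose restriction to each simplex is a smooth embedding; simplices of $\mathscr{K}$ are identified with their images in $\Sigma$, and the $2$-simplices are called facets. A continuous map $h:\Sigma\to\mathbb{R}^{2n}$ is piecewise smooth if there is a smooth triangulation (said to be adapted to $h$) such that the restriction of $h$ to each facet is smooth. It is piecewise linear if there is a smooth triangulation such that $h\circ\phi$ is affine on each simplex of $\mathscr{K}$ (all smooth triangulations of $\Sigma$ define the same piecewise linear structure up to piecewise linear isomorphism). A piecewise smooth map $h$ is isotropic if $h^*\omega|_{\mathbf{f}}=0$ for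 every facet $\mathbf{f}$ of an adapted triangulation (this does not depend on the adapted triangulation). Topological embedding: a continuous map that is a homeomorphism onto its image with the induced topology. Topological immersion: a map that is locally a topological embedding. Fix a Riemannian metric on $\Sigma$ (for compact $\Sigma$ different choices give equivalent norms). For a piecewise smooth map $h$ with adapted triangulation, $\|h\|_{C^1}=\sup_{x\in\Sigma}\|h(x)\|+\sup_{\mathbf{f}}\sup_{x\in\mathbf{f}}\|d(h|_{\mathbf{f}})_x\|$, where $\mathbf{f}$ runs over the facets and the operator norm is used for the differential. *)

(* Defs.v *)
From HB Require Import structures.
From mathcomp Require Import all_boot all_order all_algebra.
From mathcomp Require Import finmap generic_quotient.
From mathcomp Require Import all_classical all_reals all_analysis.
From mathcomp Require Import lra zify.

Set Implicit Arguments.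
Unset Strict Implicit.
Unset Printing Implicit Defensive.

Import Order.TTheory GRing.Theory Num.Theory.
Import numFieldNormedType.Exports.

Local Open Scope classical_set_scope.
Local Open Scope ring_scope.

Section EuclideanSpace.
Variable R : realType.

(* The library norm on row vectors is the sup norm; it induces the same
   topology and the same differentials. *)
Definition enorm m (v : 'rV[R]_m) : R := Num.sqrt (\sum_i v 0 i ^+ 2).

(* R^{2n} is 'rV_(n * 2): the coordinate x_j sits at [mxvec_index j 0] (position
   2j) and y_j at [mxvec_index j 1] (position 2j + 1). *)
Definition omega n (u v : 'rV[R]_(n * 2)) : R :=
  \sum_(j < n) (u 0 (mxvec_index j 0) * v 0 (mxvec_index j 1)
              - u 0 (mxvec_index j 1) * v 0 (mxvec_index j 0)).

Fixpoint Ck_on (V W : normedModType R) (k : nat) (U : set V) (f : V -> W) : Prop :=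
  if k is k'.+1 then
    (forall x, U x -> differentiable f x) /\ (forall v, Ck_on k' U ('D_v f))
  else forall x, U x -> {for x, continuous f}.

(* Meaningful for U open. *)
Definition smooth_on (V W : normedModType R) (U : set V) (f : V -> W) : Prop :=
  forall k, Ck_on k U f.

End EuclideanSpace.

Definition homeomorphism_on (X Y : topologicalType) (A : set X) (B : set Y)
    (f : X -> Y) : Prop :=
  {within A, continuous f} /\
  exists g : Y -> X, [/\ {within B, continuous g},
    forall x, A x -> B (f x) /\ g (f x) = x &
    forall y, B y -> A (g y) /\ f (g y) = y].

Definition topological_embedding_on (X Y : topologicalType) (A : set X)
    (f : X -> Y) : Prop := homeomorphism_on A (f @` A) f.

Definition topological_embedding (X Y : topologicalType) (f : X -> Y) : Prop :=
  topological_embedding_on setT f.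

Definition topological_immersion (X Y : topologicalType) (f : X -> Y) : Prop :=
  forall x, exists U, [/\ open U, U x & topological_embedding_on U f].

Section SmoothSurface.
Variable R : realType.

(* [chart_map] is the coordinate map on the open set [dom] and [chart_inv] its
   inverse on [chart_map @` dom]; elsewhere their values are irrelevant. *)
Record chart (T : Type) := Chart {
  dom : set T;
  chart_map : T -> 'rV[R]_2;
  chart_inv : 'rV[R]_2 -> T }.

Definition is_chart (T : topologicalType) (c : chart T) : Prop :=
  [/\ open (dom c), open (chart_map c @` dom c),
      forall x, dom c x -> chart_inv c (chart_map c x) = x,
      forall x, dom c x -> {for x, continuous (chart_map c)} &
      forall z, (chart_map c @` dom c) z -> {for z, continuous (chart_inv c)}].

Definition compatible (T : Type) (c c' : chart T) : Prop :=
  smooth_on (chart_map c @` (dom c `&` dom c')) (chart_map c' \o chart_inv c).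

(* The atlas is not required to be maximal. *)
Record smoothSurface := SmoothSurface {
  surface_space :> topologicalType;
  atlas : set (chart surface_space);
  surface_hausdorff : hausdorff_space surface_space;
  surface_second_countable : @second_countable surface_space;
  atlas_chart : forall c, atlas c -> is_chart c;
  atlas_cover : forall x, exists2 c, atlas c & dom c x;
  atlas_compatible : forall c c', atlas c -> atlas c' -> compatible c c' }.

Definition smooth_surface_map (S S' : smoothSurface) (F : S -> S') : Prop :=
  continuous F /\
  forall (c : chart S) (c' : chart S'), atlas c -> atlas c' ->
    smooth_on (chart_map c @` (dom c `&` F @^-1` dom c'))
      (chart_map c' \o F \o chart_inv c).

Definition diffeomorphic (S S' : smoothSurface) : Prop :=
  exists (F : S -> S') (G : S' -> S),
    [/\ smooth_surface_map F, smooth_surface_map G, cancel F G & cancel G F].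

End SmoothSurface.

Section SmoothTranslation.
Variables (R : realType) (V W : normedModType R).

Lemma near_eq_differentiable (f g : V -> W) (a : V) :
  (\near a, f a = g a) -> differentiable f a -> differentiable g a.
Proof.
move=> fg df; have [cf ef] := (diff_locallyP a f).1 df.
have eg : g \o shift a = cst (g a) + 'd f a +o_ 0 id.
  apply/eqaddoP => e e0.
  have fga := nbhs_singleton fg.
  move/eqaddoP : ef => /(_ e e0); apply: filter_app.
  move: fg; rewrite (near_shift 0); apply: filterS => h /=.
  by rewrite !fctE /= subr0 => <-; rewrite fga.
have dgf := diff_unique cf eg.
by apply/diff_locallyP; rewrite dgf.
Qed.

Lemma Ck_on_local k (U : set V) (f : V -> W) :
  (forall x, U x -> exists N g, [/\ open N, N x, Ck_on k N g &
     forall y, N y -> f y = g y]) -> Ck_on k U f.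
Proof.
elim: k f => [|k IH] f H /=.
  move=> x /H [N [g [oN Nx cg fg]]].
  have fgx : \forall y \near x, g y = f y.
    by apply: filterS (open_nbhs_nbhs (conj oN Nx)) => y /fg ->.
  have gfx := nbhs_singleton fgx.
  apply: (cvg_trans (near_eq_cvg fgx)); rewrite -gfx; exact: (cg x Nx).
split=> [x /H [N [g [oN Nx [dg _] fg]]]|v].
  apply: (@near_eq_differentiable g); last exact: dg.
  by apply: filterS (open_nbhs_nbhs (conj oN Nx)) => y /fg ->.
apply: IH => x /H [N [g [oN Nx [_ dg] fg]]].
exists N, ('D_v g); split; [by []|by []|exact: dg|move=> y Ny].
apply: near_eq_derive.
by apply: filterS (open_nbhs_nbhs (conj oN Ny)) => z /fg.
Qed.

Lemma Ck_on_cst k (U : set V) (b : W) : Ck_on k U (cst b).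
Proof.
elim: k b => [|k IH] b /=; first by move=> x _; exact: cst_continuous.
split=> [x _|v]; first exact: differentiable_cst.
by rewrite (_ : 'D_v (cst b) = cst 0) //; apply/funext => x; rewrite derive_cst.
Qed.

End SmoothTranslation.

Lemma smooth_on_translation (R : realType) (V : normedModType R) (U : set V)
  (b : V) : smooth_on U (fun x => x + b).
Proof.
case=> [|k] /=.
  by move=> x _; apply: (@continuousD _ _ _ id (cst b));
    [exact: cvg_id|exact: cst_continuous].
have df x : is_diff x (fun x : V => x + b) id.
  have := is_diffD (is_diff_id x) (is_diff_cst b x).
  by rewrite addr0.
split=> [x _|v]; first exact: ex_diff.
rewrite (_ : 'D_v _ = cst v); first exact: Ck_on_cst.
by apply/funext => x; rewrite deriveE ?diff_val.
Qed.

Section Torus.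
Variable R : realType.

Definition lattice_equiv (z w : 'rV[R]_2) : bool :=
  `[< exists k : 'rV[int]_2, z - w = map_mx intr k >].

Lemma lattice_equiv_refl : reflexive lattice_equiv.
Proof.
move=> z; apply/asboolP; exists 0.
by rewrite subrr; apply/rowP => i; rewrite !mxE.
Qed.

Lemma lattice_equiv_sym : symmetric lattice_equiv.
Proof.
suff H z w : lattice_equiv z w -> lattice_equiv w z.
  by move=> z w; apply/idP/idP; exact: H.
move=> /asboolP[k zw]; apply/asboolP; exists (- k).
by rewrite -opprB zw; apply/rowP => i; rewrite !mxE rmorphN.
Qed.

Lemma lattice_equiv_trans : transitive lattice_equiv.
Proof.
move=> w z u /asboolP[k zw] /asboolP[k' wu]; apply/asboolP; exists (k + k').
rewrite -(subrKA w) zw wu.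
by apply/rowP => i; rewrite !mxE rmorphD.
Qed.

Canonical lattice_equiv_equiv := EquivRel lattice_equiv
  lattice_equiv_refl lattice_equiv_sym lattice_equiv_trans.

(* R^2 / Z^2 with the quotient topology. *)
Definition torus_space : topologicalType :=
  quotient_topology {eq_quot lattice_equiv}%qT.

Definition torus_proj (z : 'rV[R]_2) : torus_space :=
  (\pi_(quotient_topology {eq_quot lattice_equiv}%qT) z)%qT.

Lemma torus_projE z w : torus_proj z = torus_proj w <-> lattice_equiv z w.
Proof. by split => [/eqmodP|zw]; last exact/eqmodP. Qed.

Lemma torus_projP q : exists z, q = torus_proj z.
Proof. by exists (repr q); rewrite /torus_proj; symmetry; exact: reprK. Qed.

Lemma torus_proj_continuous : continuous torus_proj.
Proof. exact: pi_continuous. Qed.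

Lemma torus_proj_open (U : set 'rV[R]_2) : open U -> open (torus_proj @` U).
Proof.
move=> oU; rewrite /open /= /quotient_open.
pose tr (k : 'rV[int]_2) := (fun z : 'rV[R]_2 => z + map_mx intr k).
rewrite (_ : _ @^-1` _ = \bigcup_k (tr k @^-1` U)).
  apply: bigcup_open => k _; apply: open_comp => // z _.
  apply: (@continuousD _ _ _ id (cst _)); first exact: cvg_id.
  exact: cst_continuous.
apply/seteqP; split => z /=.
  move=> [w Uw /torus_projE /asboolP[k wz]]; exists k => //=.
  by rewrite /tr -wz addrC subrK.
move=> [k _ Uz]; exists (tr k z) => //; apply/torus_projE/asboolP.
by exists k; rewrite /tr addrC addKr.
Qed.

(* The chart inverting the projection on an open set where it is injective. *)
Definition torus_chart (U : set 'rV[R]_2) : chart R torus_space :=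
  Chart (torus_proj @` U)
    (fun q => xget 0 [set z | U z /\ torus_proj z = q]) torus_proj.

Definition torus_atlas : set (chart R torus_space) :=
  [set c | exists U, [/\ open U, set_inj U torus_proj & c = torus_chart U]].

Lemma torus_chartP U q : (torus_proj @` U) q ->
  U (chart_map (torus_chart U) q) /\
  torus_proj (chart_map (torus_chart U) q) = q.
Proof.
move=> [z Uz zq].
have h : exists z', [set z' | U z' /\ torus_proj z' = q] z' by exists z.
exact: (xgetPex 0 h).
Qed.

Lemma torus_chartK U z : set_inj U torus_proj -> U z ->
  chart_map (torus_chart U) (torus_proj z) = z.
Proof.
move=> inj Uz; have [Uz' e] := torus_chartP (imageP torus_proj Uz).
by apply: inj; rewrite ?inE.
Qed.

Lemma torus_chart_image U : set_inj U torus_proj ->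
  chart_map (torus_chart U) @` dom (torus_chart U) = U.
Proof.
move=> inj; apply/seteqP; split => z.
  by move=> [q /torus_chartP[Uq _] <-].
by move=> Uz; exists (torus_proj z); [exists z|rewrite torus_chartK].
Qed.

Lemma torus_hausdorff : hausdorff_space torus_space.
Proof.
rewrite open_hausdorff => p q; have [z ->] := torus_projP p.
have [w ->] := torus_projP q => /eqP nzw.
have [i hi] : exists i, forall m : int, (z - w) 0 i != m%:~R.
  apply: contrapT => /forallNP H; apply: nzw; apply/torus_projE/asboolP.
  have {}H i : exists m : int, (z - w) 0 i = m%:~R.
    have := H i; move/existsNP => [m /negP]; rewrite negbK => /eqP; by exists m.
  have [k hk] := choice H; exists (\row_i k i).
  by apply/rowP => i; rewrite !mxE -hk !mxE.
set a := (z - w) 0 i in hi; set fl := Num.floor a.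
have /andP[fl1 fl2] := floor_itv a; rewrite -/fl in fl1 fl2.
have {}fl1 : fl%:~R < a by rewrite lt_neqAle fl1 eq_sym hi.
pose e := Num.min (a - fl%:~R) ((fl + 1)%:~R - a).
have e0 : 0 < e by rewrite lt_min !subr_gt0 fl1.
pose B (u : 'rV[R]_2) := (fun v : 'rV[R]_2 => v 0 i) @^-1` ball (u 0 i) (e / 2).
have oB u : open (B u).
  by apply: open_comp; [move=> *; exact: coord_continuous|exact: ball_open].
have BB u : B u u by rewrite /B /=; apply: ballxx; rewrite divr_gt0.
exists (torus_proj @` B z, torus_proj @` B w) => /=.
  by rewrite !inE; split; [exists z|exists w].
split; [exact: torus_proj_open|exact: torus_proj_open|apply/eqP].
rewrite -subset0 => _ [[u Bu <-] [v Bv /torus_projE /asboolP[k vu]]].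
have {}vu : v 0 i = u 0 i + (k 0 i)%:~R.
  by have := congr1 (fun x : 'rV[R]_2 => x 0 i) vu; rewrite !mxE => /eqP; rewrite subr_eq addrC => /eqP.
move: Bu Bv; rewrite /B /= /ball /= vu !ltr_norml => /andP[b1 b2] /andP[b3 b4].
have aE : a = z 0 i - w 0 i by rewrite /a !mxE.
have ea : e <= a - fl%:~R by rewrite ge_min lexx.
have ea' : e <= fl%:~R + 1 - a by rewrite ge_min intrD lexx orbT.
have [le|lt] := leP (- k 0 i) fl.
  have : (- k 0 i)%:~R <= fl%:~R :> R by rewrite ler_int.
  by rewrite rmorphN /=; lra.
have : (fl + 1)%:~R <= (- k 0 i)%:~R :> R by rewrite ler_int lezD1.
by rewrite rmorphN rmorphD /=; lra.
Qed.

Lemma rat_ball_basis (z : 'rV[R]_2) (e : R) : 0 < e ->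
  exists (r : 'rV[rat]_2) (n : nat),
    ball (map_mx ratr r : 'rV[R]_2) n.+1%:R^-1 z /\
    ball (map_mx ratr r : 'rV[R]_2) n.+1%:R^-1 `<=` ball z e.
Proof.
move=> e0; have e2 : 0 < e / 2 by rewrite divr_gt0.
have [n] := ltr_add_invr e2; rewrite add0r => ne.
have n0 : 0 < n.+1%:R^-1 :> R by rewrite invr_gt0.
move: ne n0; set d := n.+1%:R^-1 => ne n0.
have H i : exists q : rat, ratr q \in `]z 0 i, z 0 i + d[.
  by apply: rat_in_itvoo; rewrite ltrDl.
have [r hr] := choice H; exists (\row_i r i), n; rewrite -/d.
have bz : ball (map_mx ratr (\row_i r i) : 'rV[R]_2) d z.
  split=> // i j; rewrite !mxE ord1; move: (hr j); rewrite in_itv /= => /andP[? ?].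
  by rewrite /ball /= ltr_norml; apply/andP; split; lra.
split=> // u ru; apply: (@le_ball _ _ _ (d + d)); first by lra.
by apply: ball_triangle ru; exact: ball_sym.
Qed.

Lemma torus_second_countable : @second_countable torus_space.
Proof.
pose B (rn : 'rV[rat]_2 * nat) : set torus_space :=
  torus_proj @` ball (map_mx ratr rn.1 : 'rV[R]_2) rn.2.+1%:R^-1.
exists (range B); first exact: card_le_trans (card_image_le _ _) (countableP _).
split.
  by move=> _ [rn _ <-]; apply: torus_proj_open; exact: ball_open.
move=> q V; have [z ->] := torus_projP q => /torus_proj_continuous.
move=> /nbhs_ballP[e e0 sub]; have [r [n [bz bs]]] := rat_ball_basis z e0.
exists (B (r, n)); first by split; [exists (r, n)|exists z].
by move=> _ [u bu <-]; apply: sub; exact: bs.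
Qed.

Lemma torus_atlas_chart c : torus_atlas c -> is_chart c.
Proof.
move=> [U [oU inj ->]]; split.
- exact: torus_proj_open.
- by rewrite torus_chart_image.
- by move=> q /torus_chartP[].
- move=> _ [z Uz <-] N; rewrite torus_chartK // => Nz.
  have Nz' : nbhs z (N `&` U) by apply: filterI => //; exact: open_nbhs_nbhs.
  apply: (filterS (P := torus_proj @` (N `&` U)°)).
    move=> _ [w /interior_subset[Nw Uw] <-].
    change (N (chart_map (torus_chart U) (torus_proj w))).
    by rewrite torus_chartK.
  apply: open_nbhs_nbhs; split; last by exists z.
  by apply: torus_proj_open; exact: open_interior.
- by move=> z _; exact: torus_proj_continuous.
Qed.

Lemma torus_atlas_cover q : exists2 c, torus_atlas c & dom c q.
Proof.
have [z ->] := torus_projP q; pose U := ball z (2^-1 : R).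
exists (torus_chart U); last by exists z => //; apply: ballxx; rewrite invr_gt0.
exists U; split=> //; first exact: ball_open.
move=> u v; rewrite !inE => -[_ bu] [_ bv] /torus_projE /asboolP[k uv].
suff k0 : k = 0.
  apply/eqP; rewrite -subr_eq0 uv k0; apply/eqP/rowP => i; by rewrite !mxE.
apply/rowP => i; rewrite mxE.
have := congr1 (fun x : 'rV[R]_2 => x 0 i) uv; rewrite !mxE => uvi.
have := bu 0 i; have := bv 0 i; rewrite /ball /= !ltr_norml.
move=> /andP[? ?] /andP[? ?].
have k1 : (k 0 i)%:~R < 1%:~R :> R by rewrite -uvi; lra.
have k2 : (-1)%:~R < (k 0 i)%:~R :> R by rewrite -uvi rmorphN; lra.
by move: k1 k2; rewrite !ltr_int; lia.
Qed.

Lemma torus_atlas_compatible c c' :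
  torus_atlas c -> torus_atlas c' -> compatible c c'.
Proof.
move=> [U [oU injU ->]] [U' [oU' injU' ->]] k; apply: Ck_on_local => x.
move=> [_ [[z Uz <-] [w U'w /esym zw]]]; rewrite torus_chartK // => <-.
have /asboolP[m zm] : lattice_equiv w z by apply/torus_projE.
pose f := fun u : 'rV[R]_2 => u + map_mx intr m.
have cf : continuous f.
  move=> u; apply: (@continuousD _ _ _ id (cst _)); first exact: cvg_id.
  exact: cst_continuous.
exists (f @^-1` U'), f; split.
- by apply: open_comp => // u _; exact: cf.
- by rewrite /= /f -zm addrC subrK.
- exact: smooth_on_translation.
- move=> u /= U'fu.
  change (chart_map (torus_chart U') (torus_proj u) = f u).
  rewrite (_ : torus_proj u = torus_proj (f u)) ?torus_chartK //.
  apply/torus_projE; rewrite lattice_equiv_sym; apply/asboolP; exists m.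
  by rewrite /f addrC addKr.
Qed.

Definition torus : smoothSurface R := SmoothSurface torus_hausdorff
  torus_second_countable torus_atlas_chart torus_atlas_cover
  torus_atlas_compatible.

End Torus.

Section MapsFromSurface.
Variables (R : realType) (S : smoothSurface R).

(* Smoothness on the open subset W of S. *)
Definition smooth_map_on (V : normedModType R) (W : set S) (h : S -> V) : Prop :=
  forall c : chart R S, atlas c ->
    smooth_on (chart_map c @` (dom c `&` W)) (h \o chart_inv c).

Definition smooth_map (V : normedModType R) (h : S -> V) : Prop :=
  smooth_map_on setT h.

(* The differential of h at x read in the chart c. *)
Definition diff_in (V : normedModType R) (h : S -> V) (c : chart R S) (x : S) :
  'rV[R]_2 -> V := 'd (h \o chart_inv c) (chart_map c x).

Definition immersion (V : normedModType R) (h : S -> V) : Prop :=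
  smooth_map h /\
  forall x (c : chart R S), atlas c -> dom c x -> injective (diff_in h c x).

Definition smooth_embedding (V : normedModType R) (h : S -> V) : Prop :=
  immersion h /\ topological_embedding h.

Definition isotropic n (h : S -> 'rV[R]_(n * 2)) : Prop :=
  forall x (c : chart R S), atlas c -> dom c x ->
    forall u v, omega (diff_in h c x u) (diff_in h c x v) = 0.

(* A smooth map on a closed piece A of S (with corners): locally the restriction
   of a smooth map defined on an open subset of S. *)
Definition smooth_extension (V : normedModType R) (A : set S) (h : S -> V)
    (x : S) (W : set S) (k : S -> V) : Prop :=
  [/\ open W, W x, smooth_map_on W k & forall y, A y -> W y -> k y = h y].

Definition smooth_within (V : normedModType R) (A : set S) (h : S -> V) : Prop :=
  forall x, A x -> exists W k, smooth_extension A h x W k.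

(* L is the differential at x of the restriction of h to A, read in the chart c.
   When A is a facet, A is the closure of its interior, so that L does not
   depend on the local extension. *)
Definition is_diff_within (V : normedModType R) (A : set S) (h : S -> V)
    (c : chart R S) (x : S) (L : 'rV[R]_2 -> V) : Prop :=
  exists W k, smooth_extension A h x W k /\ L = diff_in k c x.

Definition bform (G : 'M[R]_2) (u v : 'rV[R]_2) : R := (u *m G *m v^T) 0 0.

(* A Riemannian metric, given by its Gram matrices in the charts of the atlas. *)
Record riemannian := Riemannian {
  gram : chart R S -> S -> 'M[R]_2;
  gram_sym : forall c x, atlas c -> dom c x -> (gram c x)^T = gram c x;
  gram_pos : forall c x, atlas c -> dom c x ->
    forall u, u != 0 -> 0 < bform (gram c x) u u;
  gram_smooth : forall c, atlas c ->
    smooth_on (chart_map c @` dom c) (gram c \o chart_inv c);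
  gram_change : forall c c' x, atlas c -> atlas c' -> dom c x -> dom c' x ->
    forall u v, bform (gram c x) u v =
      bform (gram c' x) (diff_in (chart_map c') c x u) (diff_in (chart_map c') c x v) }.

Definition op_norm m (g : riemannian) (c : chart R S) (x : S)
    (L : 'rV[R]_2 -> 'rV[R]_m) : \bar R :=
  ereal_sup [set (enorm (L u))%:E | u in [set u | bform (gram g c x) u u <= 1]].

End MapsFromSurface.

Section SimplicialComplex.
Variables (R : realType) (d : nat).
Implicit Types s t : {fset 'rV[R]_d}.

Definition affinely_independent s : Prop :=
  forall a : 'rV[R]_d -> R, \sum_(v <- s) a v = 0 ->
    \sum_(v <- s) a v *: v = 0 -> forall v, v \in s -> a v = 0.

Definition hull s : set 'rV[R]_d :=
  [set p | exists a : 'rV[R]_d -> R, [/\ forall v, v \in s -> 0 <= a v,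
     \sum_(v <- s) a v = 1 & p = \sum_(v <- s) a v *: v]].

(* The direction of the affine span of s. *)
Definition direction s : set 'rV[R]_d :=
  [set w | exists a : 'rV[R]_d -> R,
     \sum_(v <- s) a v = 0 /\ w = \sum_(v <- s) a v *: v].

(* A simplex is given by its set of vertices. In the last clause
   [hull fset0 = set0], so that disjoint vertex sets span disjoint simplices. *)
Definition simplicial_complex (K : {fset {fset 'rV[R]_d}}) : Prop :=
  [/\ forall s, s \in K -> s != fset0 /\ affinely_independent s,
      forall s t, s \in K -> (t `<=` s)%fset -> t != fset0 -> t \in K &
      forall s t, s \in K -> t \in K -> hull s `&` hull t = hull (s `&` t)%fset].

Definition polyhedron (K : {fset {fset 'rV[R]_d}}) : set 'rV[R]_d :=
  [set p | exists2 s, s \in K & hull s p].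

End SimplicialComplex.

Section Triangulation.
Variables (R : realType) (S : smoothSurface R).

(* In the chart c, the restriction of phi to the simplex s extends near each
   point to a smooth map k whose differential is injective along s. *)
Definition immersion_on_simplex d (phi : 'rV[R]_d -> S) (s : {fset 'rV[R]_d}) :
    Prop :=
  forall p (c : chart R S), hull s p -> atlas c -> dom c (phi p) ->
  exists W (k : 'rV[R]_d -> 'rV[R]_2),
    [/\ open W, W p, smooth_on W k,
        forall q, W q -> hull s q -> dom c (phi q) /\ k q = chart_map c (phi q) &
        forall w, direction s w -> 'd k p w = 0 -> w = 0].

(* As tri_map is a homeomorphism, its immersive restrictions to the simplices
   are embeddings. *)
Record smoothTriangulation := SmoothTriangulation {
  tri_dim : nat;
  tri_complex : {fset {fset 'rV[R]_tri_dim}};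
  tri_map : 'rV[R]_tri_dim -> S;
  tri_complexP : simplicial_complex tri_complex;
  tri_homeo : homeomorphism_on (polyhedron tri_complex) setT tri_map;
  tri_smooth : forall s, s \in tri_complex -> immersion_on_simplex tri_map s }.
Arguments tri_map : clear implicits.

Implicit Type T : smoothTriangulation.

Definition facet T : set (set S) :=
  [set A | exists s, [/\ s \in tri_complex T, #|` s| = 3%N &
                         A = tri_map T @` hull s]].

Definition adapted m T (h : S -> 'rV[R]_m) : Prop :=
  continuous h /\ forall A, facet T A -> smooth_within A h.

Definition piecewise_linear m (h : S -> 'rV[R]_m) : Prop :=
  continuous h /\
  exists T, forall s, s \in tri_complex T ->
    exists (A : 'M[R]_(tri_dim T, m)) (b : 'rV[R]_m),
      forall p, hull s p -> h (tri_map T p) = p *m A + b.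

Definition piecewise_isotropic n (h : S -> 'rV[R]_(n * 2)) : Prop :=
  exists T, adapted T h /\
    forall A x (c : chart R S) L, facet T A -> A x -> atlas c -> dom c x ->
      is_diff_within A h c x L -> forall u v, omega (L u) (L v) = 0.

Definition C1_norm m (g : riemannian S) T (h : S -> 'rV[R]_m) : \bar R :=
  (ereal_sup [set (enorm (h x))%:E | x in [set: S]] +
   ereal_sup [set N | exists A x (c : chart R S) L,
     [/\ facet T A, A x, atlas c /\ dom c x, is_diff_within A h c x L &
         N = op_norm g c x L]])%E.

(* The norm does not depend on the adapted triangulation. *)
Definition C1_norm_le m (g : riemannian S) (h : S -> 'rV[R]_m) (eps : R) : Prop :=
  exists T, adapted T h /\ (C1_norm g T h <= eps%:E)%E.

End Triangulation.

(* Main.v *)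
(* Pulled back to the plane by [R^2 -> R^2 / Z^2], [l] becomes a periodic
   isotropic immersion [f]. The Liouville form has a primitive along [f], so that
   each segment of the plane carries an action without circulation. On a fine
   grid one keeps the values of [f] at the even vertices and moves the middle
   vertex of each edge slightly, so that the broken edge has the action of the
   curved one; the boundary of every 2 x 2 block then bounds no [omega]-area.
   Moving its central vertex makes the area of its four quadrilaterals vanish,
   and a quadrilateral without [omega]-area is the base of an isotropic pyramid
   with apex close to its center. On each triangle the differential of the
   resulting piecewise linear map is close to that of [f], hence the difference
   of the two maps is Lipschitz with a small constant, and injectivity passes
   from [f] to its approximation, locally and, by compactness, globally. *)

Require Import Defs.
From HB Require Import structures.
From mathcomp Require Import all_boot all_order all_algebra.
From mathcomp Require Import finmap generic_quotient.
From mathcomp Require Import all_classical all_reals all_analysis.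
From mathcomp Require Import lra ring zify.

Import Order.TTheory GRing.Theory Num.Theory.
Import numFieldNormedType.Exports.
Local Open Scope classical_set_scope.
Local Open Scope ring_scope.

Set Implicit Arguments.
Unset Strict Implicit.
Unset Printing Implicit Defensive.

(** Everything is reduced to linear problems inside one block. Since [omega p p = 0], the area of a
    polygon is affine in each vertex. The four areas around the central vertex of a block have a sum
    fixed by the boundary; once this sum is zero, three equations remain, and likewise three for
    each apex. On an affine grid these have rank two, because opposite sides of a parallelogram are
    equal: this degeneracy is the obstacle. The remedy is to wiggle the midpoints of horizontal
    edges by [h * k] in a direction [nu] that leaves their action unchanged to leading order. Being
    proportional to the mesh [h], the wiggle costs a small constant in the differential but survives
    in the limit. Hence the order of choices: first [k] from the desired precision, then the
    admissible error [h * d] of the boundary, with [d] small compared with [k], and finally the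
    mesh.

    Blocks interact only through edges, whose action is prescribed in advance, so that no global
    system has to be solved. All displacements are small multiples of the mesh, as control of the
    differential requires. *)

Section Omega.
Variables (R : realType) (n : nat).
Local Notation W := 'rV[R]_(n * 2).
Implicit Types u v w : W.

(** * Algebra and bounds for the symplectic form *)

Lemma omegaDl u u' v : omega (u + u') v = omega u v + omega u' v.
Proof.
by rewrite /omega -big_split; apply: eq_bigr => i _ /=; rewrite !mxE; ring.
Qed.

Lemma omegaZl k u v : omega (k *: u) v = k * omega u v.
Proof.
by rewrite /omega mulr_sumr; apply: eq_bigr => i _ /=; rewrite !mxE; ring.
Qed.

Lemma omega_skew u v : omega u v = - omega v u.
Proof. by rewrite /omega -sumrN; apply: eq_bigr => i _ /=; ring. Qed.

Lemma omegavv u : omega u u = 0.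
Proof. by have := omega_skew u u; lra. Qed.

Lemma omegaNl u v : omega (- u) v = - omega u v.
Proof. by rewrite -scaleN1r omegaZl mulN1r. Qed.

Lemma omegaDr u v v' : omega u (v + v') = omega u v + omega u v'.
Proof. by rewrite omega_skew omegaDl opprD -!(omega_skew u). Qed.

Lemma omegaZr k u v : omega u (k *: v) = k * omega u v.
Proof. by rewrite omega_skew omegaZl -mulrN -(omega_skew u). Qed.

Lemma omegaNr u v : omega u (- v) = - omega u v.
Proof. by rewrite -scaleN1r omegaZr mulN1r. Qed.

Lemma omega0l v : omega 0 v = 0.
Proof. by rewrite -(scale0r 0) omegaZl mul0r. Qed.

Lemma omega0r v : omega v 0 = 0.
Proof. by rewrite -(scale0r 0) omegaZr mul0r. Qed.

Definition omegaE :=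
  (omegaDl, omegaDr, omegaNl, omegaNr, omegaZl, omegaZr, omega0l, omega0r).

Lemma coord_le_norm m (v : 'rV[R]_m) i : `|v 0 i| <= `|v|.
Proof.
by rewrite [leRHS]/Num.norm /= mx_normrE; apply/bigmax_geP; right => /=; exists (0, i).
Qed.

Lemma norm_le_coord m (v : 'rV[R]_m) (c : R) : 0 <= c ->
  (forall i, `|v 0 i| <= c) -> `|v| <= c.
Proof.
move=> c0 h; rewrite [leLHS]/Num.norm /= mx_normrE.
by apply: bigmax_le => // -[i j] _ /=; rewrite ord1.
Qed.

Lemma omega_bound u v : `|omega u v| <= (n * 2)%:R * `|u| * `|v|.
Proof.
rewrite /omega; apply: (le_trans (ler_norm_sum _ _ _)).
have -> : (n * 2)%:R * `|u| * `|v| = \sum_(j < n) (2 * (`|u| * `|v|)) :> R.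
  by rewrite sumr_const card_ord natrM -[RHS]mulr_natl; ring.
apply: ler_sum => j _; apply: (le_trans (ler_normB _ _)).
rewrite !normrM mulr_natl mulr2n.
by apply: lerD; apply: ler_pM; rewrite ?normr_ge0 ?coord_le_norm.
Qed.

(** Expanding around [(u0, v0)] leaves three error terms, each at most [(n * 2) B d]; the quadratic
    one because [d <= B]. *)
Lemma omega_close (B d : R) u v u0 v0 :
  `|u - u0| <= d -> `|v - v0| <= d -> `|u0| <= B -> `|v0| <= B -> d <= B ->
  `|omega u v - omega u0 v0| <= 3 * (n * 2)%:R * B * d.
Proof.
move=> hu hv hu0 hv0 dB.
have d0 : 0 <= d by rewrite (le_trans _ hu).
have K0 : 0 <= (n * 2)%:R :> R by [].
have -> : omega u v - omega u0 v0 =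
    omega (u - u0) (v - v0) + omega (u - u0) v0 + omega u0 (v - v0).
  by rewrite !omegaE; ring.
have h1 := omega_bound (u - u0) (v - v0).
have h2 := omega_bound (u - u0) v0.
have h3 := omega_bound u0 (v - v0).
have e1 : `|u - u0| * `|v - v0| <= B * d.
  by rewrite mulrC; apply: ler_pM => //; exact: le_trans dB.
have e2 : `|u - u0| * `|v0| <= B * d by rewrite mulrC; apply: ler_pM.
have e3 : `|u0| * `|v - v0| <= B * d by apply: ler_pM.
apply: (le_trans (ler_normD _ _)); apply: (le_trans (lerD (ler_normD _ _) (lexx _))).
rewrite -!mulrA in h1 h2 h3 *.
have := ler_wpM2l K0 e1; have := ler_wpM2l K0 e2; have := ler_wpM2l K0 e3.
lra.
Qed.

End Omega.

(** * Isotropic fillings of a block *)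

(** In the sup norm [x - x *m M] is at most [3 / 6] of [x], so [|x| <= 2 |x *m M|]; this gives both
    invertibility and the bound on the solution. *)
Lemma near_id_solve (R : realType) (M : 'M[R]_3) (r : 'rV[R]_3) :
  (forall i j, `|M i j - (i == j)%:R| <= 6^-1) ->
  exists2 x, x *m M = r & `|x| <= 2 * `|r|.
Proof.
move=> hM.
have bd (x : 'rV_3) : `|x| <= 2 * `|x *m M|.
  have h : `|x - x *m M| <= 3 * 6^-1 * `|x|.
    apply: norm_le_coord => [|j]; first by rewrite !mulr_ge0 // invr_ge0.
    rewrite -[x in x - _]mulmx1 -mulmxBr mxE.
    apply: (le_trans (ler_norm_sum _ _ _)).
    have -> : 3 * 6^-1 * `|x| = \sum_(i < 3) (6^-1 * `|x|).
      by rewrite sumr_const card_ord -mulr_natl; ring.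
    apply: ler_sum => i _; rewrite normrM mulrC; apply: ler_pM => //.
      by rewrite !mxE distrC.
    exact: coord_le_norm.
  have := ler_normD (x - x *m M) (x *m M); rewrite subrK.
  by move: h; lra.
have uM : M \in unitmx.
  rewrite -row_free_unit; apply/inj_row_free => v vM; apply/eqP.
  by rewrite -normr_le0; have := bd v; rewrite vM normr0 mulr0.
exists (r *m invmx M); first by rewrite mulmxKV.
by have := bd (r *m invmx M); rewrite mulmxKV.
Qed.

(** * Symplectic frames and the linear systems of a block *)

Section Frame.
Variables (R : realType) (n : nat).
Local Notation W := 'rV[R]_(n * 2).
Local Notation K := ((n * 2)%:R : R).

(** A Darboux basis of a symplectic 4-space: [a], [b] span the tangent plane, [mu] and [nu] are dual
    to them, and [B] bounds all four. *)
Definition frame (B : R) (a b mu nu : W) : Prop :=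
  [/\ omega a b = 0, omega a mu = 1, omega a nu = 0,
      omega b mu = 0 & omega b nu = 1] /\
  [/\ omega mu nu = 0, `|a| <= B, `|b| <= B, `|mu| <= B & `|nu| <= B].

Lemma frame_flip B a b mu nu :
  frame B a b mu nu -> frame B (- a) b (- mu) nu.
Proof.
by case=> -[ab am an bm bn] [mn *]; split; split;
  rewrite ?normrN // !omegaE ?ab ?am ?an ?bm ?mn ?opprK ?oppr0.
Qed.

Variables (B : R) (a b mu nu : W).
Hypothesis fr : frame B a b mu nu.

Definition comb (x y s t : R) : W := x *: a + y *: b + s *: mu + t *: nu.

Lemma omega_comb x y s t x' y' s' t' :
  omega (comb x y s t) (comb x' y' s' t') = x * s' - s * x' + (y * t' - t * y').
Proof.
have [[ab am an bm bn] [mn _ _ _ _]] := fr.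
rewrite /comb !omegaE !omegavv (omega_skew b a) (omega_skew mu a).
rewrite (omega_skew nu a) (omega_skew mu b) (omega_skew nu b) (omega_skew nu mu).
by rewrite ab am an bm bn mn; ring.
Qed.

Lemma combB x y s t x' y' s' t' :
  comb x y s t - comb x' y' s' t' = comb (x - x') (y - y') (s - s') (t - t').
Proof. by apply/rowP => i; rewrite !mxE; ring. Qed.

Lemma frame_bound_ge0 : 0 <= B.
Proof. by have [_ [_ h _ _ _]] := fr; exact: le_trans h. Qed.

Lemma comb_bound x y s t :
  `|comb x y s t| <= (`|x| + `|y| + `|s| + `|t|) * B.
Proof.
have [_ [_ ha hb hm hn]] := fr; have B0 := frame_bound_ge0.
rewrite /comb !mulrDl.
apply: (le_trans (ler_normD _ _)); apply: lerD; last by rewrite normrZ ler_wpM2l.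
apply: (le_trans (ler_normD _ _)); apply: lerD; last by rewrite normrZ ler_wpM2l.
by apply: (le_trans (ler_normD _ _)); apply: lerD; rewrite normrZ ler_wpM2l.
Qed.

(** Evaluated on [mu], [nu], [- b], the covectors of [D1], [D2] and [e^-1 *: D3] form a matrix
    within [1 / 6] of the identity. The third equation is divided by [e], so its right-hand side has
    to be of size [|e| s]. *)
Lemma frame_solve (e rho s : R) (D1 D2 D3 : W) (r1 r2 r3 : R) :
  e != 0 -> 6 * K * B * rho <= 1 ->
  `|D1 - a| <= rho -> `|D2 - b| <= rho -> `|D3 - e *: nu| <= `|e| * rho ->
  `|r1| <= s -> `|r2| <= s -> `|r3| <= `|e| * s ->
  exists u, [/\ omega D1 u = r1, omega D2 u = r2, omega D3 u = r3 &
    `|u| <= 6 * B * s].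
Proof.
move=> e0 hrho h1 h2 h3 q1 q2 q3.
have [[ab am an bm bn] [mn ha hb hm hn]] := fr.
have s0 : 0 <= s by exact: le_trans q1.
have B0 := frame_bound_ge0.
pose D (j : 'I_3) : W := nth 0 [:: D1; D2; e^-1 *: D3] j.
pose D0 (j : 'I_3) : W := nth 0 [:: a; b; nu] j.
pose g (i : 'I_3) : W := nth 0 [:: mu; nu; - b] i.
pose r : 'rV[R]_3 := \row_j nth 0 [:: r1; r2; e^-1 * r3] j.
have D0E i j : omega (D0 j) (g i) = (i == j)%:R.
  rewrite /D0 /g; case: i j => -[|[|[|//]]] ? [[|[|[|//]]] ?] /=;
  rewrite ?omegaE ?omegavv ?(omega_skew nu) ?ab ?am ?an ?bm ?bn ?mn ?opprK //=;
  by rewrite oppr0.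
have DD0 j : `|D j - D0 j| <= rho.
  rewrite /D /D0; case: j => -[|[|[|//]]] ? //=.
  have -> : e^-1 *: D3 - nu = e^-1 *: (D3 - e *: nu).
    by rewrite scalerBr scalerA mulVf // scale1r.
  by rewrite normrZ normfV ler_pdivrMl // normr_gt0.
have gB i : `|g i| <= B by rewrite /g; case: i => -[|[|[|//]]] ? //=; rewrite normrN.
pose M : 'M[R]_3 := \matrix_(i, j) omega (D j) (g i).
have hM i j : `|M i j - (i == j)%:R| <= 6^-1.
  rewrite mxE -D0E -(opprK (omega (D0 j) _)) -omegaNl opprK -omegaDl.
  apply: (le_trans (omega_bound _ _)).
  have : K * `|D j - D0 j| * `|g i| <= K * rho * B.
    by apply: ler_pM => //; rewrite ?mulr_ge0 // ler_wpM2l.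
  by move: hrho; lra.
have [x xM xr] := near_id_solve r hM.
have omx j : omega (D j) (\sum_i x 0 i *: g i) = r 0 j.
  rewrite -xM mxE; rewrite (big_morph _ (omegaDr (D j)) (omega0r (D j))).
  by apply: eq_bigr => i _; rewrite omegaZr mxE.
have rs : `|r| <= s.
  apply: norm_le_coord => // j; rewrite mxE; case: j => -[|[|[|//]]] ? //=.
  by rewrite normrM normfV ler_pdivrMl // normr_gt0.
exists (\sum_i x 0 i *: g i); split.
- by have := omx 0; rewrite mxE.
- by have := omx 1; rewrite mxE.
- have := omx 2; rewrite mxE /D /= omegaZl => /mulfI; apply.
  by rewrite invr_eq0.
- apply: (le_trans (ler_norm_sum _ _ _)).
  have -> : 6 * B * s = \sum_(i < 3) (2 * s * B).
    by rewrite sumr_const card_ord -mulr_natl; ring.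
  apply: ler_sum => i _; rewrite normrZ; apply: ler_pM => //.
  apply: (le_trans (coord_le_norm _ _)); apply: (le_trans xr).
  by rewrite ler_wpM2l.
Qed.

Lemma dist_sub (V : normedModType R) (x x0 y y0 : V) (d d' : R) :
  `|x - x0| <= d -> `|y - y0| <= d' -> `|(x - y) - (x0 - y0)| <= d + d'.
Proof.
move=> h h'.
have -> : x - y - (x0 - y0) = (x - x0) - (y - y0).
  by rewrite opprD addrACA -opprD.
by apply: (le_trans (ler_normB _ _)); apply: lerD.
Qed.

(** Coordinates at most 2 give combinations of norm at most [8 B], and [omega_close] turns this into
    the factor [24 = 3 * 8]. *)
Lemma omega_comb_close (d : R) (u v : W) x y s t x' y' s' t' :
  `|u - comb x y s t| <= d -> `|v - comb x' y' s' t'| <= d -> d <= 8 * B ->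
  [/\ `|x| <= 2, `|y| <= 2, `|s| <= 2 & `|t| <= 2] ->
  [/\ `|x'| <= 2, `|y'| <= 2, `|s'| <= 2 & `|t'| <= 2] ->
  x * s' - s * x' + (y * t' - t * y') = 0 ->
  `|omega u v| <= 24 * K * B * d.
Proof.
move=> hu hv hd [x2 y2 s2 t2] [x2' y2' s2' t2'] z; have B0 := frame_bound_ge0.
have := @omega_close _ _ (8 * B) d u v _ _ hu hv.
rewrite omega_comb z subr0 => h.
have -> : 24 * K * B * d = 3 * K * (8 * B) * d by ring.
by apply: h => //; apply: (le_trans (comb_bound _ _ _ _)); rewrite ler_wpM2r //; lra.
Qed.

End Frame.

(* The central vertex of a 2 x 2 block, in coordinates in which the block has
   edges [2 a], [2 b]: the four quadrilaterals get zero symplectic area. The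
   wiggle [e nu] makes the three relevant covectors independent. *)
Lemma block_center (R : realType) (n : nat) (B : R) (a b mu nu : 'rV[R]_(n * 2))
  (e d : R) (p00 p10 p20 p01 p21 p02 p12 p22 : 'rV[R]_(n * 2)) :
  let K := (n * 2)%:R in let c4 := comb a b mu nu in
  frame B a b mu nu ->
  0 < `|e| <= 1 -> 12 * K * B * d <= `|e| -> 2 * d <= B ->
  `|p00 - c4 0 0 0 0| <= d -> `|p10 - c4 1 0 0 e| <= d ->
  `|p20 - c4 2 0 0 0| <= d -> `|p01 - c4 0 1 0 0| <= d ->
  `|p21 - c4 2 1 0 0| <= d -> `|p02 - c4 0 2 0 0| <= d ->
  `|p12 - c4 1 2 0 e| <= d -> `|p22 - c4 2 2 0 0| <= d ->
  omega p00 p10 + omega p10 p20 + omega p20 p21 + omega p21 p22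
  - omega p12 p22 - omega p02 p12 - omega p01 p02 - omega p00 p01 = 0 ->
  exists p11, [/\ `|p11 - c4 1 1 0 (- e)| <= 288 * K * B ^+ 2 * d / `|e|,
    omega (p11 - p00) (p01 - p10) = 0, omega (p21 - p10) (p11 - p20) = 0,
    omega (p22 - p11) (p12 - p21) = 0 & omega (p12 - p01) (p02 - p11) = 0].
Proof.
move=> K c4 fr.
move=> /andP[e0 e1] de dB h00 h10 h20 h01 h21 h02 h12 h22 tot.
have B0 := frame_bound_ge0 fr.
have d0 : 0 <= d by exact: le_trans h00.
have K0 : 0 <= K by rewrite ler0n.
(* The [nu]-component [- e] is the one for which the four quadrilaterals of the model have area
   zero. *)
have [c cE] : exists c, c = c4 1 1 0 (- e) by exists (c4 1 1 0 (- e)).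
have hc : `|c - c4 1 1 0 (- e)| <= d by rewrite cE subrr normr0.
have close := omega_comb_close fr (d := d + d).
have dd : d + d <= 8 * B by move: dB B0; clear; lra.
have cl u v x y s t x' y' s' t' u' v' X Y S T X' Y' S' T' :
    `|u - c4 x y s t| <= d -> `|v - c4 x' y' s' t'| <= d ->
    `|u' - c4 X Y S T| <= d -> `|v' - c4 X' Y' S' T'| <= d ->
    [/\ `|x - x'| <= 2, `|y - y'| <= 2, `|s - s'| <= 2 & `|t - t'| <= 2] ->
    [/\ `|X - X'| <= 2, `|Y - Y'| <= 2, `|S - S'| <= 2 & `|T - T'| <= 2] ->
    (x - x') * (S - S') - (s - s') * (X - X') +
      ((y - y') * (T - T') - (t - t') * (Y - Y')) = 0 ->
    `|omega (u - v) (u' - v')| <= 48 * K * B * d.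
  move=> q1 q2 q3 q4 b1 b2 z.
  have := dist_sub q1 q2; have := dist_sub q3 q4; rewrite !combB => w1 w2.
  have := close _ _ _ _ _ _ _ _ _ _ w2 w1 dd b1 b2 z.
  by rewrite (_ : 24 * K * B * (d + d) = 48 * K * B * d) //; ring.

have [e_lb e_ub] : - 1 <= e /\ e <= 1 by apply/andP; rewrite -ler_norml.
have sm (x : R) : - 2 <= x -> x <= 2 -> `|x| <= 2 by move=> *; rewrite ler_norml; apply/andP.
have E00 : `|omega (c - p00) (p01 - p10)| <= 48 * K * B * d.
  by apply: (cl _ _ _ _ _ _ _ _ _ _ _ _ _ _ _ _ _ _ _ _ hc h00 h01 h10);
    [split; apply: sm; move: e_lb e_ub; clear; lra|split; apply: sm; move: e_lb e_ub; clear; lra|ring].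
have E10 : `|omega (p21 - p10) (c - p20)| <= 48 * K * B * d.
  by apply: (cl _ _ _ _ _ _ _ _ _ _ _ _ _ _ _ _ _ _ _ _ h21 h10 hc h20);
    [split; apply: sm; move: e_lb e_ub; clear; lra|split; apply: sm; move: e_lb e_ub; clear; lra|ring].
have E11 : `|omega (p22 - c) (p12 - p21)| <= 48 * K * B * d.
  by apply: (cl _ _ _ _ _ _ _ _ _ _ _ _ _ _ _ _ _ _ _ _ h22 hc h12 h21);
    [split; apply: sm; move: e_lb e_ub; clear; lra|split; apply: sm; move: e_lb e_ub; clear; lra|ring].
have E01 : `|omega (p12 - p01) (p02 - c)| <= 48 * K * B * d.
  by apply: (cl _ _ _ _ _ _ _ _ _ _ _ _ _ _ _ _ _ _ _ _ h12 h01 h02 hc);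
    [split; apply: sm; move: e_lb e_ub; clear; lra|split; apply: sm; move: e_lb e_ub; clear; lra|ring].
(* Up to sign, [2 D1], [2 D2] and [2 D3] are the derivatives, as [p11] moves, of the sum of the area
   at [p00] with each of the other three. Making these sums vanish suffices: the other areas are
   then opposite to the one at [p00], and the total is zero. *)
set D1 := 2^-1 *: (p21 - p01); set D2 := 2^-1 *: (p12 - p10).
set D3 := 2^-1 *: ((p12 - p21) - (p01 - p10)).
have half (x y : 'rV[R]_(n * 2)) k : `|x - 2 *: y| <= 2 * k -> `|2^-1 *: x - y| <= k.
  move=> h; have -> : 2^-1 *: x - y = 2^-1 *: (x - 2 *: y).
    by rewrite scalerBr scalerA mulVf ?scale1r.
  by rewrite normrZ ger0_norm ?invr_ge0 //; move: h; clear; lra.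
have rho_d : d <= 2 * d / `|e|.
  by rewrite ler_pdivlMr //; have := ler_wpM2l d0 e1; move: d0; clear; lra.
have H1 : `|D1 - a| <= 2 * d / `|e|.
  apply: half; apply: (@le_trans _ _ (d + d)); last by move: rho_d d0; clear; lra.
  have := dist_sub h21 h01; rewrite combB; congr (`|_ - _| <= _).
  by apply/rowP => i; rewrite !mxE; ring.
have H2 : `|D2 - b| <= 2 * d / `|e|.
  apply: half; apply: (@le_trans _ _ (d + d)); last by move: rho_d d0; clear; lra.
  have := dist_sub h12 h10; rewrite combB; congr (`|_ - _| <= _).
  by apply/rowP => i; rewrite !mxE; ring.
have H3 : `|D3 - e *: nu| <= `|e| * (2 * d / `|e|).
  rewrite mulrC divfK ?gt_eqF //; apply: half.
  apply: (@le_trans _ _ ((d + d) + (d + d))); last by clear; lra.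
  have := dist_sub (dist_sub h12 h21) (dist_sub h01 h10).
  congr (`|_ - _| <= _).
  by apply/rowP => i; rewrite /c4 /comb !mxE; ring.
(* Each residual is a half sum of two areas of size at most [48 K B d]; the division by [|e|] is
   imposed by the third equation. Then [6 B s] is the announced bound, with [288 = 6 * 48]. *)
pose s := 48 * K * B * d / `|e|.
have sE : `|e| * s = 48 * K * B * d by rewrite /s mulrC divfK ?gt_eqF.
have KBd : 0 <= 48 * K * B * d by rewrite !mulr_ge0.
have s_ge : 48 * K * B * d <= s.
  by rewrite /s ler_pdivlMr //; have := ler_wpM2l KBd e1; clear; lra.
have [|||||u [u1 u2 u3 us]] := frame_solve fr _ _ H1 H2 H3
  (r1 := - 2^-1 * (omega (p21 - p10) (c - p20) + omega (c - p00) (p01 - p10)))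
  (r2 := 2^-1 * (omega (c - p00) (p01 - p10) + omega (p12 - p01) (p02 - c)))
  (r3 := - 2^-1 * (omega (p22 - c) (p12 - p21) + omega (c - p00) (p01 - p10)))
  (s := s).
- by rewrite -normr_gt0.
- have -> : 6 * K * B * (2 * d / `|e|) = 12 * K * B * d / `|e| by ring.
  by rewrite ler_pdivrMr // mul1r.
- rewrite normrM normrN (@ger0_norm _ 2^-1) ?invr_ge0 //.
  by have := ler_normD (omega (p21 - p10) (c - p20)) (omega (c - p00) (p01 - p10)); move: E10 E00 s_ge; clear; lra.
- rewrite normrM (@ger0_norm _ 2^-1) ?invr_ge0 //.
  by have := ler_normD (omega (c - p00) (p01 - p10)) (omega (p12 - p01) (p02 - c)); move: E01 E00 s_ge; clear; lra.
- rewrite sE normrM normrN (@ger0_norm _ 2^-1) ?invr_ge0 //.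
  by have := ler_normD (omega (p22 - c) (p12 - p21)) (omega (c - p00) (p01 - p10)); move: E11 E00; clear; lra.
(* The inner edges cancel, so the four areas add up to the boundary sum wherever the center is. *)
have sum0 : omega (c + u - p00) (p01 - p10) + omega (p21 - p10) (c + u - p20)
    + omega (p22 - (c + u)) (p12 - p21) + omega (p12 - p01) (p02 - (c + u)) = 0.
  rewrite -[RHS]tot; rewrite !omegaE.
  move: (omega_skew p12 p02).
  move: (omega_skew p21 p20) (omega_skew p22 p12) (omega_skew p22 p21).
  move: (omega_skew u p01) (omega_skew c p01) (omega_skew c p10) (omega_skew u p10).
  move: (omega_skew c p12) (omega_skew u p12) (omega_skew c p21) (omega_skew u p21).
  clear; lra.
move: u1 u2 u3 sum0; rewrite /D1 /D2 /D3 !omegaE.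
move=> u1 u2 u3 sum0; exists (c + u); split.
- rewrite -cE addrAC subrr add0r; apply: (le_trans us); rewrite /s.
  by rewrite le_eqVlt; apply/orP; left; apply/eqP; ring.
all: move: u1 u2 u3 sum0; rewrite !omegaE.
all: move: (omega_skew u p01) (omega_skew c p01) (omega_skew c p10) (omega_skew u p10).
all: move: (omega_skew c p12) (omega_skew u p12) (omega_skew c p21) (omega_skew u p21).
all: clear; lra.
Qed.

(** The areas of the four faces are affine in the apex and add up to that of the base, so three of
    them decide. The equations are independent because opposite sides [A1 - A0] and [A2 - A3] differ
    by about [2 e nu]. *)
Lemma quad_apex (R : realType) (n : nat) (B : R) (a b mu nu : 'rV[R]_(n * 2))
  (e d : R) (A0 A1 A2 A3 : 'rV[R]_(n * 2)) :
  let K := (n * 2)%:R in let c4 := comb a b mu nu in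
  frame B a b mu nu ->
  0 < `|e| <= 1 -> 12 * K * B * d <= `|e| -> 2 * d <= B ->
  `|A0 - c4 0 0 0 0| <= d -> `|A1 - c4 1 0 0 e| <= d ->
  `|A2 - c4 1 1 0 (- e)| <= d -> `|A3 - c4 0 1 0 0| <= d ->
  omega (A2 - A0) (A3 - A1) = 0 ->
  exists P, `|P - c4 2^-1 2^-1 (e / 2) 0| <= 288 * K * B ^+ 2 * d / `|e| /\
    [/\ omega (A0 - P) (A1 - P) = 0, omega (A1 - P) (A2 - P) = 0,
        omega (A2 - P) (A3 - P) = 0 & omega (A3 - P) (A0 - P) = 0].
Proof.
move=> K c4 fr /andP[e0 e1] de dB h0 h1 h2 h3 tot.
have B0 := frame_bound_ge0 fr.
have d0 : 0 <= d by exact: le_trans h0.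
have K0 : 0 <= K by rewrite ler0n.
(* The height [e / 2] along [mu] makes the four faces of the model isotropic. *)
have [c cE] : exists c, c = c4 2^-1 2^-1 (e / 2) 0 by exists (c4 2^-1 2^-1 (e / 2) 0).
have hc : `|c - c4 2^-1 2^-1 (e / 2) 0| <= d by rewrite cE subrr normr0.
have dd : d + d <= 8 * B by move: dB B0; clear; lra.
have cl u v x y s t x' y' s' t' u' v' X Y S T X' Y' S' T' :
    `|u - c4 x y s t| <= d -> `|v - c4 x' y' s' t'| <= d ->
    `|u' - c4 X Y S T| <= d -> `|v' - c4 X' Y' S' T'| <= d ->
    [/\ `|x - x'| <= 2, `|y - y'| <= 2, `|s - s'| <= 2 & `|t - t'| <= 2] ->
    [/\ `|X - X'| <= 2, `|Y - Y'| <= 2, `|S - S'| <= 2 & `|T - T'| <= 2] ->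
    (x - x') * (S - S') - (s - s') * (X - X') +
      ((y - y') * (T - T') - (t - t') * (Y - Y')) = 0 ->
    `|omega (u - v) (u' - v')| <= 48 * K * B * d.
  move=> q1 q2 q3 q4 b1 b2 z.
  have := dist_sub q1 q2; have := dist_sub q3 q4; rewrite !combB => w1 w2.
  have := omega_comb_close fr w2 w1 dd b1 b2 z.
  by rewrite (_ : 24 * (n * 2)%:R * B * (d + d) = 48 * K * B * d) //; rewrite /K; ring.
have [e_lb e_ub] : - 1 <= e /\ e <= 1 by apply/andP; rewrite -ler_norml.
have sm (x : R) : - 2 <= x -> x <= 2 -> `|x| <= 2 by move=> *; rewrite ler_norml; apply/andP.
have F0 : `|omega (A0 - c) (A1 - A0)| <= 48 * K * B * d.
  by apply: (cl _ _ _ _ _ _ _ _ _ _ _ _ _ _ _ _ _ _ _ _ h0 hc h1 h0);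
    [split; apply: sm; move: e_lb e_ub; clear; lra|split; apply: sm; move: e_lb e_ub; clear; lra|field].
have F2 : `|omega (A2 - c) (A3 - A2)| <= 48 * K * B * d.
  by apply: (cl _ _ _ _ _ _ _ _ _ _ _ _ _ _ _ _ _ _ _ _ h2 hc h3 h2);
    [split; apply: sm; move: e_lb e_ub; clear; lra|split; apply: sm; move: e_lb e_ub; clear; lra|field].
have F3 : `|omega (A3 - c) (A0 - A3)| <= 48 * K * B * d.
  by apply: (cl _ _ _ _ _ _ _ _ _ _ _ _ _ _ _ _ _ _ _ _ h3 hc h0 h3);
    [split; apply: sm; move: e_lb e_ub; clear; lra|split; apply: sm; move: e_lb e_ub; clear; lra|field].
set D1 := 2^-1 *: ((A1 - A0) - (A3 - A2)); set D2 := A3 - A0.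
set D3 := 2^-1 *: ((A1 - A0) - (A2 - A3)).
have half (x y : 'rV[R]_(n * 2)) k : `|x - 2 *: y| <= 2 * k -> `|2^-1 *: x - y| <= k.
  move=> h; have -> : 2^-1 *: x - y = 2^-1 *: (x - 2 *: y).
    by rewrite scalerBr scalerA mulVf ?scale1r.
  by rewrite normrZ ger0_norm ?invr_ge0 //; move: h; clear; lra.
have rho_d : d <= d / `|e|.
  by rewrite ler_pdivlMr //; have := ler_wpM2l d0 e1; move: d0; clear; lra.
have H1 : `|D1 - a| <= 2 * d / `|e|.
  apply: half; apply: (@le_trans _ _ ((d + d) + (d + d))); last by move: rho_d d0; clear; lra.
  have := dist_sub (dist_sub h1 h0) (dist_sub h3 h2); congr (`|_ - _| <= _).
  by apply/rowP => i; rewrite /c4 /comb !mxE; ring.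
have H2 : `|D2 - b| <= 2 * d / `|e|.
  apply: (@le_trans _ _ (d + d)); last by move: rho_d d0; clear; lra.
  have := dist_sub h3 h0; congr (`|_ - _| <= _).
  by apply/rowP => i; rewrite /c4 /comb !mxE; ring.
have H3 : `|D3 - e *: nu| <= `|e| * (2 * d / `|e|).
  rewrite mulrC divfK ?gt_eqF //; apply: half.
  apply: (@le_trans _ _ ((d + d) + (d + d))); last by clear; lra.
  have := dist_sub (dist_sub h1 h0) (dist_sub h2 h3); congr (`|_ - _| <= _).
  by apply/rowP => i; rewrite /c4 /comb !mxE; ring.
pose s := 48 * K * B * d / `|e|.
have sE : `|e| * s = 48 * K * B * d by rewrite /s mulrC divfK ?gt_eqF.
have KBd : 0 <= 48 * K * B * d by rewrite !mulr_ge0.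
have s_ge : 48 * K * B * d <= s.
  by rewrite /s ler_pdivlMr //; have := ler_wpM2l KBd e1; clear; lra.
have [|||||u [u1 u2 u3 us]] := frame_solve fr _ _ H1 H2 H3
  (r1 := - 2^-1 * (omega (A0 - c) (A1 - A0) - omega (A2 - c) (A3 - A2)))
  (r2 := omega (A3 - c) (A0 - A3))
  (r3 := - 2^-1 * (omega (A0 - c) (A1 - A0) + omega (A2 - c) (A3 - A2)))
  (s := s).
- by rewrite -normr_gt0.
- have -> : 6 * (n * 2)%:R * B * (2 * d / `|e|) = 12 * K * B * d / `|e| by rewrite /K; ring.
  by rewrite ler_pdivrMr // mul1r.
- rewrite normrM normrN (@ger0_norm _ 2^-1) ?invr_ge0 //.
  by have := ler_normB (omega (A0 - c) (A1 - A0)) (omega (A2 - c) (A3 - A2)); move: F0 F2 s_ge; clear; lra.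
- exact: le_trans s_ge.
- rewrite sE normrM normrN (@ger0_norm _ 2^-1) ?invr_ge0 //.
  by have := ler_normD (omega (A0 - c) (A1 - A0)) (omega (A2 - c) (A3 - A2)); move: F0 F2; clear; lra.
move: tot u1 u2 u3; rewrite /D1 /D2 /D3 !omegaE.
move=> tot u1 u2 u3; exists (c + u); split.
  rewrite -cE addrAC subrr add0r; apply: (le_trans us); rewrite /s /K.
  by rewrite le_eqVlt; apply/orP; left; apply/eqP; ring.
have uu : omega u u = 0 := omegavv u.
have cc : omega c c = 0 := omegavv c.
have aa0 := omegavv A0; have aa1 := omegavv A1.
have aa2 := omegavv A2; have aa3 := omegavv A3.
split; move: tot u1 u2 u3 uu cc aa0 aa1 aa2 aa3; rewrite !omegaE.
all: move: (omega_skew c A0) (omega_skew c A1) (omega_skew c A2) (omega_skew c A3).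
all: move: (omega_skew u A0) (omega_skew u A1) (omega_skew u A2) (omega_skew u A3).
all: move: (omega_skew c u) (omega_skew A0 A1) (omega_skew A0 A2) (omega_skew A0 A3).
all: move: (omega_skew A1 A2) (omega_skew A1 A3) (omega_skew A2 A3).
all: clear; lra.
Qed.

Definition pyramid (R : realType) (n : nat) (P A0 A1 A2 A3 : 'rV[R]_(n * 2)) : Prop :=
  [/\ omega (A0 - P) (A1 - P) = 0, omega (A1 - P) (A2 - P) = 0,
      omega (A2 - P) (A3 - P) = 0 & omega (A3 - P) (A0 - P) = 0].

(** * Filling a block at any position and scale *)

Section Block.
Variables (R : realType) (n : nat).
Local Notation W := 'rV[R]_(n * 2).
Local Notation K := ((n * 2)%:R : R).

Lemma pyramid_rot (P A0 A1 A2 A3 : W) :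
  pyramid P A0 A1 A2 A3 -> pyramid P A1 A2 A3 A0.
Proof. by case. Qed.

Lemma pyramid_rev (P A0 A1 A2 A3 : W) :
  pyramid P A0 A1 A2 A3 -> pyramid P A3 A2 A1 A0.
Proof.
by case=> h0 h1 h2 h3; split; rewrite omega_skew ?h0 ?h1 ?h2 ?h3 oppr0.
Qed.

Section Scale.
Variables (o : W) (h : R).
Hypothesis h0 : 0 < h.

(** Unit coordinates centered at [o]: areas are divided by [h ^+ 2], so that their vanishing is
    unaffected. *)
Let sc (A : W) := h^-1 *: (A - o).

Let scK A : o + h *: sc A = A.
Proof. by rewrite /sc scalerA mulfV ?gt_eqF // scale1r addrC subrK. Qed.

Let sc_sub A A' : A - A' = h *: (sc A - sc A').
Proof. by rewrite -[in LHS](scK A) -[in LHS](scK A') opprD addrACA subrr add0r scalerBr. Qed.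

Let sc_close A C d : `|A - (o + h *: C)| <= h * d <-> `|sc A - C| <= d.
Proof.
have -> : A - (o + h *: C) = h *: (sc A - C).
  by rewrite -[in LHS](scK A) opprD addrACA subrr add0r scalerBr.
by rewrite normrZ gtr0_norm // ler_pM2l.
Qed.

Let omega_sc A A' A'' A''' :
  omega (A - A') (A'' - A''') = h ^+ 2 * omega (sc A - sc A') (sc A'' - sc A''').
Proof. by rewrite (sc_sub A) (sc_sub A'') omegaZl omegaZr mulrA. Qed.

Lemma quad_apex_at (B : R) (a b mu nu : W) (e d : R) (A0 A1 A2 A3 : W) :
  let c4 := comb a b mu nu in
  frame B a b mu nu ->
  0 < `|e| <= 1 -> 12 * K * B * d <= `|e| -> 2 * d <= B ->
  `|A0 - (o + h *: c4 0 0 0 0)| <= h * d ->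
  `|A1 - (o + h *: c4 1 0 0 e)| <= h * d ->
  `|A2 - (o + h *: c4 1 1 0 (- e))| <= h * d ->
  `|A3 - (o + h *: c4 0 1 0 0)| <= h * d ->
  omega (A2 - A0) (A3 - A1) = 0 ->
  exists2 P, `|P - (o + h *: c4 2^-1 2^-1 (e / 2) 0)| <=
    h * (288 * K * B ^+ 2 * d / `|e|) & pyramid P A0 A1 A2 A3.
Proof.
move=> c4 fr he de dB /sc_close q0 /sc_close q1 /sc_close q2 /sc_close q3.
rewrite omega_sc => /eqP; rewrite mulf_eq0 expf_eq0 /= gt_eqF //= => /eqP tot.
have [P [hP [w0 w1 w2 w3]]] := quad_apex fr he de dB q0 q1 q2 q3 tot.
exists (o + h *: P).
  apply/sc_close; rewrite (_ : sc (o + h *: P) = P) //.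
  by rewrite /sc addrAC subrr add0r scalerA mulVf ?gt_eqF // scale1r.
have PE : sc (o + h *: P) = P.
  by rewrite /sc addrAC subrr add0r scalerA mulVf ?gt_eqF // scale1r.
by split; rewrite omega_sc PE ?w0 ?w1 ?w2 ?w3 mulr0.
Qed.

Lemma block_center_at (B : R) (a b mu nu : W) (e d : R)
  (p00 p10 p20 p01 p21 p02 p12 p22 : W) :
  let c4 := comb a b mu nu in
  frame B a b mu nu ->
  0 < `|e| <= 1 -> 12 * K * B * d <= `|e| -> 2 * d <= B ->
  `|p00 - (o + h *: c4 0 0 0 0)| <= h * d ->
  `|p10 - (o + h *: c4 1 0 0 e)| <= h * d ->
  `|p20 - (o + h *: c4 2 0 0 0)| <= h * d ->
  `|p01 - (o + h *: c4 0 1 0 0)| <= h * d ->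
  `|p21 - (o + h *: c4 2 1 0 0)| <= h * d ->
  `|p02 - (o + h *: c4 0 2 0 0)| <= h * d ->
  `|p12 - (o + h *: c4 1 2 0 e)| <= h * d ->
  `|p22 - (o + h *: c4 2 2 0 0)| <= h * d ->
  omega p00 p10 + omega p10 p20 + omega p20 p21 + omega p21 p22
  - omega p12 p22 - omega p02 p12 - omega p01 p02 - omega p00 p01 = 0 ->
  exists p11, [/\ `|p11 - (o + h *: c4 1 1 0 (- e))| <=
      h * (288 * K * B ^+ 2 * d / `|e|),
    omega (p11 - p00) (p01 - p10) = 0, omega (p21 - p10) (p11 - p20) = 0,
    omega (p22 - p11) (p12 - p21) = 0 & omega (p12 - p01) (p02 - p11) = 0].
Proof.
move=> c4 fr he de dB /sc_close q00 /sc_close q10 /sc_close q20 /sc_close q01.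
move=> /sc_close q21 /sc_close q02 /sc_close q12 /sc_close q22 tot.
have [|p [hp w0 w1 w2 w3]] := block_center fr he de dB q00 q10 q20 q01 q21 q02 q12 q22.
  (* Around a closed polygon the terms containing [o] cancel. *)
  apply: (@mulfI _ (h ^+ 2)); first by rewrite expf_eq0 /= gt_eqF.
  rewrite mulr0 -[RHS]tot -[in RHS](scK p00) -[in RHS](scK p10) -[in RHS](scK p20).
  rewrite -[in RHS](scK p01) -[in RHS](scK p21) -[in RHS](scK p02) -[in RHS](scK p12).
  rewrite -[in RHS](scK p22).
  move: (sc p00) (sc p10) (sc p20) (sc p01) (sc p21) (sc p02) (sc p12) (sc p22).
  move=> r00 r10 r20 r01 r21 r02 r12 r22.
  rewrite !(omegaDl, omegaDr, omegaZl, omegaZr) omegavv.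
  rewrite (omega_skew o r10) (omega_skew o r20) (omega_skew o r01).
  rewrite (omega_skew o r21) (omega_skew o r02) (omega_skew o r12) (omega_skew o r22).
  ring.
have pE : sc (o + h *: p) = p.
  by rewrite /sc addrAC subrr add0r scalerA mulVf ?gt_eqF // scale1r.
exists (o + h *: p); split; last 4 first.
- by rewrite omega_sc pE w0 mulr0.
- by rewrite omega_sc pE w1 mulr0.
- by rewrite omega_sc pE w2 mulr0.
- by rewrite omega_sc pE w3 mulr0.
by apply/sc_close; rewrite pE.
Qed.

End Scale.

(* Filling a 2 x 2 block by sixteen isotropic triangles, given its boundary. *)
Lemma block_fill (B e tau : R) : 0 < B -> 0 < e <= 1 -> 0 < tau ->
  exists2 d, 0 < d & forall (a b mu nu o : W) (h : R)
    (p00 p10 p20 p01 p21 p02 p12 p22 : W),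
  let c4 := comb a b mu nu in
  frame B a b mu nu -> 0 < h ->
  `|p00 - (o + h *: c4 0 0 0 0)| <= h * d ->
  `|p10 - (o + h *: c4 1 0 0 e)| <= h * d ->
  `|p20 - (o + h *: c4 2 0 0 0)| <= h * d ->
  `|p01 - (o + h *: c4 0 1 0 0)| <= h * d ->
  `|p21 - (o + h *: c4 2 1 0 0)| <= h * d ->
  `|p02 - (o + h *: c4 0 2 0 0)| <= h * d ->
  `|p12 - (o + h *: c4 1 2 0 e)| <= h * d ->
  `|p22 - (o + h *: c4 2 2 0 0)| <= h * d ->
  omega p00 p10 + omega p10 p20 + omega p20 p21 + omega p21 p22
  - omega p12 p22 - omega p02 p12 - omega p01 p02 - omega p00 p01 = 0 ->
  exists p11 q00 q10 q01 q11,
   [/\ `|p11 - (o + h *: c4 1 1 0 (- e))| <= h * tau,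
       `|q00 - (o + h *: c4 2^-1 2^-1 (e / 2) 0)| <= h * tau,
       `|q10 - (o + h *: c4 (3 / 2) 2^-1 (- (e / 2)) 0)| <= h * tau,
       `|q01 - (o + h *: c4 2^-1 (3 / 2) (- (e / 2)) 0)| <= h * tau &
       `|q11 - (o + h *: c4 (3 / 2) (3 / 2) (e / 2) 0)| <= h * tau] /\
   [/\ pyramid q00 p00 p10 p11 p01, pyramid q10 p10 p20 p21 p11,
       pyramid q01 p01 p11 p12 p02 & pyramid q11 p11 p21 p22 p12].
Proof.
move=> B0 /andP[e0 e1] tau0.
have K0 : 0 <= K by rewrite ler0n.
have [C [CE C0]] : exists C, C = 288 * K * B ^+ 2 /\ 0 <= C.
  exists (288 * K * B ^+ 2); split; first reflexivity.
  exact: mulr_ge0 (mulr_ge0 (ler0n _ _) K0) (exprn_ge0 _ (ltW B0)).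
have [C' [CE' C'0]] : exists C', C' = 12 * K * B /\ 0 <= C'.
  exists (12 * K * B); split; first reflexivity.
  exact: mulr_ge0 (mulr_ge0 (ler0n _ _) K0) (ltW B0).

(* Two nested tolerances: a boundary within [d] gives a center within [d1], and a base within [d1]
   gives an apex within [tau]. Each solution loses a factor [C / e]. *)
pose d1 := Num.min (Num.min tau (e / (C' + 1)))
  (Num.min (B / 2) (tau * e / (C + 1))).
have c1 : 0 < C' + 1 by rewrite ltr_wpDl.
have c2 : 0 < C + 1 by rewrite ltr_wpDl.
have d1_0 : 0 < d1 by rewrite !lt_min tau0 !divr_gt0 // mulr_gt0.
have d1tau : d1 <= tau by rewrite !ge_min lexx.
have d1e : C' * d1 <= e.
  have : d1 <= e / (C' + 1) by rewrite !ge_min lexx orbT.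
  by rewrite ler_pdivlMr //; move: d1_0; clear; lra.
have d1B : 2 * d1 <= B.
  have : d1 <= B / 2 by rewrite !ge_min lexx !orbT.
  by clear; lra.
have d1t : C * d1 / e <= tau.
  have : d1 <= tau * e / (C + 1) by rewrite !ge_min lexx !orbT.
  by rewrite ler_pdivrMr // ler_pdivlMr //; move: d1_0; clear; lra.
pose d := d1 * (e / (C + 1)).
have d0 : 0 < d by rewrite mulr_gt0 // divr_gt0.
have f1 : e / (C + 1) <= 1.
  by rewrite ler_pdivrMr // mul1r; apply: (le_trans e1); rewrite lerDr.
have dd1 : d <= d1 by have := ler_wpM2l (ltW d1_0) f1; rewrite mulr1.
have dE : C * d / e <= d1.
  rewrite ler_pdivrMr // /d mulrCA ler_pM2l // mulrCA ler_piMr // ?ltW //.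
  by rewrite ltr_pdivrMr // mul1r ltrDl.
clearbody d; clearbody d1.
exists d => // a b mu nu o h p00 p10 p20 p01 p21 p02 p12 p22 c4 fr h0.
move=> q00 q10 q20 q01 q21 q02 q12 q22 tot.
have eE : `|e| = e by rewrite gtr0_norm.
have he : 0 < `|e| <= 1 by rewrite eE e0.
have hNe : 0 < `|- e| <= 1 by rewrite normrN.
have md : h * d <= h * d1 by rewrite ler_pM2l.
have [||p11 [q11 w00 w10 w11 w01]] :=
  block_center_at h0 fr he _ _ q00 q10 q20 q01 q21 q02 q12 q22 tot.
- by rewrite eE -CE'; apply: le_trans d1e; rewrite ler_wpM2l.
- by apply: le_trans d1B; rewrite ler_pM2l.
have {}q11 : `|p11 - (o + h *: c4 1 1 0 (- e))| <= h * d1.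
  by apply: (le_trans q11); rewrite ler_pM2l // eE -CE.
have up (V X : W) : `|V - X| <= h * d -> `|V - X| <= h * d1 by move=> /le_trans; apply.
have d1e' : 12 * K * B * d1 <= `|e| by rewrite eE -CE'.
have d1Ne : 12 * K * B * d1 <= `|- e| by rewrite normrN.
have fin (V X Y : W) : X = Y -> `|V - X| <= h * (288 * K * B ^+ 2 * d1 / `|e|) ->
    `|V - Y| <= h * tau.
  by move=> -> /le_trans; apply; rewrite ler_pM2l // eE -CE.
have vec x y s t x' y' s' t' x2 y2 s2 t2 :
    x + x' = x2 -> y + y' = y2 -> s + s' = s2 -> t + t' = t2 ->
    o + h *: c4 x y s t + h *: c4 x' y' s' t' = o + h *: c4 x2 y2 s2 t2.
  by move=> <- <- <- <-; apply/rowP => i; rewrite /c4 /comb !mxE; ring.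
have vecN x y s t x' y' s' t' x2 y2 s2 t2 :
    x - x' = x2 -> y + y' = y2 -> s - s' = s2 -> t + t' = t2 ->
    o + h *: c4 x y s t + h *: comb (- a) b (- mu) nu x' y' s' t' =
    o + h *: c4 x2 y2 s2 t2.
  by move=> <- <- <- <-; apply/rowP => i; rewrite /c4 /comb !mxE; ring.
have eqv (V X Y : W) c : Y = X -> `|V - X| <= c -> `|V - Y| <= c by move=> ->.
(* All four quadrilaterals are copies of one model. Those on the right are seen from the right edge
   with [a] and [mu] reversed; those on top have [- e] for [e], as their lower side ends at the
   center. Reversing [a] also reverses the order of the base vertices, which [pyramid_rev] and
   [pyramid_rot] restore. *)
have frN := frame_flip fr.
have [|||||r00 t00 y00] := quad_apex_at h0 (o := o) fr he d1e' d1B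
  (A0 := p00) (A1 := p10) (A2 := p11) (A3 := p01).
- exact (up _ _ q00).
- exact (up _ _ q10).
- exact q11.
- exact (up _ _ q01).
- exact: w00.
have [|||||r10 t10 y10] := quad_apex_at h0 (o := o + h *: c4 2 0 0 0) frN he d1e' d1B
  (A0 := p20) (A1 := p10) (A2 := p11) (A3 := p21).
- by apply: (eqv _ _ _ _ _ (up _ _ q20)); apply: vecN; ring.
- by apply: (eqv _ _ _ _ _ (up _ _ q10)); apply: vecN; ring.
- by apply: (eqv _ _ _ _ _ q11); apply: vecN; ring.
- by apply: (eqv _ _ _ _ _ (up _ _ q21)); apply: vecN; ring.
- by rewrite omega_skew w10 oppr0.
have [|||||r01 t01 y01] := quad_apex_at h0 (o := o + h *: c4 0 1 0 0) fr hNe d1Ne d1B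
  (A0 := p01) (A1 := p11) (A2 := p12) (A3 := p02).
- by apply: (eqv _ _ _ _ _ (up _ _ q01)); apply: vec; ring.
- by apply: (eqv _ _ _ _ _ q11); apply: vec; ring.
- by apply: (eqv _ _ _ _ _ (up _ _ q12)); apply: vec; ring.
- by apply: (eqv _ _ _ _ _ (up _ _ q02)); apply: vec; ring.
- exact: w01.
have [|||||r11 t11 y11] := quad_apex_at h0 (o := o + h *: c4 2 1 0 0) frN hNe d1Ne d1B
  (A0 := p21) (A1 := p11) (A2 := p12) (A3 := p22).
- by apply: (eqv _ _ _ _ _ (up _ _ q21)); apply: vecN; ring.
- by apply: (eqv _ _ _ _ _ q11); apply: vecN; ring.
- by apply: (eqv _ _ _ _ _ (up _ _ q12)); apply: vecN; ring.
- by apply: (eqv _ _ _ _ _ (up _ _ q22)); apply: vecN; ring.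
- by rewrite omega_skew w11 oppr0.
exists p11, r00, r10, r01, r11; split; split.
- by apply: (le_trans q11); rewrite ler_pM2l.
- exact (fin _ _ _ (erefl _) t00).
- by apply: (fin _ _ _ _ t10); apply: vecN; field.
- by rewrite normrN in t01; apply: (fin _ _ _ _ t01); apply: vec; field.
- by rewrite normrN in t11; apply: (fin _ _ _ _ t11); apply: vecN; field.
- exact: y00.
- exact: pyramid_rot (pyramid_rot (pyramid_rev y10)).
- exact: y01.
- exact: pyramid_rot (pyramid_rot (pyramid_rev y11)).
Qed.

End Block.

(** * Periodic maps of the plane *)

Section Lipschitz.
Variables (R : realType).

(** Continuity method: the supremum of the times where the bound holds satisfies it, and could be
    exceeded if it were below 1. The hypothesis compares only with the value at [t], which also
    admits maps with corners. *)
Lemma lipschitz_of_local (V : normedModType R) (q : R -> V) (k : R) :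
  (forall t : R, 0 <= t <= 1 -> \forall s \near t, `|q s - q t| <= k * `|s - t|) ->
  `|q 1 - q 0| <= k.
Proof.
move=> loc; pose A := [set t | 0 <= t <= 1 /\ `|q t - q 0| <= k * t].
have A0 : A 0 by split; rewrite ?lexx ?ler01 // subrr normr0 mulr0.
have hA : has_sup A.
  by split; [exists 0|exists 1 => t [/andP[]]].
pose c := sup A.
have c01 : 0 <= c <= 1.
  apply/andP; split; first by apply: sup_upper_bound.
  by apply: ge_sup; [exists 0|move=> t [/andP[]]].
have := loc c c01; rewrite -nbhs_nearE => /nbhs_ballP[r /= r0 hr].
have hr' s : `|c - s| < r -> `|q s - q c| <= k * `|s - c| by move=> h; apply: hr.
have Ac : A c.
  split=> //; have [s [s01 As] cs] := sup_adherent r0 hA.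
  have sc : s <= c by apply: sup_upper_bound => //; split.
  have h := hr' s; rewrite ger0_norm ?subr_ge0 // ltrBlDr addrC -ltrBlDr in h.
  have {h} := h cs; rewrite distrC (distrC s) (ger0_norm (x := c - s)) ?subr_ge0 // => h.
  have -> : q c - q 0 = (q c - q s) + (q s - q 0) by rewrite addrA subrK.
  by apply: (le_trans (ler_normD _ _)); move: h As; clear; lra.
have [c1|c1] := eqVneq c 1; first by case: Ac => _; rewrite c1 mulr1.
have {}c1 : c < 1 by case/andP: c01 => _; rewrite lt_neqAle c1.
pose s := c + Num.min (r / 2) (1 - c).
have m0 : 0 < Num.min (r / 2) (1 - c) by rewrite lt_min divr_gt0 // subr_gt0.
have sr : s - c <= r / 2 by rewrite /s addrAC subrr add0r ge_min lexx.
have s1 : s <= 1.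
  have : Num.min (r / 2) (1 - c) <= 1 - c by rewrite ge_min lexx orbT.
  by rewrite /s; lra.
have cs : c < s by rewrite /s ltrDl.
have As : A s.
  case: Ac => /andP[c0 _] Ac; split; first by rewrite s1 (le_trans c0) // ltW.
  have h : `|q s - q c| <= k * `|s - c|.
    by apply: hr'; rewrite distrC gtr0_norm ?subr_gt0 //; move: sr r0; clear; lra.
  rewrite gtr0_norm ?subr_gt0 // in h.
  have -> : q s - q 0 = (q s - q c) + (q c - q 0) by rewrite addrA subrK.
  by apply: (le_trans (ler_normD _ _)); move: h Ac; clear; lra.
have := sup_upper_bound hA As; rewrite -/c => sc.
by move: (lt_le_trans cs sc); rewrite ltxx.
Qed.

Lemma lipschitz_segment (E V : normedModType R) (g : E -> V) (k : R) (x y : E) :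
  (forall t : R, 0 <= t <= 1 -> \forall z \near x + t *: (y - x),
     `|g z - g (x + t *: (y - x))| <= k * `|z - (x + t *: (y - x))|) ->
  `|g y - g x| <= k * `|y - x|.
Proof.
move=> loc; pose q (t : R) := g (x + t *: (y - x)).
have := @lipschitz_of_local _ q (k * `|y - x|).
rewrite /q scale1r scale0r addr0 [x + (y - x)]addrC subrK; apply=> t t01.
have ct : {for t, continuous (fun s : R => x + s *: (y - x))}.
  apply: continuousD; first exact: cvg_cst.
  exact: scalel_continuous.
have : nbhs t (fun s : R => `|g (x + s *: (y - x)) - g (x + t *: (y - x))| <=
    k * `|x + s *: (y - x) - (x + t *: (y - x))|) by exact: ct _ (loc t t01).
apply: filterS => s h; apply: (le_trans h).
have -> : x + s *: (y - x) - (x + t *: (y - x)) = (s - t) *: (y - x).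
  by rewrite opprD addrACA subrr add0r scalerBl.
by rewrite normrZ mulrCA mulrC -mulrA (mulrC `|y - x|) mulrA.
Qed.

Lemma lipschitz_continuous (E V : normedModType R) (f : E -> V) (C : R) : 0 <= C ->
  (forall z w, `|f z - f w| <= C * `|z - w|) -> continuous f.
Proof.
move=> C0 h z; apply/cvgrPdist_le => e e0.
have c0 : 0 < C + 1 by rewrite ltr_wpDl.
have hz := (cvgrPdist_le _ _).1 (@cvg_id _ (nbhs z)) _ (divr_gt0 e0 c0).
near=> w; apply: (le_trans (h _ _)).
have : `|z - w| <= e / (C + 1) by near: w; exact: hz.
rewrite ler_pdivlMr // mulrDr mulr1 mulrC; apply: le_trans.
by rewrite lerDl.
Unshelve. all: by end_near. Qed.

Lemma diff_near_bound (E V : normedModType R) (f : E -> V) (z : E) (e : R) :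
  differentiable f z -> 0 < e ->
  \forall s \near z, `|f s - f z - 'd f z (s - z)| <= e * `|s - z|.
Proof.
move=> df e0; have [_ ef] := (diff_locallyP z f).1 df.
move/eqaddoP: ef => /(_ e e0) h.
move: h; rewrite (near_shift 0); apply: filterS => u /=.
by rewrite !fctE /= subr0 addrK opprD addrA.
Qed.

End Lipschitz.

Section Periodic.
Variables (R : realType).
Local Notation E := 'rV[R]_2.

Definition zperiodic (X : Type) (f : E -> X) : Prop :=
  forall z (k : 'rV[int]_2), f (z + map_mx intr k) = f z.

Definition unit_box : set E := [set z | forall i, `[0, 1]%classic (z 0 i)].

Lemma unit_box_compact : compact unit_box.
Proof.
by have := @rV_compact R 2 (fun=> `[0, 1]%classic) (fun=> @segment_compact R 0 1).
Qed.

Lemma unit_box_rep (z : E) : exists k : 'rV[int]_2, unit_box (z + map_mx intr k).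
Proof.
exists (\row_i - Num.floor (z 0 i)) => i; rewrite /= !mxE in_itv /= rmorphN /=.
by have := floor_itv (z 0 i); rewrite intrD; case/andP => ? ?; apply/andP; split; lra.
Qed.

(** One [d] serves the compact unit box; translating [z] and [w] by the same lattice vector brings
    every pair there, up to [w] leaving the box by less than [d]. *)
Lemma periodic_unif (V : normedModType R) (f : E -> V) : continuous f ->
  zperiodic f -> forall e, 0 < e -> exists2 d, 0 < d &
  forall z w, `|w - z| < d -> `|f w - f z| < e.
Proof.
move=> cf pf e e0.
have := (compact_near_coveringP _).1 unit_box_compact R (0^'+)
  (fun d z => forall w, `|w - z| < d -> `|f w - f z| < e) _.
case=> [x _|d /= d0 hd].
  have := cf x; move/cvgrPdist_lt/(_ (e / 2)).
  rewrite divr_gt0 // -nbhs_nearE => /(_ isT) /nbhs_ballP[r /= r0 hr].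
  have r2 : 0 < r / 2 by exact: divr_gt0.
  have zn : \forall z \near x, `|x - z| < r / 2.
    by have := nbhsx_ballx x _ r2; rewrite -ball_normE.
  near=> z d => w /= wz.
  have zx : `|x - z| < r / 2 by near: z.
  have dr : d <= r / 2 by near: d; exact: nbhs_right_le.
  have h1 : `|f x - f z| < e / 2.
    by apply: hr; rewrite -ball_normE /=; apply: (lt_trans zx); rewrite ltr_pdivrMr // ltr_pMr // ltr1n.
  have h2 : `|f x - f w| < e / 2.
    apply: hr; rewrite -ball_normE /=.
    have -> : x - w = (x - z) - (w - z) by rewrite opprB addrA subrK.
    apply: (le_lt_trans (ler_normB _ _)).
    by move: zx dr wz; clear; lra.
  have -> : f w - f z = (f x - f z) - (f x - f w) by rewrite opprB [RHS]addrC addrA subrK.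
  by apply: (le_lt_trans (ler_normB _ _)); move: h1 h2; clear; lra.
exists (d / 2); first exact: divr_gt0.
move=> z w zw; have [k zk] := unit_box_rep z.
rewrite -(pf z k) -(pf w k); apply: (hd (d / 2)) => //.
- by rewrite /= sub0r normrN ger0_norm ?ltr_pdivrMr ?ltr_pMr ?ltr1n // ltW // divr_gt0.
- exact: divr_gt0.
- by rewrite opprD addrACA subrr addr0.
Unshelve. all: by end_near. Qed.

Lemma periodic_bounded (V : normedModType R) (f : E -> V) : continuous f ->
  zperiodic f -> exists2 M, 0 < M & forall z, `|f z| <= M.
Proof.
move=> cf pf.
have := (compact_near_coveringP _).1 unit_box_compact R +oo
  (fun M z => `|f z| <= M) _.
case=> [x _|M /= [Mr hM]].
  have := cf x; move/cvgrPdist_lt/(_ 1 ltr01) => near1.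
  near=> z M; rewrite /=.
  have h : `|f x - f z| < 1 by near: z.
  have hM : `|f x| + 1 <= M by near: M; apply: nbhs_pinfty_ge; exact: num_real.
  have -> : f z = f x - (f x - f z) by rewrite opprB addrC subrK.
  by apply: (le_trans (ler_normB _ _)); move: h hM; clear; lra.
exists (`|M| + 1) => [|z]; first by rewrite ltr_wpDl.
have [k zk] := unit_box_rep z; rewrite -(pf z k); apply: hM => //.
by apply: (le_lt_trans (ler_norm _)); rewrite ltrDl.
Unshelve. all: by end_near. Qed.

End Periodic.

(** * The complex structure and the Euclidean product *)

Section ComplexStructure.
Variables (R : realType) (n : nat).
Local Notation W := 'rV[R]_(n * 2).

(** Multiplication by [i]; [omega u (Jmul v)] is the Euclidean inner product of [u] and [v]. *)
Definition Jmul (u : W) : W := mxvec (\matrix_(j < n, c < 2)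
  if c == 0 then - u 0 (mxvec_index j 1) else u 0 (mxvec_index j 0)).

Lemma Jmul_x u j : Jmul u 0 (mxvec_index j 0) = - u 0 (mxvec_index j 1).
Proof. by rewrite mxvecE mxE. Qed.

Lemma Jmul_y u j : Jmul u 0 (mxvec_index j 1) = u 0 (mxvec_index j 0).
Proof. by rewrite mxvecE mxE. Qed.

Lemma JmulB u v : Jmul u - Jmul v = Jmul (u - v).
Proof.
apply/rowP => k; case/mxvec_indexP: k => j c.
by rewrite !mxE !mxvecE !mxE; case: ifP => _; ring.
Qed.

Lemma norm_Jmul u : `|Jmul u| <= `|u|.
Proof.
apply: norm_le_coord => // k; case/mxvec_indexP: k => j c.
by rewrite mxvecE mxE; case: ifP => _; rewrite ?normrN coord_le_norm.
Qed.

Lemma omega_JJ u v : omega (Jmul u) (Jmul v) = omega u v.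
Proof. by apply: eq_bigr => j _; rewrite !Jmul_x !Jmul_y; ring. Qed.

Lemma omega_J_sym u v : omega u (Jmul v) = omega v (Jmul u).
Proof. by apply: eq_bigr => j _; rewrite !Jmul_x !Jmul_y; ring. Qed.

Lemma omega_J_gt0 u : u != 0 -> 0 < omega u (Jmul u).
Proof.
have pos j : 0 <= u 0 (mxvec_index j 0) * Jmul u 0 (mxvec_index j 1) -
    u 0 (mxvec_index j 1) * Jmul u 0 (mxvec_index j 0).
  by rewrite Jmul_x Jmul_y mulrN opprK addr_ge0 // -expr2 sqr_ge0.
rewrite lt_neqAle sumr_ge0 // andbT; apply: contraNN.
rewrite eq_sym psumr_eq0 // => /allP h; apply/eqP/rowP => k.
case/mxvec_indexP: k => j c; have := h j; rewrite mem_index_enum => /(_ isT) /=.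
rewrite Jmul_x Jmul_y mulrN opprK -!expr2 paddr_eq0 ?sqr_ge0 //.
rewrite !sqrf_eq0 => /andP[/eqP h0 /eqP h1]; rewrite mxE.
by case: c => -[|[|//]] i; [rewrite -h0|rewrite -h1]; congr (u _ (mxvec_index _ _)); apply: val_inj.
Qed.

Lemma omega_continuous (T : topologicalType) (f g : T -> W) :
  continuous f -> continuous g -> continuous (fun t => omega (f t) (g t)).
Proof.
move=> cf cg t; apply/cvgrPdist_le => e e0.
pose B := `|f t| + `|g t| + 1.
have B0 : 0 < B by rewrite ltr_wpDl // addr_ge0.
pose d := Num.min B (e / (3 * (n * 2)%:R * B + 1)).
have c0 : 0 <= 3 * (n * 2)%:R * B by rewrite !mulr_ge0 // ltW.
have d0 : 0 < d by rewrite lt_min B0 divr_gt0 // ltr_wpDl.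
have hf := (cvgrPdist_le _ _).1 (cf t) d d0; have hg := (cvgrPdist_le _ _).1 (cg t) d d0.
have dB : d <= B by rewrite ge_min lexx.
have fB : `|f t| <= B by rewrite /B -addrA lerDl addr_ge0.
have gB : `|g t| <= B by rewrite /B addrAC lerDr addr_ge0.
near=> s; rewrite distrC; apply: (@le_trans _ _ (3 * (n * 2)%:R * B * d)).
  apply: omega_close fB gB dB; rewrite distrC.
    by near: s; exact: hf.
  by near: s; exact: hg.
have : d <= e / (3 * (n * 2)%:R * B + 1) by rewrite ge_min lexx orbT.
by rewrite ler_pdivlMr ?ltr_wpDl //; move: d0; clear; lra.
Unshelve. all: by end_near. Qed.

Lemma Jmul_continuous (T : topologicalType) (f : T -> W) :
  continuous f -> continuous (fun t => Jmul (f t)).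
Proof.
move=> cf t; apply/cvgrPdist_le => e e0; have h := (cvgrPdist_le _ _).1 (cf t) e e0.
near=> s; rewrite JmulB; apply: (le_trans (norm_Jmul _)).
by near: s; exact: h.
Unshelve. all: by end_near. Qed.

End ComplexStructure.

Section Plane.
Variable R : realType.
Local Notation E := 'rV[R]_2.

Definition pt (x y : R) : E := \row_(i < 2) (if i == 0 then x else y).

Lemma pt_x x y : pt x y 0 0 = x. Proof. by rewrite mxE. Qed.
Lemma pt_y x y : pt x y 0 1 = y. Proof. by rewrite mxE. Qed.

Lemma eq_pt (z w : E) : z 0 0 = w 0 0 -> z 0 1 = w 0 1 -> z = w.
Proof.
move=> h0 h1; apply/rowP; case=> -[|[|//]] i.
  by rewrite (_ : Ordinal i = 0) //; apply: val_inj.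
by rewrite (_ : Ordinal i = 1) //; apply: val_inj.
Qed.

Lemma pt_eta (z : E) : z = pt (z 0 0) (z 0 1).
Proof. by apply: eq_pt; rewrite (pt_x, pt_y). Qed.

Lemma ptD x y x' y' : pt x y + pt x' y' = pt (x + x') (y + y').
Proof. by apply: eq_pt; rewrite mxE !(pt_x, pt_y). Qed.

Lemma ptB x y x' y' : pt x y - pt x' y' = pt (x - x') (y - y').
Proof. by apply: eq_pt; rewrite mxE [X in _ + X]mxE !(pt_x, pt_y). Qed.

Lemma ptZ k x y : k *: pt x y = pt (k * x) (k * y).
Proof. by apply: eq_pt; rewrite mxE !(pt_x, pt_y). Qed.

Lemma norm_pt x y c : `|x| <= c -> `|y| <= c -> `|pt x y| <= c.
Proof.
move=> hx hy; apply: norm_le_coord => [|i]; first exact: le_trans hx.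
by rewrite mxE; case: ifP.
Qed.

End Plane.

(** * Uniform differentiability and moving frames *)

Section TorusImmersion.
Variables (R : realType) (n : nat).
Local Notation E := 'rV[R]_2.
Local Notation W := 'rV[R]_(n * 2).

Definition lin (a b : W) (u : E) : W := u 0 0 *: a + u 0 1 *: b.

Lemma linD a b u v : lin a b (u + v) = lin a b u + lin a b v.
Proof. by rewrite /lin !mxE !scalerDl addrACA. Qed.

Lemma linN a b u : lin a b (- u) = - lin a b u.
Proof. by rewrite /lin !mxE !scaleNr opprD. Qed.

Lemma linB a b u v : lin a b (u - v) = lin a b u - lin a b v.
Proof. by rewrite linD linN. Qed.

Lemma lin_subl a b a' b' u : lin a b u - lin a' b' u = lin (a - a') (b - b') u.
Proof. by rewrite /lin !scalerBr opprD addrACA. Qed.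

Lemma norm_lin a b u : `|lin a b u| <= (`|a| + `|b|) * `|u|.
Proof.
apply: (le_trans (ler_normD _ _)); rewrite !normrZ mulrDl.
by apply: lerD; rewrite mulrC ler_wpM2l // coord_le_norm.
Qed.

(* [f] is a periodic isotropic C^1 immersion of the plane with partial
   derivatives [a] and [b]. *)
Definition torus_immersion (f a b : E -> W) : Prop :=
  [/\ zperiodic f, zperiodic a, zperiodic b, continuous a & continuous b] /\
  [/\ forall (z : E) (e : R), 0 < e ->
        \forall s \near z, `|f s - f z - lin (a z) (b z) (s - z)| <= e * `|s - z|,
      forall z : E, omega (a z) (b z) = 0 &
      forall (z : E) (x y : R), x *: a z + y *: b z = 0 -> x = 0 /\ y = 0].

Variables f a b : E -> W.
Hypothesis tf : torus_immersion f a b.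

Lemma tangent_unif (e : R) : 0 < e -> exists2 d, 0 < d &
  forall z w u : E, `|w - z| < d ->
    `|lin (a w) (b w) u - lin (a z) (b z) u| <= e * `|u|.
Proof.
case: tf => -[_ pa pb ca cb] _ e0; have e2 : 0 < e / 2 by rewrite divr_gt0.
have [d1 d10 h1] := periodic_unif ca pa e2.
have [d2 d20 h2] := periodic_unif cb pb e2.
exists (Num.min d1 d2) => [|z w u]; first by rewrite lt_min d10.
rewrite lt_min => /andP[/h1 {}h1 /h2 {}h2].
rewrite lin_subl; apply: (le_trans (norm_lin _ _ _)); apply: ler_wpM2r => //.
by move: h1 h2; clear; lra.
Qed.

(** Mean value inequality for [f] minus its linearization at [z], whose derivative is small near
    [z], at a radius that periodicity makes independent of [z]. *)
Lemma strict_diff (e : R) : 0 < e -> exists2 d, 0 < d &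
  forall z x y : E, `|x - z| < d -> `|y - z| < d ->
    `|f y - f x - lin (a z) (b z) (y - x)| <= e * `|y - x|.
Proof.
move=> e0; have e2 : 0 < e / 2 by rewrite divr_gt0.
have [d d0 hd] := tangent_unif e2; exists d => // z x y xz yz.
pose g (w : E) := f w - lin (a z) (b z) w.
have -> : f y - f x - lin (a z) (b z) (y - x) = g y - g x.
  by rewrite linB /g !opprD !opprK addrACA.
apply: (@lipschitz_segment _ _ _ g) => t /andP[t0 t1].
set w := x + t *: (y - x).
have wz : `|w - z| < d.
  have -> : w - z = (1 - t) *: (x - z) + t *: (y - z).
    by rewrite /w; apply/rowP => i; rewrite !mxE; ring.
  apply: (le_lt_trans (ler_normD _ _)); rewrite !normrZ ger0_norm ?subr_ge0 //.
  rewrite (ger0_norm t0).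
  have [->|tn] := eqVneq t 0; first by rewrite subr0 mul1r mul0r addr0.
  have {tn t0} t0 : 0 < t by rewrite lt_neqAle eq_sym tn.
  have : (1 - t) * `|x - z| <= (1 - t) * d by rewrite ler_wpM2l ?subr_ge0 // ltW.
  have : t * `|y - z| < t * d by rewrite ltr_pM2l.
  by clear; lra.
have [_ [df _ _]] := tf.
have := df w (e / 2) e2; apply: filterS => s hs.
have -> : g s - g w = (f s - f w - lin (a w) (b w) (s - w)) +
    (lin (a w) (b w) (s - w) - lin (a z) (b z) (s - w)).
  by rewrite addrA subrK /g !linB; apply/rowP => i; rewrite !mxE; ring.
apply: (le_trans (ler_normD _ _)).
have h := hd z w (s - w) wz.
by rewrite [e in e * _](_ : e = e / 2 + e / 2) ?mulrDl ?lerD //; field.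
Qed.

(** [mu] and [nu] are [Jmul] of the basis of the tangent plane that is dual to [(a, b)] for the
    Euclidean product, [D] being the Gram determinant. As [Jmul] preserves [omega] and the plane is
    isotropic, [omega mu nu = 0]. *)
Lemma exists_frame : exists (B : R) (mu nu : E -> W),
  [/\ 0 < B, continuous nu, zperiodic mu, zperiodic nu &
      forall z, frame B (a z) (b z) (mu z) (nu z)].
Proof.
have [[_ pa pb ca cb] [_ ab inj]] := tf.
pose ip (u v : W) : R := omega u (Jmul v).
have ipc (g h : E -> W) : continuous g -> continuous h -> continuous (fun z : E => ip (g z) (h z)).
  by move=> cg ch; apply: omega_continuous => //; apply: Jmul_continuous.
pose D (z : E) := ip (a z) (a z) * ip (b z) (b z) - ip (a z) (b z) * ip (a z) (b z).
have cZ (s : E -> R) (g : E -> W) : continuous s -> continuous g ->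
    continuous (fun z => s z *: g z) by move=> cs cg z; exact: cvgZ (cs z) (cg z).
have cB (g h : E -> W) : continuous g -> continuous h ->
    continuous (fun z => g z - h z) by move=> cg ch z; exact: cvgB (cg z) (ch z).
have bp z : 0 < ip (b z) (b z).
  apply: omega_J_gt0; apply/eqP => bz; have := inj z 0 1.
  by rewrite bz scale0r scaler0 addr0 => /(_ erefl)[_ /eqP]; rewrite oner_eq0.
have ipB (u v w : W) (k l : R) : ip (k *: u - l *: v) w = k * ip u w - l * ip v w.
  by rewrite /ip omegaDl omegaNl !omegaZl.
have ipC (u v : W) : ip u v = ip v u by exact: omega_J_sym.
have Dp z : 0 < D z.
  (* The squared norm of this nonzero vector is [ip b b * D]. *)
  have : 0 < ip (ip (b z) (b z) *: a z - ip (a z) (b z) *: b z)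
               (ip (b z) (b z) *: a z - ip (a z) (b z) *: b z).
    apply: omega_J_gt0; apply/eqP; rewrite -scaleNr => /inj[/eqP].
    by rewrite gt_eqF.
  rewrite ipB !(ipC _ (_ - _)) !ipB (ipC (b z) (a z)).
  have -> : ip (b z) (b z) *
      (ip (b z) (b z) * ip (a z) (a z) - ip (a z) (b z) * ip (a z) (b z)) -
      ip (a z) (b z) *
      (ip (b z) (b z) * ip (a z) (b z) - ip (a z) (b z) * ip (b z) (b z)) =
    ip (b z) (b z) * D z by rewrite /D; ring.
  by rewrite pmulr_rgt0.
pose mu (z : E) : W := (D z)^-1 *: Jmul (ip (b z) (b z) *: a z - ip (a z) (b z) *: b z).
pose nu (z : E) : W := (D z)^-1 *: Jmul (ip (a z) (a z) *: b z - ip (a z) (b z) *: a z).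
have cD : continuous (fun z => (D z)^-1).
  move=> z; apply: continuousV; first by rewrite gt_eqF.
  apply: continuousB; first by apply: continuousM; apply: ipc.
  by apply: continuousM; apply: ipc.
have cm : continuous mu.
  by apply: (cZ) => //; apply: Jmul_continuous; apply: (cB); apply: (cZ) => //; exact: ipc.
have cn : continuous nu.
  by apply: (cZ) => //; apply: Jmul_continuous; apply: (cB); apply: (cZ) => //; exact: ipc.
have pm : zperiodic mu by move=> z k; rewrite /mu /D pa pb.
have pn : zperiodic nu by move=> z k; rewrite /nu /D pa pb.
have [Ba Ba0 hBa] := periodic_bounded ca pa; have [Bb Bb0 hBb] := periodic_bounded cb pb.
have [Bm Bm0 hBm] := periodic_bounded cm pm; have [Bn Bn0 hBn] := periodic_bounded cn pn.
exists (Ba + Bb + Bm + Bn), mu, nu; split=> // [|z].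
  by rewrite !addr_gt0.
have iM (u v w : W) (k l m : R) : omega u (m *: Jmul (k *: v - l *: w)) =
    m * (k * ip u v - l * ip u w).
  by rewrite omegaZr -/(ip _ _) ipC ipB (ipC v) (ipC w).
split; split=> //.
- rewrite iM -(mulVf (x := D z)) ?gt_eqF //; congr (_ * _); rewrite /D; ring.
- by rewrite iM (_ : _ - _ = 0) ?mulr0 //; ring.
- by rewrite iM (ipC (b z) (a z)) (_ : _ - _ = 0) ?mulr0 //; ring.
- rewrite iM (ipC (b z) (a z)) -(mulVf (x := D z)) ?gt_eqF //; congr (_ * _); rewrite /D; ring.
- rewrite omegaZl omegaZr omega_JJ !omegaDl !omegaDr !omegaNl !omegaNr !omegaZl !omegaZr.
  by rewrite !omegavv (omega_skew (b z)) ab; ring.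
- by apply: (le_trans (hBa z)); rewrite -!addrA lerDl !addr_ge0 // ltW.
- by apply: (le_trans (hBb z)); rewrite -!addrA addrCA lerDl !addr_ge0 // ltW.
- by apply: (le_trans (hBm z)); rewrite addrAC lerDr !addr_ge0 // ltW.
- by apply: (le_trans (hBn z)); rewrite lerDr !addr_ge0 // ltW.
Qed.

End TorusImmersion.

(** * The action of a periodic isotropic immersion *)

Section Action.
Variables (R : realType) (n : nat).
Local Notation E := 'rV[R]_2.
Local Notation W := 'rV[R]_(n * 2).

Lemma pow_half m : 2 ^- m.+1 = 2 ^- m / 2 :> R.
Proof. by rewrite exprSr invfM. Qed.

(** The intervals of radius [2 C 2 ^- m] around [u m] are nested. *)
Lemma geometric_limit (u : nat -> R) (C : R) :
  (forall m, `|u m.+1 - u m| <= C * 2 ^- m) ->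
  exists l, forall m, `|l - u m| <= 2 * C * 2 ^- m.
Proof.
move=> h; pose lo m := u m - 2 * C * 2 ^- m; pose hi m := u m + 2 * C * 2 ^- m.
have loS m : lo m <= lo m.+1.
  have := h m; rewrite ler_norml => /andP[+ _]; rewrite /lo pow_half.
  by move: (u m) (u m.+1) (2 ^- m) => x y z; clear; lra.
have hiS m : hi m.+1 <= hi m.
  have := h m; rewrite ler_norml => /andP[_]; rewrite /hi pow_half.
  by move: (u m) (u m.+1) (2 ^- m) => x y z; clear; lra.
have lohi m : lo m <= hi m.
  have C0 : 0 <= C * 2 ^- m by apply: le_trans (h m).
  by rewrite /lo /hi; move: C0; clear; lra.
have loD m k : lo m <= lo (m + k)%N.
  by elim: k => [|k IH]; rewrite ?addn0 // addnS (le_trans IH).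
have hiD m k : hi (m + k)%N <= hi m.
  by elim: k => [|k IH]; rewrite ?addn0 // addnS (le_trans (hiS _)).
have cross m k : lo m <= hi k.
  by apply: (le_trans (loD m k)); apply: (le_trans (lohi _)); rewrite addnC.
exists (sup (range lo)) => m.
have ub : has_sup (range lo).
  by split; [exists (lo 0); exists 0%N|exists (hi 0) => _ [k _ <-]].
have h1 : lo m <= sup (range lo) by apply: sup_upper_bound => //; exists m.
have h2 : sup (range lo) <= hi m.
  by apply: ge_sup => [|_ [k _ <-]]; [exists (lo 0); exists 0%N|].
move: h1 h2; rewrite /lo /hi ler_norml => h1 h2.
by apply/andP; split; move: h1 h2; clear; lra.
Qed.

Lemma small_exp (C e : R) : 0 < e -> exists m, C * 2 ^- m < e.
Proof.
move=> e0; have [m hm] : exists m : nat, C / e < m%:R.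
  exists (Num.truncn `|C / e|).+1; apply: (le_lt_trans (ler_norm _)).
  by have /andP[] := truncn_itv (normr_ge0 (C / e)).
exists m; rewrite ltr_pdivrMr ?exprn_gt0 //.
rewrite ltr_pdivrMr // in hm; apply: (lt_le_trans hm); rewrite mulrC.
apply: ler_wpM2l; first exact: ltW.
by rewrite -natrX ler_nat ltnW // ltn_expl.
Qed.

Variables f a b : E -> W.
Hypothesis tf : torus_immersion f a b.

(* Twice the [omega]-area swept, seen from the origin, by the polygon with
   vertices [f (z + i v / 2 ^ m)]. *)
Fixpoint action (m : nat) (z v : E) : R :=
  if m is m'.+1 then action m' z (2^-1 *: v) + action m' (z + 2^-1 *: v) (2^-1 *: v)
  else omega (f z) (f (z + v)).

Definition circulation m z u v :=
  action m z u + action m (z + u) v - action m (z + v) u - action m z v.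

Lemma action_periodic m z k v : action m (z + map_mx intr k) v = action m z v.
Proof.
have [[pf _ _ _ _] _] := tf.
elim: m z v => [|m IH] z v /=; first by rewrite addrAC !pf.
by rewrite IH addrAC IH.
Qed.

Lemma half_half (v : E) : 2^-1 *: v + 2^-1 *: v = v.
Proof. by rewrite -scalerDl (_ : 2^-1 + 2^-1 = 1) ?scale1r //; field. Qed.

Lemma circulationS m z u v : let u' := 2^-1 *: u in let v' := 2^-1 *: v in
  circulation m.+1 z u v = circulation m z u' v' + circulation m (z + u') u' v' +
    circulation m (z + v') u' v' + circulation m (z + u' + v') u' v'.
Proof.
move=> u' v'; rewrite /circulation /= -/u' -/v'.
have e1 : z + u' + u' = z + u by rewrite -addrA half_half.
have e2 : z + v' + v' = z + v by rewrite -addrA half_half.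
have e3 : z + v' + u' = z + u' + v' by rewrite addrAC.
have e4 : z + u' + v' + u' = z + u + v' by rewrite addrAC e1.
have e5 : z + u' + v' + v' = z + v + u' by rewrite -addrA half_half addrAC.
by rewrite e1 e2 e3 e4 e5; ring.
Qed.

Lemma half_norm (v : E) : `|2^-1 *: v| = `|v| / 2.
Proof. by rewrite normrZ ger0_norm ?invr_ge0 // mulrC. Qed.

Lemma lin_bound : exists2 M, 0 < M & forall z u, `|lin (a z) (b z) u| <= M * `|u|.
Proof.
have [[_ pa pb ca cb] _] := tf.
have [Ma Ma0 ha] := periodic_bounded ca pa; have [Mb Mb0 hb] := periodic_bounded cb pb.
exists (Ma + Mb) => [|z u]; first exact: addr_gt0.
by apply: (le_trans (norm_lin _ _ _)); rewrite ler_wpM2r // lerD.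
Qed.

(** Differences of values of [f] near [z] are tangent vectors at [z] up to [o(s)], and [omega]
    vanishes on the tangent plane: isotropy makes areas [o(s^2)] instead of [O(s^2)]. *)
Lemma small_area (e : R) : 0 < e -> exists2 d, 0 < d &
  forall (z x y x' y' : E) (s : R), s < d ->
    `|x - z| <= s -> `|y - z| <= s -> `|x' - z| <= s -> `|y' - z| <= s ->
    `|omega (f y - f x) (f y' - f x')| <= e * s ^+ 2.
Proof.
move=> e0; have [M M0 hM] := lin_bound.
(* [omega_close] with vectors of size [2 M s] and errors [2 r s] gives [3 * 2 * 2 = 12]. *)
pose c := 12 * (n * 2)%:R * M + 1.
have c0 : 0 < c by rewrite ltr_wpDl // !mulr_ge0 // ltW.
pose r := Num.min M (e / c).
have r0 : 0 < r by rewrite lt_min M0 divr_gt0.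
have rM : r <= M by rewrite ge_min lexx.
have rc : 12 * (n * 2)%:R * M * r <= e.
  have : r <= e / c by rewrite ge_min lexx orbT.
  by rewrite ler_pdivlMr // /c; move: r0; clear -tf; lra.
clearbody r.
have [d d0 hd] := strict_diff tf r0.
exists d => // z x y x' y' s sd xs ys xs' ys'.
have s0 : 0 <= s by exact: le_trans xs.
have dist p q : `|p - z| <= s -> `|q - z| <= s -> `|q - p| <= 2 * s.
  move=> ps qs; have -> : q - p = (q - z) - (p - z) by rewrite opprB addrA subrK.
  by apply: (le_trans (ler_normB _ _)); move: ps qs; clear -tf; lra.
have L p q : `|p - z| <= s -> `|q - z| <= s ->
    `|f q - f p - lin (a z) (b z) (q - p)| <= r * (2 * s) /\
    `|lin (a z) (b z) (q - p)| <= M * (2 * s).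
  move=> ps qs; split.
    apply: (le_trans (hd z p q (le_lt_trans ps sd) (le_lt_trans qs sd))).
    by rewrite ler_pM2l // dist.
  by apply: (le_trans (hM _ _)); rewrite ler_pM2l // dist.
have [h1 h2] := L _ _ xs ys; have [h1' h2'] := L _ _ xs' ys'.
have [_ [_ ab _]] := tf.
have lag u v : omega (lin (a z) (b z) u) (lin (a z) (b z) v) = 0.
  rewrite /lin !omegaDl !omegaDr !omegaZl !omegaZr !omegavv.
  by rewrite (omega_skew (b z)) ab; ring.
have := omega_close h1 h1' h2 h2'; rewrite lag subr0 => h; apply: (le_trans (h _)).
  by rewrite ler_wpM2r // mulr_ge0.
have := ler_wpM2r (sqr_ge0 s) rc; rewrite expr2.
by congr (_ <= _); ring.
Qed.

(** The refinement adds [2 ^ m] triangles of size [|v| / 2 ^ m], each with an area at most [e] times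
    the square of its size. *)
Lemma action_step (e : R) : 0 < e -> exists2 d, 0 < d &
  forall m z v, `|v| < d -> `|action m.+1 z v - action m z v| <= e * `|v| ^+ 2 * 2 ^- m.
Proof.
move=> e0; have [d d0 hd] := small_area e0; exists d => // m.
elim: m => [|m IH] z v vd.
  rewrite expr0 invr1 mulr1 /= -[z + _ + _]addrA half_half.
  have -> : omega (f z) (f (z + 2^-1 *: v)) + omega (f (z + 2^-1 *: v)) (f (z + v)) -
      omega (f z) (f (z + v)) =
      omega (f (z + 2^-1 *: v) - f z) (f (z + v) - f (z + 2^-1 *: v)).
    rewrite !omegaDl !omegaDr !omegaNl !omegaNr omegavv.
    by clear -tf; lra.
  have h0 : `|z + 2^-1 *: v - z| <= `|v|.
    by rewrite addrAC subrr add0r half_norm ler_pdivrMr // ler_peMr // ler1n.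
  have h1 : `|z + v - z| <= `|v| by rewrite addrAC subrr add0r.
  by apply: (hd z) => //; rewrite ?subrr ?normr0.
have v2 : `|2^-1 *: v| < d.
  by apply: le_lt_trans vd; rewrite half_norm ler_pdivrMr // ler_peMr // ler1n.
have E m' w : action m'.+1 w v =
  action m' w (2^-1 *: v) + action m' (w + 2^-1 *: v) (2^-1 *: v) by [].
rewrite (E m.+1) (E m) opprD addrACA.
have := IH z _ v2; have := IH (z + 2^-1 *: v) _ v2.
rewrite half_norm (pow_half m) => h1 h2.
apply: (le_trans (ler_normD _ _)); apply: (le_trans (lerD h2 h1)).
by rewrite le_eqVlt; apply/orP; left; apply/eqP; field.
Qed.

(** For [m = 0] the circulation is [omega] of the two diagonals; a subdivision yields four
    parallelograms of half the size, which preserves a bound quadratic in [s]. *)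
Lemma circulation_bound (e : R) : 0 < e -> exists2 d, 0 < d &
  forall m z u v s, s < d -> `|u| <= s -> `|v| <= s ->
    `|circulation m z u v| <= e * s ^+ 2.
Proof.
move=> e0; have e4 : 0 < e / 4 by rewrite divr_gt0.
have [d d0 hd] := small_area e4; exists (d / 2); first by rewrite divr_gt0.
elim=> [|m IH] z u v s sd us vs.
  have s0 : 0 <= s by exact: le_trans us.
  have -> : circulation 0 z u v =
      omega (f (z + u + v) - f z) (f (z + v) - f (z + u)).
    rewrite /circulation /= (addrAC z v u).
    rewrite !omegaDl !omegaDr !omegaNl !omegaNr.
    by rewrite (omega_skew (f (z + u + v)) (f (z + u))) (omega_skew (f (z + v))) ; ring.
  have := hd z z (z + u + v) (z + u) (z + v) (2 * s).
  have -> : e / 4 * (2 * s) ^+ 2 = e * s ^+ 2 by field.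
  apply.
  - by move: sd; clear -tf; lra.
  - by rewrite subrr normr0 mulr_ge0.
  - rewrite -[z + u + v]addrA addrAC subrr add0r; apply: (le_trans (ler_normD _ _)).
    by move: us vs; clear -tf; lra.
  - by rewrite addrAC subrr add0r; move: us s0; clear -tf; lra.
  - by rewrite addrAC subrr add0r; move: vs s0; clear -tf; lra.
have s0 : 0 <= s by exact: le_trans us.
have s2 : s / 2 < d / 2 by move: sd s0; clear -tf; lra.
have u2 : `|2^-1 *: u| <= s / 2 by rewrite half_norm; move: us; clear -tf; lra.
have v2 : `|2^-1 *: v| <= s / 2 by rewrite half_norm; move: vs; clear -tf; lra.
rewrite circulationS /=.
have h w := IH w _ _ _ s2 u2 v2.
apply: (le_trans (ler_normD _ _)); apply: (le_trans (lerD (ler_normD _ _) (lexx _))).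
apply: (le_trans (lerD (lerD (ler_normD _ _) (lexx _)) (lexx _))).
apply: (le_trans (lerD (lerD (lerD (h _) (h _)) (h _)) (h _))).
by rewrite le_eqVlt; apply/orP; left; apply/eqP; field.
Qed.

Lemma circulation_scale k m z u v c :
  (forall z, `|circulation m z (2 ^- k *: u) (2 ^- k *: v)| <= c) ->
  `|circulation (k + m) z u v| <= 4 ^+ k * c.
Proof.
elim: k u v z => [|k IH] u v z h.
  by have := h z; rewrite expr0 invr1 !scale1r mul1r.
have {}h w : `|circulation (k + m) w (2^-1 *: u) (2^-1 *: v)| <= 4 ^+ k * c.
  by apply: IH => z'; have := h z'; rewrite pow_half -!scalerA.
rewrite addSn circulationS /=.
apply: (le_trans (ler_normD _ _)); apply: (le_trans (lerD (ler_normD _ _) (lexx _))).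
apply: (le_trans (lerD (lerD (ler_normD _ _) (lexx _)) (lexx _))).
apply: (le_trans (lerD (lerD (lerD (h _) (h _)) (h _)) (h _))).
by rewrite le_eqVlt; apply/orP; left; apply/eqP; rewrite exprS; ring.
Qed.

(** Stokes by subdivision: [4 ^ k] parallelograms of size [s / 2 ^ k] contribute at most [c s^2] in
    all, for any [c > 0] once [k] is large. *)
Lemma circulation_vanish z u v (e : R) : 0 < e ->
  exists k, forall m, `|circulation (k + m) z u v| <= e.
Proof.
move=> e0; pose s := `|u| + `|v|.
have s0 : 0 <= s by rewrite addr_ge0.
have c0 : 0 < s ^+ 2 + 1 by rewrite ltr_wpDl // sqr_ge0.
have [d d0 hd] := circulation_bound (divr_gt0 e0 c0).
have [k hk] := small_exp s d0.
have p0 : 0 < 2 ^- k :> R by rewrite invr_gt0 exprn_gt0.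
exists k => m; apply: (le_trans (circulation_scale (c := e / (s ^+ 2 + 1) * (s * 2 ^- k) ^+ 2) _ _)).
  move=> w; apply: hd => //; rewrite normrZ (gtr0_norm p0) mulrC ler_pM2r //.
    by rewrite /s lerDl.
  by rewrite /s lerDr.
have -> : 4 ^+ k * (e / (s ^+ 2 + 1) * (s * 2 ^- k) ^+ 2) = e / (s ^+ 2 + 1) * s ^+ 2.
  have -> : 4 ^+ k = 2 ^+ k * 2 ^+ k :> R.
    by rewrite -exprMn (_ : 2 * 2 = 4) //; ring.
  have : 2 ^+ k != 0 :> R by rewrite expf_neq0.
  move: (2 ^+ k) => t t0; field.
  by rewrite t0 gt_eqF.
rewrite mulrAC ler_pdivrMr // ler_pM2l //.
by rewrite lerDl.
Qed.

(* The limit of [action m z v] is twice the integral of the Liouville form over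
   the [f]-image of the segment [z, z + v]; it has no circulation since [f] is
   isotropic. *)
Lemma exists_action : exists T : E -> E -> R,
  (forall (z : E) (k : 'rV[int]_2) (v : E), T (z + map_mx intr k) v = T z v) /\
  forall e : R, 0 < e -> exists2 d : R, 0 < d & forall z u v : E, `|u| < d -> `|v| < d ->
    T z u + T (z + u) v = T (z + v) u + T z v /\
    `|T z u - (omega (f z) (f (z + 2^-1 *: u)) +
               omega (f (z + 2^-1 *: u)) (f (z + u)))| <= e * `|u| ^+ 2.
Proof.
pose P z v (l : R) := exists C, forall m, `|l - action m z v| <= C * 2 ^- m.
pose T z v := xget 0 [set l | P z v l].
have Puniq z v l l' : P z v l -> P z v l' -> l = l'.
  move=> [C h] [C' h']; apply/eqP; rewrite -subr_eq0 -normr_le0 leNgt.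
  apply/negP => /(small_exp (C + C'))[m].
  rewrite ltNge => /negP; apply.
  have -> : l - l' = (l - action m z v) - (l' - action m z v) by ring.
  by apply: (le_trans (ler_normB _ _)); rewrite mulrDl lerD.
have TE z v l : P z v l -> T z v = l.
  by move=> Pl; apply: (Puniq z v) => //; apply: (xgetPex 0 (ex_intro _ l Pl)).
exists T; split.
  move=> z k v; rewrite /T; congr (xget _ _); apply/funext => l /=.
  by rewrite /P; under eq_fun do under eq_forall do rewrite action_periodic.
move=> e e0; have [d1 d10 h1] := action_step ltr01.
have [d2 d20 h2] := action_step e0.
have TP z v : `|v| < d1 -> forall m, `|T z v - action m z v| <= 2 * `|v| ^+ 2 * 2 ^- m.
  move=> vd; have [l hl] := geometric_limit (fun m => h1 m z v vd).
  rewrite (TE z v l) => [m|]; first by have := hl m; rewrite mul1r.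
  by eexists; exact: hl.
exists (Num.min d1 d2) => [|z u v]; first by rewrite lt_min d10.
rewrite !lt_min => /andP[u1 u2] /andP[v1 v2]; split.
  apply/eqP; rewrite -subr_eq0 -normr_le0 leNgt; apply/negP.
  set t := _ - _ => t0; have t2 : 0 < `|t| / 2 by rewrite divr_gt0.
  have [k hk] := circulation_vanish z u v t2.
  have [m hm] := small_exp (4 * `|u| ^+ 2 + 4 * `|v| ^+ 2) t2.
  have le : 2 ^- (k + m) <= 2 ^- m :> R.
    rewrite exprD invfM ler_piMl ?invr_ge0 ?exprn_ge0 // invf_le1 ?exprn_gt0 //.
    by rewrite exprn_ege1 // ler1n.
  have b1 := TP z u u1 (k + m)%N; have b2 := TP (z + u) v v1 (k + m)%N.
  have b3 := TP (z + v) u u1 (k + m)%N; have b4 := TP z v v1 (k + m)%N.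
  have tE : t = circulation (k + m) z u v +
      ((T z u - action (k + m) z u) + (T (z + u) v - action (k + m) (z + u) v) -
       (T (z + v) u - action (k + m) (z + v) u) - (T z v - action (k + m) z v)).
    by rewrite /t /circulation; ring.
  have : `|t| <= `|t| / 2 + (4 * `|u| ^+ 2 + 4 * `|v| ^+ 2) * 2 ^- m.
    rewrite {1}tE; apply: (le_trans (ler_normD _ _)); apply: lerD; first exact: hk.
    apply: (le_trans (ler_normB _ _)); apply: (le_trans (lerD (ler_normB _ _) (lexx _))).
    apply: (le_trans (lerD (lerD (ler_normD _ _) (lexx _)) (lexx _))).
    apply: (@le_trans _ _ ((4 * `|u| ^+ 2 + 4 * `|v| ^+ 2) * 2 ^- (k + m))).
      by move: b1 b2 b3 b4; clear -tf; lra.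
    by apply: ler_wpM2l le; rewrite addr_ge0 // mulr_ge0 // sqr_ge0.
  by move: hm t0; clear -tf; lra.
(* The sequence starts at [action 1], the action of the segment broken at its midpoint, to which [T]
   has to be compared. *)
have step m : `|action m.+2 z u - action m.+1 z u| <= e * `|u| ^+ 2 / 2 * 2 ^- m.
  by have := h2 m.+1 z u u2; rewrite pow_half [_ * 2^-1]mulrC mulrA.
have [l hl] := geometric_limit (u := fun m => action m.+1 z u) step.
have E m : 2 * (e * `|u| ^+ 2 / 2) * 2 ^- m = e * `|u| ^+ 2 * 2 ^- m by field.
have l0 : `|l - action 1 z u| <= e * `|u| ^+ 2.
  by have := hl 0%N; rewrite E expr0 invr1 mulr1.
rewrite (TE z u l); first by move: l0; rewrite /= -[z + _ + _]addrA half_half.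
exists (2 * e * `|u| ^+ 2); case=> [|m].
  rewrite expr0 invr1 mulr1.
  have -> : l - action 0 z u = (l - action 1 z u) + (action 1 z u - action 0 z u).
    by rewrite addrA subrK.
  have := h2 0%N z u u2; rewrite expr0 invr1 mulr1 => h0.
  by apply: (le_trans (ler_normD _ _)); move: l0 h0; clear -tf; lra.
have := hl m; rewrite E pow_half => /le_trans; apply.
by rewrite le_eqVlt; apply/orP; left; apply/eqP; field.
Qed.

End Action.

(** * Broken edges with prescribed action *)

Section EdgeMidpoint.
Variables (R : realType) (n : nat).
Local Notation E := 'rV[R]_2.
Local Notation W := 'rV[R]_(n * 2).
Local Notation K := ((n * 2)%:R : R).

Variables (f a b nu : E -> W) (T : E -> E -> R) (B : R).
Hypothesis tf : torus_immersion f a b.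
Hypothesis nu_cont : continuous nu.
Hypothesis nu_per : zperiodic nu.
Hypothesis B_gt0 : 0 < B.
Hypothesis nuB : forall z, `|nu z| <= B.
Hypothesis T_approx : forall e : R, 0 < e -> exists2 d : R, 0 < d &
  forall z u v : E, `|u| < d -> `|v| < d ->
    T z u + T (z + u) v = T (z + v) u + T z v /\
    `|T z u - (omega (f z) (f (z + 2^-1 *: u)) +
               omega (f (z + 2^-1 *: u)) (f (z + u)))| <= e * `|u| ^+ 2.

(* The middle vertex of the broken edge from [f w] to [f (w + 2 h ev)]: the
   [nu]-component is the prescribed wiggle, the [c]-component corrects the
   action of the broken edge to that of the curved one. *)
Definition edge_mid (ev : E) (c : E -> W) (k h : R) (w : E) : W :=
  let m := f (w + h *: ev) + (h * k) *: nu w in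
  let chord := f (w + (2 * h) *: ev) - f w in
  m + ((T w ((2 * h) *: ev) - omega m chord) / omega (c w) chord) *: c w.

(** The defect of the action is [o(h^2)], since the wiggle pairs to zero with the tangent along
    [ev], while [c] pairs with the chord at order [h]. So the exact correction has size [o(h)]. *)
Lemma edge_mid_close (ev : E) (c : E -> W) (k d : R) :
  `|ev| <= 1 -> (forall z, `|c z| <= B) ->
  (forall z, `|omega (c z) (lin (a z) (b z) ev)| = 1) ->
  (forall z, k * omega (nu z) (lin (a z) (b z) ev) = 0) ->
  0 < d -> exists2 d', 0 < d' & forall h z w, 0 < h < d' -> `|w - z| <= 2 * h ->
    omega (f w) (edge_mid ev c k h w) +
      omega (edge_mid ev c k h w) (f (w + (2 * h) *: ev)) = T w ((2 * h) *: ev) /\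
    `|edge_mid ev c k h w -
       (f z + lin (a z) (b z) (w - z + h *: ev) + (h * k) *: nu z)| <= h * d.
Proof.
move=> ev1 cB c1 k0 d0.
(* The errors in units of [eta * h]: 3 from expanding [f] at distance at most [3 h], [|k|] from the
   variation of [nu], the rest from the correction along [c]. *)
pose C := 3 + `|k| + B * (4 + 2 * `|k| * K * B).
have K0 : 0 <= K by exact: ler0n.
have B0 := ltW B_gt0.
have C0 : 0 < C + 2 * K * B + 1.
  by rewrite ltr_wpDl // /C !(addr_ge0, mulr_ge0).
pose eta := Num.min (d / (C + 2 * K * B + 1)) (2 * K * B + 1)^-1.
have KB0 : 0 < 2 * K * B + 1 by rewrite ltr_wpDl // !mulr_ge0.
have eta0 : 0 < eta by rewrite lt_min divr_gt0 //= invr_gt0.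
have etaC : eta * C <= d.
  have : eta <= d / (C + 2 * K * B + 1) by rewrite ge_min lexx.
  rewrite ler_pdivlMr //; apply: le_trans; rewrite ler_pM2l // -addrA lerDl.
  exact: ltW.
have etaK : 2 * K * B * eta <= 1.
  have : eta <= (2 * K * B + 1)^-1 by rewrite ge_min lexx orbT.
  rewrite -div1r ler_pdivlMr // mulrDr mulr1 mulrC; apply: le_trans.
  by rewrite lerDl ltW.
clearbody eta.
have [d1 d10 h1] := strict_diff tf eta0.
have [d2 d20 h2] := periodic_unif nu_cont nu_per eta0.
have [d3 d30 h3] := T_approx eta0.
pose d' := Num.min (d1 / 4) (Num.min (d2 / 4) (d3 / 4)).
exists d' => [|h z w /andP[h0 hd'] wz]; first by rewrite !lt_min !divr_gt0.
have hd1 : 4 * h < d1 by move: hd'; rewrite !lt_min => /andP[+ _]; clear -tf nu_cont nu_per B_gt0 nuB T_approx; lra.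
have hd2 : 4 * h < d2 by move: hd'; rewrite !lt_min => /and3P[_ + _]; clear -tf nu_cont nu_per B_gt0 nuB T_approx; lra.
have hd3 : 4 * h < d3 by move: hd'; rewrite !lt_min => /and3P[_ _ +]; clear -tf nu_cont nu_per B_gt0 nuB T_approx; lra.
clear hd'; clearbody d'.
have hev : `|h *: ev| <= h.
  by rewrite normrZ gtr0_norm // ler_piMr // ltW.
have h2ev : `|(2 * h) *: ev| <= 2 * h.
  by rewrite normrZ gtr0_norm ?mulr_gt0 // ler_piMr // mulr_ge0 // ltW.
set v := (2 * h) *: ev; set chord := f (w + v) - f w.
have v2 : 2^-1 *: v = h *: ev by rewrite scalerA mulKf.
pose r := chord - (2 * h) *: lin (a w) (b w) ev.
have rB : `|r| <= eta * (2 * h).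
  have := h1 w w (w + v).
  rewrite subrr normr0 addrAC subrr add0r => h1'.
  have rE : r = f (w + v) - f w - lin (a w) (b w) v.
    by rewrite /r /v /lin !mxE scalerDr !scalerA.
  rewrite rE; apply: (le_trans (h1' d10 _)); last by rewrite ler_pM2l.
  by apply: le_lt_trans h2ev _; move: hd1 h0; clear -tf nu_cont nu_per B_gt0 nuB T_approx; lra.
have chE : chord = (2 * h) *: lin (a w) (b w) ev + r by rewrite /r addrC subrK.
have oc u : `|u| <= B -> `|omega u chord - 2 * h * omega u (lin (a w) (b w) ev)| <=
    h * (2 * K * B * eta).
  move=> uB; rewrite chE omegaDr omegaZr addrAC subrr add0r.
  apply: (le_trans (omega_bound _ _)).
  have -> : h * (2 * K * B * eta) = K * B * (eta * (2 * h)) by ring.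
  by apply: ler_pM => //; rewrite ler_wpM2l.
have den : h <= `|omega (c w) chord|.
  have e1 := oc _ (cB w).
  have e2 : `|2 * h * omega (c w) (lin (a w) (b w) ev)| = 2 * h.
    by rewrite normrM c1 mulr1 gtr0_norm // mulr_gt0.
  have e3 : h * (2 * K * B * eta) <= h by rewrite ler_piMr // ltW.
  have := ler_normB (omega (c w) chord)
    (omega (c w) chord - 2 * h * omega (c w) (lin (a w) (b w) ev)).
  by rewrite opprB addrC subrK e2; move: e1 e3; clear -tf nu_cont nu_per B_gt0 nuB T_approx; lra.
have den0 : omega (c w) chord != 0.
  by rewrite -normr_gt0; exact: lt_le_trans den.
set m := f (w + h *: ev) + (h * k) *: nu w.
set x := (T w v - omega m chord) / omega (c w) chord.
have EM : edge_mid ev c k h w = m + x *: c w by [].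
rewrite EM; split.
  have -> : omega (f w) (m + x *: c w) + omega (m + x *: c w) (f (w + v)) =
      omega (m + x *: c w) chord.
    move: (m + x *: c w) => M.
    by rewrite /chord [RHS]omegaDr omegaNr (omega_skew (f w)) addrC.
  by rewrite omegaDl omegaZl /x divfK // addrC subrK.
have num : `|T w v - omega m chord| <= h * h * (4 + 2 * `|k| * K * B) * eta.
  have t1 : `|T w v - omega (f (w + h *: ev)) chord| <= eta * (2 * h) ^+ 2.
    have -> : omega (f (w + h *: ev)) chord =
        omega (f w) (f (w + 2^-1 *: v)) + omega (f (w + 2^-1 *: v)) (f (w + v)).
      by rewrite v2 /chord omegaDr omegaNr -(omega_skew (f w)) addrC.
    have vd3 : `|v| < d3.
      by apply: (le_lt_trans h2ev); move: hd3 h0; clear -tf nu_cont nu_per B_gt0 nuB T_approx; lra.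
    have [_ h3'] := h3 w v v vd3 vd3.
    apply: (le_trans h3'); rewrite ler_pM2l //.
    by rewrite ler_pXn2r // nnegrE ?mulr_ge0 // ltW.
  have t2 : `|(h * k) * omega (nu w) chord| <= h * `|k| * (h * (2 * K * B * eta)).
    have -> : (h * k) * omega (nu w) chord = h * (k * (omega (nu w) chord -
        2 * h * omega (nu w) (lin (a w) (b w) ev))).
      by rewrite [k * (_ - _)]mulrBr [k * (_ * _ * _)]mulrCA k0 mulr0 subr0 mulrA.
    rewrite normrM (gtr0_norm h0) -[leRHS]mulrA (ler_pM2l h0) normrM.
    by apply: ler_wpM2l => //; exact: oc.
  rewrite /m omegaDl omegaZl opprD addrA.
  apply: (le_trans (ler_normB _ _)).
  have -> : h * h * (4 + 2 * `|k| * K * B) * eta =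
    eta * (2 * h) ^+ 2 + h * `|k| * (h * (2 * K * B * eta)) by ring.
  exact: lerD.
have xB : `|x *: c w| <= h * (4 + 2 * `|k| * K * B) * eta * B.
  rewrite normrZ; apply: ler_pM => //.
  rewrite /x normrM normfV ler_pdivrMr ?normr_gt0 //.
  apply: (le_trans num).
  have -> : h * h * (4 + 2 * `|k| * K * B) * eta =
    h * (4 + 2 * `|k| * K * B) * eta * h by ring.
  by apply: ler_wpM2l => //; rewrite !(mulr_ge0, addr_ge0) // ltW.
have fB : `|f (w + h *: ev) - f z - lin (a z) (b z) (w - z + h *: ev)| <= eta * (3 * h).
  have D : w + h *: ev - z = w - z + h *: ev by rewrite addrAC.
  have s3 : `|w - z + h *: ev| <= 3 * h.
    by apply: (le_trans (ler_normD _ _)); move: wz hev; clear -tf nu_cont nu_per B_gt0 nuB T_approx; lra.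
  have := h1 z z (w + h *: ev); rewrite D subrr normr0 => h1'.
  apply: (le_trans (h1' d10 _)); last by rewrite ler_pM2l.
  by apply: le_lt_trans s3 _; move: hd1 h0; clear -tf nu_cont nu_per B_gt0 nuB T_approx; lra.
have nB : `|(h * k) *: (nu w - nu z)| <= h * `|k| * eta.
  rewrite normrZ normrM (gtr0_norm h0); apply: ler_wpM2l; first by rewrite mulr_ge0 // ltW.
  apply: ltW; apply: h2; apply: le_lt_trans wz _.
  by move: hd2 h0; clear -tf nu_cont nu_per B_gt0 nuB T_approx; lra.
have -> : m + x *: c w - (f z + lin (a z) (b z) (w - z + h *: ev) + (h * k) *: nu z) =
    (f (w + h *: ev) - f z - lin (a z) (b z) (w - z + h *: ev)) +
    (h * k) *: (nu w - nu z) + x *: c w.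
  by rewrite /m; apply/rowP => i; rewrite !mxE; ring.
apply: (le_trans (ler_normD _ _)); apply: (le_trans (lerD (ler_normD _ _) (lexx _))).
apply: (le_trans (lerD (lerD fB nB) xB)).
have := ler_wpM2l (ltW h0) etaC; apply: le_trans.
by rewrite le_eqVlt; apply/orP; left; apply/eqP; rewrite /C; ring.
Qed.

Lemma edge_mid_periodic ev c k h : zperiodic c ->
  (forall (z : E) (k : 'rV[int]_2) (v : E), T (z + map_mx intr k) v = T z v) ->
  zperiodic (edge_mid ev c k h).
Proof.
have [[pf _ _ _ _] _] := tf.
move=> pc pT z l; rewrite /edge_mid pc pT nu_per.
by rewrite !(addrAC z (map_mx intr l)) !pf.
Qed.

End EdgeMidpoint.

(** * Assembling the blocks into a periodic grid *)

Section Grid.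
Variables (R : realType) (n : nat).
Local Notation E := 'rV[R]_2.
Local Notation W := 'rV[R]_(n * 2).
Variables f a b : E -> W.
Hypothesis tf : torus_immersion f a b.

(** [X] and [Y] hold the midpoints of the horizontal and vertical edges starting at a point, so
    adjacent blocks share them; the tuple holds what is private to the block, its center and four
    apexes. *)
Definition block_filling (X Y : E -> W) (e h : R) (z : E) (t : W * W * W * W * W) : Prop :=
  let: (p11, q00, q10, q01, q11) := t in
  [/\ `|p11 - f (z + pt h h)| <= h * e,
      `|q00 - f (z + pt (h / 2) (h / 2))| <= h * e,
      `|q10 - f (z + pt (3 * h / 2) (h / 2))| <= h * e,
      `|q01 - f (z + pt (h / 2) (3 * h / 2))| <= h * e &
      `|q11 - f (z + pt (3 * h / 2) (3 * h / 2))| <= h * e] /\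
  [/\ pyramid q00 (f z) (X z) p11 (Y z),
      pyramid q10 (X z) (f (z + pt (2 * h) 0)) (Y (z + pt (2 * h) 0)) p11,
      pyramid q01 (Y z) p11 (X (z + pt 0 (2 * h))) (f (z + pt 0 (2 * h))) &
      pyramid q11 p11 (Y (z + pt (2 * h) 0)) (f (z + pt (2 * h) (2 * h)))
        (X (z + pt 0 (2 * h)))].

Lemma exists_block_filling (e : R) : 0 < e -> exists2 d, 0 < d &
  forall h, 0 < h < d -> exists X Y : E -> W,
    [/\ zperiodic X, zperiodic Y,
        forall z, `|X z - f (z + pt h 0)| <= h * e,
        forall z, `|Y z - f (z + pt 0 h)| <= h * e &
        forall z, exists t, block_filling X Y e h z t].
Proof.
move=> e0; have [B [mu [nu [B0 cn pm pn fr]]]] := exists_frame tf.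
have [T [pT hT]] := exists_action tf.
have muB z : `|mu z| <= B by have [_ [_ _ _ h _]] := fr z.
have nuB z : `|nu z| <= B by have [_ [_ _ _ _ h]] := fr z.
(* The wiggle takes a quarter of the error allowed; it is fixed before [d], which depends on it. *)
pose k := Num.min 1 (e / (4 * B)).
have k0 : 0 < k by rewrite lt_min ltr01 divr_gt0 // mulr_gt0.
have k1 : k <= 1 by rewrite ge_min lexx.
have kB : k * B <= e / 4.
  have : k <= e / (4 * B) by rewrite ge_min lexx orbT.
  by rewrite ler_pdivlMr ?mulr_gt0 //; clear -tf; lra.
clearbody k.
have e4 : 0 < e / 4 by rewrite divr_gt0.
have k01 : 0 < k <= 1 by rewrite k0.
have [d d0 fill] := block_fill n B0 k01 e4.
have linx z : lin (a z) (b z) (pt 1 0) = a z by rewrite /lin pt_x pt_y scale1r scale0r addr0.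
have liny z : lin (a z) (b z) (pt 0 1) = b z by rewrite /lin pt_x pt_y scale1r scale0r add0r.
pose dd := Num.min d (e / 4).
have dd0 : 0 < dd by rewrite lt_min d0.
have ddd : dd <= d by rewrite ge_min lexx.
have dde : dd <= e / 4 by rewrite ge_min lexx orbT.
clearbody dd.
have nx : `|pt 1 0 : E| <= 1 by apply: norm_pt; rewrite ?normr1 ?normr0.
have ny : `|pt 0 1 : E| <= 1 by apply: norm_pt; rewrite ?normr1 ?normr0.
(* On horizontal edges [nu] pairs to zero with [a] and can carry the wiggle, the correction being
   along [mu]. On vertical edges [nu] is the direction dual to [b]: it carries the correction and
   there is no wiggle. *)
have [||dX dX0 hX] := edge_mid_close tf cn pn B0 nuB hT nx muB (k := k) _ _ dd0.
- by move=> z; rewrite linx omega_skew; have [[_ -> _ _ _] _] := fr z; rewrite normrN normr1.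
- by move=> z; rewrite linx omega_skew; have [[_ _ -> _ _] _] := fr z; rewrite oppr0 mulr0.
have [||dY dY0 hY] := edge_mid_close tf cn pn B0 nuB hT ny nuB (k := 0) _ _ dd0.
- by move=> z; rewrite liny omega_skew; have [[_ _ _ _ ->] _] := fr z; rewrite normrN normr1.
- by move=> z; rewrite mul0r.
have dd4 : 0 < dd / 4 by rewrite divr_gt0.
have [dF dF0 hF] := strict_diff tf dd4.
have [dT dT0 hT'] := hT 1 ltr01.
pose dm := Num.min (Num.min dX dY) (Num.min (dF / 4) (dT / 4)).
exists dm => [|h /andP[h0]]; first by rewrite !lt_min dX0 dY0 !divr_gt0.
rewrite !lt_min => /andP[/andP[hx hy] /andP[hf ht]]; clear dm.
have h2 : `|pt (2 * h) 0 : E| <= 2 * h.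
  by apply: norm_pt; rewrite ?normr0 ?ger0_norm ?mulr_ge0 // ltW.
have h2' : `|pt 0 (2 * h) : E| <= 2 * h.
  by apply: norm_pt; rewrite ?normr0 ?ger0_norm ?mulr_ge0 // ltW.
pose X := edge_mid f nu T (pt 1 0) mu k h; pose Y := edge_mid f nu T (pt 0 1) nu 0 h.
have F z x y : `|x| <= 2 * h -> `|y| <= 2 * h ->
    `|f (z + pt x y) - (f z + (x *: a z + y *: b z))| <= h * (dd / 2).
  move=> hx' hy'; have np : `|pt x y : E| <= 2 * h by exact: norm_pt.
  have := hF z z (z + pt x y); rewrite subrr normr0 addrAC subrr add0r => h1.
  have E1 : lin (a z) (b z) (pt x y) = x *: a z + y *: b z by rewrite /lin pt_x pt_y.
  rewrite E1 in h1; rewrite opprD addrA; apply: (le_trans (h1 dF0 _)).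
    by apply: le_lt_trans np _; move: hf h0; clear -tf; lra.
  apply: (@le_trans _ _ (dd / 4 * (2 * h))); first by rewrite ler_pM2l.
  by rewrite le_eqVlt; apply/orP; left; apply/eqP; field.
have pt0 z : z + pt 0 0 = z :> E by apply: eq_pt; rewrite mxE ?pt_x ?pt_y addr0.
have XE z x y : `|x| <= 2 * h -> `|y| <= 2 * h ->
    `|X (z + pt x y) - (f z + ((x + h) *: a z + y *: b z + (h * k) *: nu z))| <= h * dd.
  move=> hx' hy'; have hhx : 0 < h < dX by rewrite h0.
  have wE : z + pt x y - z = pt x y by rewrite addrAC subrr add0r.
  have wz : `|z + pt x y - z| <= 2 * h by rewrite wE; exact: norm_pt.
  have [_] := hX h z _ hhx wz; rewrite wE; congr (`|_ - _| <= _).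
  by apply/rowP => i; rewrite /lin !mxE /=; ring.
have YE z x y : `|x| <= 2 * h -> `|y| <= 2 * h ->
    `|Y (z + pt x y) - (f z + (x *: a z + (y + h) *: b z))| <= h * dd.
  move=> hx' hy'; have hhy : 0 < h < dY by rewrite h0.
  have wE : z + pt x y - z = pt x y by rewrite addrAC subrr add0r.
  have wz : `|z + pt x y - z| <= 2 * h by rewrite wE; exact: norm_pt.
  have [_] := hY h z _ hhy wz; rewrite wE; congr (`|_ - _| <= _).
  by apply/rowP => i; rewrite /lin !mxE /=; ring.
have XT z : omega (f z) (X z) + omega (X z) (f (z + pt (2 * h) 0)) = T z (pt (2 * h) 0).
  have hhx : 0 < h < dX by rewrite h0.
  have zz : `|z - z| <= 2 * h by rewrite subrr normr0 mulr_ge0 // ltW.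
  have [+ _] := hX h z z hhx zz; rewrite (_ : (2 * h) *: pt 1 0 = pt (2 * h) 0) //.
  by rewrite ptZ mulr1 mulr0.
have YT z : omega (f z) (Y z) + omega (Y z) (f (z + pt 0 (2 * h))) = T z (pt 0 (2 * h)).
  have hhy : 0 < h < dY by rewrite h0.
  have zz : `|z - z| <= 2 * h by rewrite subrr normr0 mulr_ge0 // ltW.
  have [+ _] := hY h z z hhy zz; rewrite (_ : (2 * h) *: pt 0 1 = pt 0 (2 * h)) //.
  by rewrite ptZ mulr1 mulr0.
have near_pt (p q r : W) (c c' c'' : R) : `|p - q| <= c -> `|r - q| <= c' ->
    c + c' <= c'' -> `|p - r| <= c''.
  move=> pq rq; apply: le_trans; have -> : p - r = (p - q) - (r - q).
    by rewrite opprB addrA subrK.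
  by apply: (le_trans (ler_normB _ _)); apply: lerD.
have hh : h <= 2 * h by move: h0; clear -tf; lra.
exists X, Y; split.
- exact (edge_mid_periodic tf pn _ _ _ pm pT).
- exact (edge_mid_periodic tf pn _ _ _ pn pT).
- move=> z; have := XE z 0 0; rewrite normr0 mulr_ge0 ?(ltW h0) // => /(_ isT isT).
  rewrite pt0 add0r scale0r addr0 => h1.
  have := F z h 0; rewrite normr0 (gtr0_norm h0) => h3.
  have {}h3 : `|f (z + pt h 0) + (h * k) *: nu z - (f z + (h *: a z + (h * k) *: nu z))| <= h * (dd / 2).
    have := h3; rewrite hh mulr_ge0 ?(ltW h0) // => /(_ isT isT).
    by congr (`|_| <= _); apply/rowP => i; rewrite !mxE; ring.
  have h4 : `|(h * k) *: nu z| <= h * (e / 4).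
    rewrite normrZ gtr0_norm ?mulr_gt0 // -mulrA ler_pM2l //.
    by apply: le_trans kB; rewrite ler_pM2l.
  have h5 : `|X z - (f (z + pt h 0) + (h * k) *: nu z)| <= h * dd + h * (dd / 2).
    exact: near_pt h1 h3 (lexx _).
  have -> : X z - f (z + pt h 0) =
      (X z - (f (z + pt h 0) + (h * k) *: nu z)) + (h * k) *: nu z.
    by rewrite opprD addrA subrK.
  apply: (le_trans (ler_normD _ _)); apply: (le_trans (lerD h5 h4)).
  by rewrite -!mulrDr ler_pM2l //; move: dde e0; clear -tf; lra.
- move=> z; have := YE z 0 0; rewrite normr0 mulr_ge0 ?(ltW h0) // => /(_ isT isT).
  rewrite pt0 add0r scale0r add0r => h1.
  have := F z 0 h; rewrite normr0 (gtr0_norm h0) hh mulr_ge0 ?(ltW h0) // => /(_ isT isT).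
  rewrite scale0r add0r => h3; apply: near_pt h1 h3 _.
  by rewrite -!mulrDr ler_pM2l //; move: dde e0; clear -tf; lra.
move=> z.
have up (p q : W) c x : p = q -> c <= h * d -> `|x - p| <= c -> `|x - q| <= h * d.
  by move=> -> le1 le2; exact: le_trans le1.
have hdd : h * dd <= h * d by rewrite ler_pM2l.
have hdd2 : h * (dd / 2) <= h * d.
  by rewrite ler_pM2l //; move: dd0 ddd; clear -tf; lra.
have h00 : 0 <= h := ltW h0.
have n0 : `|0 : R| <= 2 * h by rewrite normr0 mulr_ge0.
have nn2 : `|2 * h| <= 2 * h by rewrite ger0_norm // mulr_ge0.
pose c4 := comb (a z) (b z) (mu z) (nu z).
have c1 : `|f z - (f z + h *: c4 0 0 0 0)| <= h * d.
  rewrite (_ : c4 0 0 0 0 = 0) ?scaler0 ?addr0 ?subrr ?normr0 ?mulr_ge0 // ?(ltW d0) //.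
  by rewrite /c4 /comb !scale0r !addr0.
have c2 : `|X z - (f z + h *: c4 1 0 0 k)| <= h * d.
  have := XE z 0 0 n0 n0; rewrite pt0; apply: up hdd.
  by apply/rowP => i; rewrite /c4 /comb !mxE; ring.
have c3 : `|f (z + pt (2 * h) 0) - (f z + h *: c4 2 0 0 0)| <= h * d.
  have := F z _ _ nn2 n0; apply: up hdd2.
  by apply/rowP => i; rewrite /c4 /comb !mxE; ring.
have c5 : `|Y z - (f z + h *: c4 0 1 0 0)| <= h * d.
  have := YE z 0 0 n0 n0; rewrite pt0; apply: up hdd.
  by apply/rowP => i; rewrite /c4 /comb !mxE; ring.
have c6 : `|Y (z + pt (2 * h) 0) - (f z + h *: c4 2 1 0 0)| <= h * d.
  have := YE z _ _ nn2 n0; apply: up hdd.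
  by apply/rowP => i; rewrite /c4 /comb !mxE; ring.
have c7 : `|f (z + pt 0 (2 * h)) - (f z + h *: c4 0 2 0 0)| <= h * d.
  have := F z _ _ n0 nn2; apply: up hdd2.
  by apply/rowP => i; rewrite /c4 /comb !mxE; ring.
have c8 : `|X (z + pt 0 (2 * h)) - (f z + h *: c4 1 2 0 k)| <= h * d.
  have := XE z _ _ n0 nn2; apply: up hdd.
  by apply/rowP => i; rewrite /c4 /comb !mxE; ring.
have c9 : `|f (z + pt (2 * h) (2 * h)) - (f z + h *: c4 2 2 0 0)| <= h * d.
  have := F z _ _ nn2 nn2; apply: up hdd2.
  by apply/rowP => i; rewrite /c4 /comb !mxE; ring.
have e22 : z + pt (2 * h) 0 + pt 0 (2 * h) = z + pt (2 * h) (2 * h).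
  by rewrite -addrA ptD addr0 add0r.
have e22' : z + pt 0 (2 * h) + pt (2 * h) 0 = z + pt (2 * h) (2 * h).
  by rewrite -addrA ptD addr0 add0r.
(* Each broken edge has action [T], and [T] has no circulation around the block. *)
have tot : omega (f z) (X z) + omega (X z) (f (z + pt (2 * h) 0)) +
    omega (f (z + pt (2 * h) 0)) (Y (z + pt (2 * h) 0)) +
    omega (Y (z + pt (2 * h) 0)) (f (z + pt (2 * h) (2 * h))) -
    omega (X (z + pt 0 (2 * h))) (f (z + pt (2 * h) (2 * h))) -
    omega (f (z + pt 0 (2 * h))) (X (z + pt 0 (2 * h))) -
    omega (Y z) (f (z + pt 0 (2 * h))) - omega (f z) (Y z) = 0.
  have t1 := XT z; have t2 := YT z; have t3 := XT (z + pt 0 (2 * h)).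
  have t4 := YT (z + pt (2 * h) 0); rewrite e22' in t3; rewrite e22 in t4.
  have [||t5 _] := hT' z (pt (2 * h) 0) (pt 0 (2 * h)).
  - by apply: le_lt_trans h2 _; move: ht h0; clear -tf; lra.
  - by apply: le_lt_trans h2' _; move: ht h0; clear -tf; lra.
  by move: t1 t2 t3 t4 t5; clear; lra.
have [p11 [q00 [q10 [q01 [q11 [[b11 b00 b10 b01 b11'] pyr]]]]]] :=
  fill _ _ _ _ _ _ _ _ _ _ _ _ _ _ (fr z) h0 c1 c2 c3 c5 c6 c7 c8 c9 tot.
exists (p11, q00, q10, q01, q11); split; last exact: pyr.
have close (p : W) x y s t : `|x| <= 2 -> `|y| <= 2 -> `|s| + `|t| <= k ->
    `|p - (f z + h *: c4 x y s t)| <= h * (e / 4) ->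
    `|p - f (z + pt (h * x) (h * y))| <= h * e.
  move=> x2 y2 st hp.
  have [xh yh] : `|h * x| <= 2 * h /\ `|h * y| <= 2 * h.
    by rewrite !normrM (gtr0_norm h0) !(mulrC h) !ler_pM2r.
  have hf1 := F z _ _ xh yh.
  have hc : `|h *: c4 0 0 s t| <= h * (e / 4).
    rewrite normrZ (gtr0_norm h0) ler_pM2l //; apply: le_trans kB.
    apply: (le_trans (comb_bound (fr z) _ _ _ _)).
    by rewrite !normr0 !add0r ler_pM2r.
  have -> : p - f (z + pt (h * x) (h * y)) =
     (p - (f z + h *: c4 x y s t)) -
     (f (z + pt (h * x) (h * y)) - (f z + ((h * x) *: a z + (h * y) *: b z))) +
     h *: c4 0 0 s t.
    by apply/rowP => i; rewrite /c4 /comb !mxE; ring.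
  apply: (le_trans (ler_normD _ _)); apply: (le_trans (lerD (ler_normB _ _) (lexx _))).
  apply: (le_trans (lerD (lerD hp hf1) hc)).
  by rewrite -!mulrDr ler_pM2l //; move: dde e0; clear -tf; lra.
have k2 : k / 2 <= k by move: k0; clear -tf; lra.
have st1 : `|0 : R| + `|- k| <= k by rewrite normr0 add0r normrN gtr0_norm.
have st2 : `|k / 2| + `|0 : R| <= k by rewrite normr0 addr0 gtr0_norm // divr_gt0.
have st3 : `|- (k / 2)| + `|0 : R| <= k by rewrite normrN.
have l1 : `|1 : R| <= 2 by rewrite normr1 ler1n.
have l2 : `|2^-1 : R| <= 2 by rewrite ger0_norm ?invr_ge0 //; clear -tf; lra.
have l3 : `|3 / 2 : R| <= 2 by rewrite ger0_norm ?divr_ge0 //; clear -tf; lra.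
split.
- by have := close _ _ _ _ _ l1 l1 st1 b11; rewrite !mulr1.
- exact (close _ _ _ _ _ l2 l2 st2 b00).
- by have := close _ _ _ _ _ l3 l2 st3 b10; rewrite mulrCA mulrA.
- by have := close _ _ _ _ _ l2 l3 st3 b01; rewrite [h * (3 / 2)]mulrCA mulrA.
- by have := close _ _ _ _ _ l3 l3 st2 b11'; rewrite [h * (3 / 2)]mulrCA mulrA.
Qed.

End Grid.

Section IsotropicGrid.
Variables (R : realType) (n : nat).
Local Notation E := 'rV[R]_2.
Local Notation W := 'rV[R]_(n * 2).

(** [G0] sits over the lattice points and [G1] over the centers of the squares. The errors are
    measured against the mesh [1 / M], so that difference quotients are controlled too. *)
Definition isotropic_grid (f : E -> W) (e : R) (M : nat) (G0 G1 : int -> int -> W) : Prop :=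
  [/\ forall i j, G0 (i + M%:Z) j = G0 i j, forall i j, G0 i (j + M%:Z) = G0 i j,
      forall i j, G1 (i + M%:Z) j = G1 i j & forall i j, G1 i (j + M%:Z) = G1 i j] /\
  forall i j : int,
  [/\ `|G0 i j - f (pt (i%:~R / M%:R) (j%:~R / M%:R))| <= e / M%:R,
      `|G1 i j - f (pt ((i%:~R + 2^-1) / M%:R) ((j%:~R + 2^-1) / M%:R))| <= e / M%:R &
      pyramid (G1 i j) (G0 i j) (G0 (i + 1) j) (G0 (i + 1) (j + 1)) (G0 i (j + 1))].

Lemma exists_isotropic_grid (f a b : E -> W) (e : R) (N0 : nat) :
  torus_immersion f a b -> 0 < e ->
  exists M G0 G1, (N0 < M)%N /\ isotropic_grid f e M G0 G1.
Proof.
move=> tf e0; have [[pf _ _ _ _] _] := tf.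
have [d d0 hd] := exists_block_filling tf e0.
pose N := (maxn N0 (Num.truncn d^-1)).+1.
have N00 : 0 < N%:R :> R by rewrite ltr0n.
(* The period is even, so that blocks of two squares by two tile the torus. *)
pose M := (2 * N)%N; pose h : R := M%:R^-1.
have M0 : 0 < M%:R :> R by rewrite ltr0n.
have h0 : 0 < h by rewrite invr_gt0.
have hdlt : h < d.
  rewrite /h -[d]invrK ltf_pV2 ?posrE ?invr_gt0 //.
  have di : 0 <= d^-1 by rewrite invr_ge0 ltW.
  have /andP[_ t] := truncn_itv di; apply: (lt_le_trans t).
  by rewrite ler_nat /M /N; lia.
have hMN : M%:R * h = 1 by rewrite /h mulfV // gt_eqF.
have [X [Y [pX pY Xc Yc fillz]]] : exists X Y : E -> W,
    [/\ zperiodic X, zperiodic Y,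
        forall z, `|X z - f (z + pt h 0)| <= h * e,
        forall z, `|Y z - f (z + pt 0 h)| <= h * e &
        forall z, exists t, block_filling f X Y e h z t].
  by apply: hd; rewrite h0.
have hN : 2 * h * (N%:Z)%:~R = 1.
  by have := hMN; rewrite -pmulrn {1}/M natrM -mulrA [N%:R * h]mulrC mulrA.
clearbody h.
pose C z := xget (0, 0, 0, 0, 0) [set t | block_filling f X Y e h z t].
have CP z : block_filling f X Y e h z (C z).
  have [t tP] := fillz z; exact: (xgetPex (0, 0, 0, 0, 0) (ex_intro _ t tP)).
(* Fillings of translated blocks form the same set, and a choice made from equal sets is equal. *)
have Cper z k : C (z + map_mx intr k) = C z.
  rewrite /C; congr (xget _ _); apply/funext => -[[[[p11 q00] q10] q01] q11] /=.
  by rewrite !(addrAC z (map_mx intr k)) !pf !pX !pY.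
clearbody C.
pose zb (I J : int) : E := pt (2 * h * I%:~R) (2 * h * J%:~R).
(* The parities of [i] and [j] tell the place in a block: corner, vertical midpoint, horizontal
   midpoint or center. *)
pose G0 (i j : int) : W := let z := zb (i %/ 2)%Z (j %/ 2)%Z in
  if (i %% 2)%Z == 0 then if (j %% 2)%Z == 0 then f z else Y z
  else if (j %% 2)%Z == 0 then X z else (C z).1.1.1.1.
pose G1 (i j : int) : W := let z := zb (i %/ 2)%Z (j %/ 2)%Z in
  if (i %% 2)%Z == 0 then if (j %% 2)%Z == 0 then (C z).1.1.1.2 else (C z).1.2
  else if (j %% 2)%Z == 0 then (C z).1.1.2 else (C z).2.
have dv0 (I : int) : ((2 * I) %/ 2)%Z = I by lia.
have md0 (I : int) : ((2 * I) %% 2)%Z = 0 by lia.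
have dv1 (I : int) : ((2 * I + 1) %/ 2)%Z = I by lia.
have md1 (I : int) : ((2 * I + 1) %% 2)%Z = 1 by lia.
have par (i : int) : exists I : int, i = 2 * I \/ i = 2 * I + 1.
  by exists (i %/ 2)%Z; lia.
have zbM1 I J : zb (I + N%:Z) J = zb I J + map_mx intr (\row_k (if k == 0 then 1 else 0)).
  by apply: eq_pt; rewrite !mxE /= ?addr0 // intrD mulrDr hN.
have zbM2 I J : zb I (J + N%:Z) = zb I J + map_mx intr (\row_k (if k == 0 then 0 else 1)).
  by apply: eq_pt; rewrite !mxE /= ?addr0 // intrD mulrDr hN.
have dvM (i : int) : ((i + M%:Z) %/ 2)%Z = ((i %/ 2)%Z + N%:Z) by rewrite /M; lia.
have mdM (i : int) : ((i + M%:Z) %% 2)%Z = (i %% 2)%Z by rewrite /M; lia.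
exists M, G0, G1; split; first by rewrite /M /N; lia.
split.
  by split=> i j; rewrite /G0 /G1 dvM mdM ?zbM1 ?zbM2 Cper ?pf ?pX ?pY.
have zx I J : zb (I + 1) J = zb I J + pt (2 * h) 0.
  by rewrite /zb ptD addr0 intrD mulrDr mulr1.
have zy I J : zb I (J + 1) = zb I J + pt 0 (2 * h).
  by rewrite /zb ptD addr0 intrD mulrDr mulr1.
have zxy I J : zb (I + 1) (J + 1) = zb I J + pt (2 * h) (2 * h).
  by rewrite /zb ptD !intrD !mulrDr !mulr1.
have s2 (I : int) : 2 * I + 1 + 1 = 2 * (I + 1) by ring.
have he : h * e = e / M%:R.
  by apply: (mulfI (x := M%:R)); rewrite ?gt_eqF // mulrA hMN mul1r mulrC divfK ?gt_eqF.
have hM : M%:R^-1 = h.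
  by apply: (mulfI (x := M%:R)); rewrite ?gt_eqF // hMN mulfV ?gt_eqF.
move=> i j; rewrite -he hM.
have [I [->|->]] := par i; have [J [->|->]] := par j.
all: have := CP (zb I J); case CE: (C (zb I J)) => [[[[p11 q00] q10] q01] q11].
all: case=> -[b11 b00 b10 b01 b11'] [y00 y10 y01 y11].
all: rewrite /G0 /G1 ?s2 !(dv0, dv1, md0, md1) /= ?zxy ?zx ?zy CE /=.
all: split=> //.
- rewrite (_ : pt _ _ = zb I J) ?subrr ?normr0 ?mulr_ge0 ?(ltW h0) ?(ltW e0) //.
  by rewrite /zb !intrM; congr pt; ring.
- move: b00; congr (`|_ - f _| <= _).
  by rewrite ptD !intrM; congr pt; field.
- have := Yc (zb I J); congr (`|_ - f _| <= _).
  by rewrite ptD !intrD !intrM; congr pt; ring.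
- move: b01; congr (`|_ - f _| <= _).
  by rewrite ptD !intrD !intrM; congr pt; field.
- have := Xc (zb I J); congr (`|_ - f _| <= _).
  by rewrite ptD !intrD !intrM; congr pt; ring.
- move: b10; congr (`|_ - f _| <= _).
  by rewrite ptD !intrD !intrM; congr pt; field.
- move: b11; congr (`|_ - f _| <= _).
  by rewrite ptD !intrD !intrM; congr pt; ring.
- move: b11'; congr (`|_ - f _| <= _).
  by rewrite ptD !intrD !intrM; congr pt; field.
Qed.

End IsotropicGrid.

(** * Simplicial complexes with vertices in a basis *)

Section Realization.
Variables (R : realType) (V : finType).
Local Notation n := #|V|.
Implicit Types (p q : 'rV[R]_n) (v w : V) (S : {set V}).

(** One basis vector per vertex: coordinates are barycentric coordinates, and simplices meet along
    common faces for every family of vertex sets. *)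
Definition evec v : 'rV[R]_n := delta_mx 0 (enum_rank v).
Definition co p v : R := p 0 (enum_rank v).

Lemma co_evec v w : co (evec v) w = (v == w)%:R.
Proof. by rewrite /co /evec mxE eqxx /= (inj_eq enum_rank_inj) eq_sym. Qed.

Lemma evec_inj : injective evec.
Proof.
move=> v w vw; have := co_evec v w; rewrite vw co_evec eqxx.
by case: eqVneq => // _ /eqP; rewrite oner_eq0.
Qed.

Lemma co_ext p q : co p =1 co q -> p = q.
Proof.
move=> h; apply/rowP => i; rewrite -(enum_valK i); exact: h.
Qed.

Lemma coD p q v : co (p + q) v = co p v + co q v.
Proof. by rewrite /co mxE. Qed.

Lemma coZ k p v : co (k *: p) v = k * co p v.
Proof. by rewrite /co mxE. Qed.

Lemma co_sum (I : Type) (r : seq I) (P : pred I) (F : I -> 'rV[R]_n) v :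
  co (\sum_(i <- r | P i) F i) v = \sum_(i <- r | P i) co (F i) v.
Proof. by rewrite /co summxE. Qed.

Lemma co_comb S (a : V -> R) v :
  co (\sum_(w in S) a w *: evec w) v = if v \in S then a v else 0.
Proof.
rewrite co_sum; under eq_bigr do rewrite coZ co_evec.
have [vS|vS] := ifPn.
  rewrite (bigD1 v) //= eqxx mulr1 big1 ?addr0 // => w /andP[_ wv].
  by rewrite (negPf wv) mulr0.
rewrite big1 // => w wS; case: eqVneq => [wv|]; last by rewrite mulr0.
by rewrite -wv wS in vS.
Qed.

Definition simp S : {fset 'rV[R]_n} := [fset evec v | v in S]%fset.

Lemma simpP S p : reflect (exists2 v, v \in S & p = evec v) (p \in simp S).
Proof. exact: imfsetP. Qed.

Lemma mem_simp S v : (evec v \in simp S) = (v \in S).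
Proof.
by apply/simpP/idP => [[w wS /evec_inj ->]|vS] //; exists v.
Qed.

Lemma big_simp (T : nmodType) S (F : 'rV[R]_n -> T) :
  \sum_(x <- simp S) F x = \sum_(v in S) F (evec v).
Proof.
rewrite -[RHS]big_enum -[RHS](big_map evec predT).
apply: perm_big; apply: uniq_perm.
- exact: fset_uniq.
- by rewrite map_inj_uniq ?enum_uniq //; exact: evec_inj.
move=> x; apply/simpP/mapP => -[v vS ->]; exists v => //; move: vS.
  by rewrite mem_enum.
by rewrite mem_enum.
Qed.

Lemma card_simp S : #|` simp S| = #|S|.
Proof.
by rewrite card_imfset //=; [rewrite -cardE|exact: evec_inj].
Qed.

Lemma simp_sub S (t : {fset 'rV[R]_n}) : (t `<=` simp S)%fset ->
  exists2 S' : {set V}, S' \subset S & t = simp S'.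
Proof.
move=> /fsubsetP tS; exists [set v in S | evec v \in t].
  by apply/fintype.subsetP => v; rewrite inE => /andP[].
apply/fsetP => x; apply/idP/simpP => [xt|[v + ->]].
  by have /simpP[v vS xv] := tS _ xt; exists v => //; rewrite inE vS -xv.
by rewrite inE => /andP[].
Qed.

Lemma simpI S S' : (simp S `&` simp S')%fset = simp (S :&: S').
Proof.
apply/fsetP => x; rewrite in_fsetI; apply/andP/simpP.
  by case=> /simpP[v vS ->]; rewrite mem_simp => vS'; exists v; rewrite // inE vS.
by case=> v + ->; rewrite inE !mem_simp => /andP[].
Qed.

Lemma simp_neq0 S : (simp S != fset0) = (S != finset.set0).
Proof.
by rewrite -!cardfs_eq0 card_simp cards_eq0.
Qed.

Lemma hull_simpP S p : hull (simp S) p <->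
  [/\ forall v, 0 <= co p v, \sum_v co p v = 1 & forall v, v \notin S -> co p v = 0].
Proof.
split.
  move=> [a [a0 a1 ->]]; rewrite !big_simp in a1 *.
  have cE v := co_comb S (fun v => a (evec v)) v.
  split=> [v|| v vS]; rewrite ?cE.
  - by case: ifP => // vS; apply: a0; rewrite mem_simp.
  - by rewrite -[RHS]a1 [RHS]big_mkcond /=; apply: eq_bigr => v _; rewrite cE.
  - by rewrite (negPf vS).
move=> [p0 p1 pS]; exists (fun x => \sum_v co p v * (x == evec v)%:R).
have aE v : \sum_w co p w * (evec v == evec w)%:R = co p v.
  rewrite (bigD1 v) //= eqxx mulr1 big1 ?addr0 // => w wv.
  by rewrite (inj_eq evec_inj) eq_sym (negPf wv) mulr0.
split.
- by move=> _ /simpP[v _ ->]; rewrite aE.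
- rewrite big_simp; under eq_bigr do rewrite aE.
  rewrite -[RHS]p1 big_mkcond /=; apply: eq_bigr => v _.
  by case: ifPn => // /pS.
- rewrite big_simp; under eq_bigr do rewrite aE.
  by apply: co_ext => v; rewrite co_comb; case: ifPn => // /pS.
Qed.

Lemma affinely_independent_simp S : affinely_independent (simp S).
Proof.
move=> a _; rewrite big_simp => h x /simpP[v vS ->].
by have := congr1 (co^~ v) h; rewrite /= (co_comb S (fun v => a (evec v))) vS /co mxE.
Qed.

Variable F : {set {set V}}.
Hypothesis F_neq0 : forall S, S \in F -> S != finset.set0.
Hypothesis F_down : forall S S', S \in F -> S' \subset S -> S' != finset.set0 -> S' \in F.

Definition realization : {fset {fset 'rV[R]_n}} := [fset simp S | S in F]%fset.

Lemma realizationP s : reflect (exists2 S, S \in F & s = simp S) (s \in realization).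
Proof. exact: imfsetP. Qed.

Lemma realization_complex : simplicial_complex realization.
Proof.
split.
- move=> _ /realizationP[S SF ->]; split; last exact: affinely_independent_simp.
  by rewrite simp_neq0 F_neq0.
- move=> _ t /realizationP[S SF ->] /simp_sub[S' S'S ->]; rewrite simp_neq0 => S'0.
  by apply/realizationP; exists S' => //; exact: F_down S'S S'0.
- move=> _ _ /realizationP[S SF ->] /realizationP[S' S'F ->].
  rewrite simpI; apply/seteqP; split => p.
    move=> [/hull_simpP[p0 p1 pS] /hull_simpP[_ _ pS']]; apply/hull_simpP.
    by split=> // v; rewrite inE negb_and => /orP[/pS|/pS'].
  move=> /hull_simpP[p0 p1 pSS]; split; apply/hull_simpP; split=> // v vS.
    by apply: pSS; rewrite inE (negPf vS).
  by apply: pSS; rewrite inE (negPf vS) andbF.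
Qed.

End Realization.

(** * The periodic triangulation of the plane *)

Section LatticeDistance.
Variables (R : realType) (N : R).
Hypothesis N0 : 0 < N.

(** Distance to the lattice [N Z], attained by rounding [t / N] to an integer. *)
Definition zdist (t : R) : R := `|t - N * (Num.floor (t / N + 2^-1))%:~R|.

Lemma zdist_le t (k : int) : zdist t <= `|t - N * k%:~R|.
Proof.
rewrite /zdist; set q := Num.floor _.
have /andP[q1 q2] := floor_itv (t / N + 2^-1); rewrite -/q intrD in q1 q2.
have tE : N * (t / N) = t by rewrite mulrC divfK ?gt_eqF.
have t1 : N * q%:~R - N / 2 <= t.
  by rewrite -[leRHS]tE -mulrBr ler_pM2l //; move: q1; clear -N0; lra.
have t2 : t <= N * q%:~R + N / 2.
  by rewrite -[leLHS]tE -mulrDr ler_pM2l //; move: q2; clear -N0; lra.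
have [->//|kq] := eqVneq k q.
have [lt|le] := ltP k q.
  have : k%:~R + 1 <= q%:~R :> R by rewrite -(intrD _ k 1) ler_int lezD1.
  rewrite -(ler_pM2l N0) mulrDr mulr1 => h.
  by rewrite (ger0_norm (x := t - N * k%:~R)) ?ler_norml; move: t1 t2 h N0; clear -N0; lra.
have {le kq} lt : q < k by rewrite lt_neqAle eq_sym kq.
have : q%:~R + 1 <= k%:~R :> R by rewrite -(intrD _ q 1) ler_int lezD1.
rewrite -(ler_pM2l N0) mulrDr mulr1 => h.
by rewrite (ler0_norm (x := t - N * k%:~R)) ?ler_norml; move: t1 t2 h N0; clear -N0; lra.
Qed.

Lemma zdist_ex t : exists k : int, zdist t = `|t - N * k%:~R|.
Proof. by eexists. Qed.

Lemma zdist_lip s t : `|zdist s - zdist t| <= `|s - t|.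
Proof.
have H x y : zdist x <= zdist y + `|x - y|.
  have [k ->] := zdist_ex y; apply: (le_trans (zdist_le x k)).
  have -> : x - N * k%:~R = (y - N * k%:~R) + (x - y) by ring.
  exact: ler_normD.
by rewrite ler_norml; have := H s t; have := H t s; rewrite (distrC t); clear -N0; lra.
Qed.

Lemma zdist_per t (k : int) : zdist (t + N * k%:~R) = zdist t.
Proof.
have H x (l : int) : zdist x <= zdist (x + N * l%:~R).
  have [q ->] := zdist_ex (x + N * l%:~R); have := zdist_le x (q - l).
  by rewrite intrB mulrBr opprB addrA addrAC.
apply/eqP; rewrite eq_le H andbT.
have := H (t + N * k%:~R) (- k); by rewrite rmorphN mulrN addrK.
Qed.

Lemma zdist_small t : `|t| <= N / 2 -> zdist t = `|t|.
Proof.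
move=> ht; apply/eqP; rewrite eq_le.
have := zdist_le t 0; rewrite mulr0 subr0 => -> /=.
have [k ->] := zdist_ex t.
have [->|k0] := eqVneq k 0; first by rewrite mulr0 subr0.
have k1 : 1 <= `|k%:~R| :> R by rewrite norm_intr_ge1 // intr_eq0.
have h : N <= `|N * k%:~R| by rewrite normrM gtr0_norm // ler_peMr // ltW.
have := ler_normB t (t - N * k%:~R); rewrite opprB addrC subrK.
by move: h ht; clear -N0; lra.
Qed.

End LatticeDistance.

Section Hats.
Variables (R : realType) (m : nat).
Hypothesis m_ge2 : (2 <= m)%N.
Local Notation M := (m.+1).
Local Notation MR := ((m.+1)%:R : R).
Local Notation E := 'rV[R]_2.
Local Notation zdist := (zdist MR).

Lemma zdist_ge1 (i : int) (u : R) : 0 <= u <= 1 ->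
  (forall k : int, i <> M%:Z * k) -> (forall k : int, i <> M%:Z * k - 1) ->
  1 <= zdist (i%:~R + u).
Proof.
move=> /andP[u0 u1] h0 h1; have [k ->] := zdist_ex MR (i%:~R + u).
have -> : i%:~R + u - MR * k%:~R = (i - M%:Z * k)%:~R + u.
  by rewrite intrB intrM -pmulrn; ring.
set r := i - M%:Z * k.
have [r1|r1] : 1 <= r \/ r <= -2.
- by have := h0 k; have := h1 k; rewrite /r; lia.
- have : 1 <= r%:~R :> R by rewrite (ler_int R 1).
  by move=> rr; rewrite ger0_norm; move: rr u0 u1; clear -m_ge2; lra.
- have : r%:~R <= -2 :> R by rewrite (ler_int R _ (-2)).
  by move=> rr; rewrite ler0_norm; move: rr u0 u1; clear -m_ge2; lra.
Qed.

Lemma zdist_ge_half (i : int) (u : R) : 0 <= u <= 1 ->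
  (forall k : int, i <> M%:Z * k) -> 2^-1 <= zdist (i%:~R + u - 2^-1).
Proof.
move=> /andP[u0 u1] h0; have [k ->] := zdist_ex MR (i%:~R + u - 2^-1).
have -> : i%:~R + u - 2^-1 - MR * k%:~R = (i - M%:Z * k)%:~R + u - 2^-1.
  by rewrite intrB intrM -pmulrn; ring.
set r := i - M%:Z * k.
have [r1|r1] : 1 <= r \/ r <= -1.
- by have := h0 k; rewrite /r; lia.
- have : 1 <= r%:~R :> R by rewrite (ler_int R 1).
  by move=> rr; rewrite ger0_norm; move: rr u0 u1; clear -m_ge2; lra.
- have : r%:~R <= -1 :> R by rewrite (ler_int R _ (-1)).
  by move=> rr; rewrite ler0_norm; move: rr u0 u1; clear -m_ge2; lra.
Qed.

Definition idx (i : int) : 'I_M := inord `|(i %% M%:Z)%Z|%N.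

Lemma idxE (i : int) : (idx i : nat)%:Z = (i %% M%:Z)%Z.
Proof.
rewrite /idx inordK; last by lia.
by lia.
Qed.

Lemma idx_eq (i j : int) : idx i = idx j <-> exists k : int, i = j + M%:Z * k.
Proof.
split=> [h|[k ->]].
  have := idxE i; rewrite h idxE => hm.
  exists ((i %/ M%:Z)%Z - (j %/ M%:Z)%Z).
  have := divz_eq i M%:Z; have := divz_eq j M%:Z; rewrite hm.
  move: (i %/ M%:Z)%Z (j %/ M%:Z)%Z (i %% M%:Z)%Z => qi qj r -> ->; ring.
by apply: val_inj; apply/eqP; rewrite -eqz_nat !idxE addrC mulrC modzMDl.
Qed.

Lemma idxK (i : 'I_M) : idx i%:Z = i.
Proof.
by apply: val_inj; apply/eqP; rewrite -eqz_nat idxE modz_small // ltz_nat ltn_ord.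
Qed.

Lemma idx_succ_neq (i : int) : idx i != idx (i + 1).
Proof.
apply/eqP => /idx_eq[k hk]; have {}hk : M%:Z * k = -1 by lia.
have : (M %| 1)%Z.
  by apply/dvdzP; exists (- k); rewrite mulNr mulrC hk opprK.
by rewrite dvdz1 => /eqP; lia.
Qed.

Local Notation V := ('I_M * 'I_M * bool)%type.

(** In units of a square's side, the star of a lattice vertex is the l1-ball of radius 1 and the
    star of a center is its square; [hat] is the cone function over either. *)
Definition hat (c : bool) (x y : R) : R :=
  if c then Num.max 0 (1 - 2 * Num.max x y) else Num.max 0 (1 - x - y).

Definition cshift (c : bool) : R := if c then 2^-1 else 0.

(* The coordinates of [psi z] are the barycentric coordinates of [z] in the
   periodic triangulation by the lattice points [(i / M, j / M)] and the centers
   of the squares they bound. *)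
Definition hat_at (w : V) (z : E) : R :=
  hat w.2 (zdist (MR * z 0 0 - (nat_of_ord w.1.1)%:R - cshift w.2))
          (zdist (MR * z 0 1 - (nat_of_ord w.1.2)%:R - cshift w.2)).

Definition psi (z : E) : 'rV[R]_#|{: V}| := \row_k hat_at (enum_val k) z.

Lemma co_psi z w : co (psi z) w = hat_at w z.
Proof. by rewrite /co mxE enum_rankK. Qed.

(* A triangle is given by a square [(i, j)] and one of its sides: [s.1] tells
   whether the side is horizontal, and [s.2] whether it is the far one. *)
Definition tri := (int * int * (bool * bool))%type.

Definition offset (s : bool * bool) (e : bool) : bool * bool :=
  if s.1 then (e, s.2) else (s.2, e).

Definition tvx (t : tri) (l : 'I_3) : V :=
  let: (i, j, s) := t in
  let o e := (idx (i + (nat_of_bool (offset s e).1)%:Z),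
              idx (j + (nat_of_bool (offset s e).2)%:Z), false) in
  if l == 0 then o false else if l == 1 then o true else (idx i, idx j, true).

Definition tpt (t : tri) (l : 'I_3) : E :=
  let: (i, j, s) := t in
  let o e := pt ((i%:~R + (nat_of_bool (offset s e).1)%:R) / MR)
                ((j%:~R + (nat_of_bool (offset s e).2)%:R) / MR) in
  if l == 0 then o false else if l == 1 then o true
  else pt ((i%:~R + 2^-1) / MR) ((j%:~R + 2^-1) / MR).

Lemma sum3 (T : nmodType) (F : 'I_3 -> T) : \sum_l F l = F 0 + F 1 + F 2.
Proof.
rewrite !big_ord_recl big_ord0 addr0 addrA.
by congr (F _ + F _ + F _); apply: val_inj.
Qed.

Lemma hat_lip c (x y x' y' d : R) : `|x - x'| <= d -> `|y - y'| <= d ->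
  `|hat c x y - hat c x' y'| <= 2 * d.
Proof.
rewrite !ler_norml => /andP[h1 h2] /andP[h3 h4].
rewrite /hat; case: c; rewrite /Num.max.
  by case: (ltP x y) => ?; case: (ltP x' y') => ?; case: ltP => ?; case: ltP => ?;
    apply/andP; split; lra.
by case: ltP => ?; case: ltP => ?; apply/andP; split; lra.
Qed.

Lemma psi_continuous : continuous psi.
Proof.
apply: (@lipschitz_continuous _ _ _ _ (2 * MR)); first by rewrite mulr_ge0.
move=> z w; apply: norm_le_coord => [|k]; first by rewrite !mulr_ge0.
rewrite !mxE -mulrA; apply: hat_lip.
all: apply: (le_trans (zdist_lip _ _ _)); first by rewrite ltr0n.
all: rewrite opprD addrACA subrr addr0 opprD addrACA subrr addr0 -mulrBr.
all: rewrite normrM ger0_norm ?ler0n // ler_wpM2l ?ler0n //.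
all: by have := coord_le_norm (z - w); rewrite /= => h; apply: le_trans (h _); rewrite !mxE.
Qed.

Lemma psi_periodic : zperiodic psi.
Proof.
move=> z k; apply: co_ext => w; rewrite !co_psi /hat_at !mxE !mulrDr.
by rewrite -!(addrAC _ (- _) (MR * _)) !zdist_per // ltr0n.
Qed.

Let M0 : 0 < MR. Proof. by rewrite ltr0n. Qed.
Let M3 : 3 <= MR. Proof. by rewrite ler_nat. Qed.

Lemma zdist_corner (i : int) (u : R) (p : 'I_M) : 0 <= u <= 1 ->
  let d := zdist (i%:~R + u - (nat_of_ord p)%:R - cshift false) in
  if p == idx i then d = u else if p == idx (i + 1) then d = 1 - u else 1 <= d.
Proof.
move=> /andP[u0 u1]; rewrite /cshift subr0 /=.
have small x : `|x| <= 1 -> zdist x = `|x|.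
  by move=> x1; apply: zdist_small => //; move: M3 x1; move: MR; clear -m_ge2 => N; lra.
case: ifPn => [/eqP pi|pi].
  have /idx_eq[k ik] : idx i = idx p%:Z by rewrite idxK.
  have -> : i%:~R + u - (nat_of_ord p)%:R = u + MR * k%:~R.
    by rewrite ik intrD intrM -!pmulrn; ring.
  by rewrite zdist_per // small ger0_norm.
case: ifPn => [/eqP pi1|pi1].
  have /idx_eq[k ik] : idx (i + 1) = idx p%:Z by rewrite idxK.
  have -> : i%:~R + u - (nat_of_ord p)%:R = (u - 1) + MR * k%:~R.
    by rewrite -[i](addrK 1) ik intrB intrD intrM -!pmulrn; ring.
  rewrite zdist_per // small; rewrite ler0_norm ?opprB //; move: u0 u1; clear -m_ge2; lra.
have -> : i%:~R + u - (nat_of_ord p)%:R = (i - p%:Z)%:~R + u.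
  by rewrite intrB -pmulrn; ring.
apply: zdist_ge1; first by rewrite u0.
  move=> k ik; move/eqP: pi; apply; rewrite -[p in LHS]idxK; apply/esym/idx_eq.
  by exists k; rewrite -ik; ring.
move=> k ik; move/eqP: pi1; apply; rewrite -[p in LHS]idxK; apply/esym/idx_eq.
by exists k; rewrite -[M%:Z * k](subrK 1) -ik; ring.
Qed.

Lemma zdist_center (i : int) (u : R) (p : 'I_M) : 0 <= u <= 1 ->
  let d := zdist (i%:~R + u - (nat_of_ord p)%:R - cshift true) in
  if p == idx i then d = `|u - 2^-1| else 2^-1 <= d.
Proof.
move=> /andP[u0 u1]; rewrite /cshift /=.
case: ifPn => [/eqP pi|pi].
  have /idx_eq[k ik] : idx i = idx p%:Z by rewrite idxK.
  have -> : i%:~R + u - (nat_of_ord p)%:R - 2^-1 = (u - 2^-1) + MR * k%:~R.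
    by rewrite ik intrD intrM -!pmulrn; ring.
  rewrite zdist_per // zdist_small // ler_norml.
  by move: M3 u0 u1; move: MR; clear -m_ge2 => N *; apply/andP; split; lra.
have -> : i%:~R + u - (nat_of_ord p)%:R - 2^-1 = (i - p%:Z)%:~R + u - 2^-1.
  by rewrite intrB -pmulrn; ring.
apply: zdist_ge_half; first by rewrite u0.
move=> k ik; move/eqP: pi; apply; rewrite -[p in LHS]idxK; apply/esym/idx_eq.
by exists k; rewrite -ik; ring.
Qed.

(** Only the hats of the four corners and of the center live on a square. With these explicit
    values, comparing hats and barycentric coordinates becomes linear arithmetic. *)
Lemma hat_at_eval (i j : int) (u v : R) (w : V) : 0 <= u <= 1 -> 0 <= v <= 1 ->
  hat_at w (pt ((i%:~R + u) / MR) ((j%:~R + v) / MR)) =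
  let: (p, q, c) := w in
  if c then if (p == idx i) && (q == idx j)
            then Num.max 0 (1 - 2 * Num.max `|u - 2^-1| `|v - 2^-1|) else 0
  else if p == idx i then if q == idx j then Num.max 0 (1 - u - v)
                          else if q == idx (j + 1) then Num.max 0 (v - u) else 0
  else if p == idx (i + 1) then if q == idx j then Num.max 0 (u - v)
                          else if q == idx (j + 1) then Num.max 0 (u + v - 1) else 0
  else 0.
Proof.
move=> u01 v01; case: w => -[p q] c; rewrite /hat_at /= pt_x pt_y.
have mulK x : MR * (x / MR) = x by rewrite mulrC divfK // gt_eqF.
have /andP[u0 u1] := u01; have /andP[v0 v1] := v01.
have z0 t : 0 <= zdist t by exact: normr_ge0.
rewrite !mulK; case: c => /=.
  move: (zdist_center i p u01) (zdist_center j q v01).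
  move: (z0 (i%:~R + u - (nat_of_ord p)%:R - cshift true)).
  move: (z0 (j%:~R + v - (nat_of_ord q)%:R - cshift true)) => /=.
  move: (zdist (i%:~R + u - _ - _)) (zdist (j%:~R + v - _ - _)) => x y y0 x0.
  case: (p == idx i); case: (q == idx j) => /= hx hy; rewrite ?hx ?hy //.
  - by rewrite max_l // subr_le0 -ler_pdivrMl // mulr1 le_max hy orbT.
  - by rewrite max_l // subr_le0 -ler_pdivrMl // mulr1 le_max hx.
  - by rewrite max_l // subr_le0 -ler_pdivrMl // mulr1 le_max hx.
move: (zdist_corner i p u01) (zdist_corner j q v01).
move: (z0 (i%:~R + u - (nat_of_ord p)%:R - cshift false)).
move: (z0 (j%:~R + v - (nat_of_ord q)%:R - cshift false)) => /=.
move: (zdist (i%:~R + u - _ - _)) (zdist (j%:~R + v - _ - _)) => x y y0 x0.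
have big (x' y' : R) : 0 <= x' -> 0 <= y' -> 1 <= x' \/ 1 <= y' -> Num.max 0 (1 - x' - y') = 0.
  by move=> x0' y0' h; apply: max_l; case: h => h; move: x0' y0' h; clear -m_ge2; lra.
case: (p == idx i); [|case: (p == idx (i + 1))];
  (case: (q == idx j); [|case: (q == idx (j + 1))]) => hx hy.
all: try by (apply: big => //; right).
all: try by (apply: big => //; left).
all: by rewrite ?hx ?hy; congr (Num.max _ _); ring.
Qed.

Lemma tvx_inj t : injective (tvx t).
Proof.
case: t => -[i j] [h f]; have := idx_succ_neq i; have := idx_succ_neq j.
move=> /negPf nj /negPf ni; move=> l l'.
have H : forall l : 'I_3, l = 0 \/ l = 1 \/ l = 2.
  case=> -[|[|[|//]]] p; [left|right; left|right; right]; exact: val_inj.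
rewrite /tvx /offset; have [->|[->|->]] := H l; have [->|[->|->]] := H l' => //=.
all: case: h; case: f => /= -[]; rewrite ?addr0.
all: try by move=> /eqP; rewrite ?ni ?nj //.
all: try by move=> /esym /eqP; rewrite ?ni ?nj //.
all: try by move=> _ /eqP; rewrite ?ni ?nj //.
all: try by move=> _ /esym /eqP; rewrite ?ni ?nj //.
Qed.

Lemma ord3 (l : 'I_3) : l = 0 \/ l = 1 \/ l = 2.
Proof.
by case: l => -[|[|[|//]]] p; [left|right; left|right; right]; exact: val_inj.
Qed.

Lemma tvx_rep t l : exists (i j : int) (c : bool), tvx t l = (idx i, idx j, c) /\
  tpt t l = pt ((i%:~R + cshift c) / MR) ((j%:~R + cshift c) / MR).
Proof.
case: t => -[i j] s; rewrite /tvx /tpt; case: ifP => _.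
  by do 2 eexists; exists false; split; first reflexivity; rewrite /cshift !addr0 !intrD.
case: ifP => _.
  by do 2 eexists; exists false; split; first reflexivity; rewrite /cshift !addr0 !intrD.
by exists i, j, true.
Qed.

Lemma tpt_loc t : exists (i j : int), forall l, exists x y : R,
  [/\ 0 <= x <= 1, 0 <= y <= 1 & tpt t l = pt ((i%:~R + x) / MR) ((j%:~R + y) / MR)].
Proof.
have b01 (b : bool) : 0 <= ((nat_of_bool b)%:R : R) <= 1.
  by case: b; rewrite ?lexx ?ler01.
case: t => -[i j] s; exists i, j => l; rewrite /tpt; case: ifP => _; [|case: ifP => _].
- by do 2 eexists; split; last reflexivity; exact: b01.
- by do 2 eexists; split; last reflexivity; exact: b01.
- by exists 2^-1, 2^-1; split=> //; apply/andP; split; clear -m_ge2 M0 M3; lra.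
Qed.

Lemma tpt_vertex t t' l l' : tvx t l = tvx t' l' ->
  exists k : 'rV[int]_2, tpt t l = tpt t' l' + map_mx intr k.
Proof.
have key (i i' : int) (c : R) : idx i = idx i' ->
    exists k : int, (i%:~R + c) / MR = (i'%:~R + c) / MR + k%:~R.
  move=> /idx_eq[k ->]; exists k; rewrite intrD intrM -[M%:Z%:~R]pmulrn.
  by move: M0; rewrite lt_neqAle eq_sym => /andP[m0 _]; move: MR m0 => N ?; field.
have [i [j [c [-> ->]]]] := tvx_rep t l; have [i' [j' [c' [-> ->]]]] := tvx_rep t' l'.
case=> /(key _ _ (cshift c))[k1 e1] /(key _ _ (cshift c))[k2 e2] <-.
exists (\row_k (if k == 0 then k1 else k2)); rewrite e1 e2.
by apply: eq_pt; rewrite !mxE.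
Qed.

Lemma tpt_diam t l l' : `|tpt t l - tpt t l'| <= MR^-1.
Proof.
have [i [j h]] := tpt_loc t; have [x [y [/andP[x0 x1] /andP[y0 y1] ->]]] := h l.
have [x' [y' [/andP[x0' x1'] /andP[y0' y1'] ->]]] := h l'.
have key (k : int) (z z' : R) : 0 <= z -> z <= 1 -> 0 <= z' -> z' <= 1 ->
    `|(k%:~R + z) / MR - (k%:~R + z') / MR| <= MR^-1.
  move=> *; rewrite -mulrBl normrM (gtr0_norm (x := MR^-1)) ?invr_gt0 //.
  rewrite ler_piMl ?invr_ge0 ?ler0n // ler_norml.
  by apply/andP; split; lra.
by rewrite ptB; apply: norm_pt; apply: key.
Qed.

Lemma tpt_sum i j s (a : 'I_3 -> R) : \sum_l a l *: tpt (i, j, s) l =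
  pt ((i%:~R * (\sum_l a l) + ((nat_of_bool (offset s false).1)%:R * a 0 +
        (nat_of_bool (offset s true).1)%:R * a 1 + a 2 / 2)) / MR)
     ((j%:~R * (\sum_l a l) + ((nat_of_bool (offset s false).2)%:R * a 0 +
        (nat_of_bool (offset s true).2)%:R * a 1 + a 2 / 2)) / MR).
Proof.
rewrite !sum3 /tpt /= !ptZ !ptD.
by move: M0; rewrite lt_neqAle eq_sym => /andP[m0 _]; move: MR m0 => N ?;
  congr pt; field.
Qed.

Lemma tpt_indep t (a : 'I_3 -> R) : \sum_l a l *: tpt t l = 0 -> \sum_l a l = 0 ->
  forall l, a l = 0.
Proof.
case: t => -[i j] [h f]; rewrite tpt_sum => e0 s0.
have := congr1 (fun z : E => z 0 0) e0; have := congr1 (fun z : E => z 0 1) e0.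
rewrite pt_x pt_y !mxE s0 !mulr0 !add0r => /eqP; rewrite mulf_eq0 invr_eq0.
rewrite [_ == 0 in X in _ || X]gt_eqF // orbF => /eqP ey /eqP.
rewrite mulf_eq0 invr_eq0 [_ == 0 in X in _ || X]gt_eqF // orbF => /eqP ex.
rewrite sum3 in s0.
have [z0 [z1 z2]] : a 0 = 0 /\ a 1 = 0 /\ a 2 = 0.
  clear e0; move: s0 ex ey; rewrite /offset; move: (a 0) (a 1) (a 2) => x y z.
  by case: h; case: f => /=; clear -m_ge2 M0 M3 => *; (split; [|split]); lra.
by move=> l; case: (ord3 l) => [->|[->|->]].
Qed.

Lemma tri_cover (z : E) : exists (t : tri) (a : 'I_3 -> R),
  [/\ forall l, 0 <= a l, \sum_l a l = 1 & z = \sum_l a l *: tpt t l].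
Proof.
pose fr (x : R) := MR * x - (Num.floor (MR * x))%:~R.
have fr01 x : 0 <= fr x <= 1.
  have := floor_itv (MR * x); rewrite intrD /fr => /andP[h1 h2].
  by apply/andP; split; move: h1 h2; move: (MR * x); clear -m_ge2 M0 M3 => y; lra.
have frE x : x = ((Num.floor (MR * x))%:~R + fr x) / MR.
  by rewrite /fr addrC subrK mulrC mulKf // gt_eqF.
set i := Num.floor (MR * z 0 0) in frE *; set j := Num.floor (MR * z 0 1).
have /andP[u0 u1] := fr01 (z 0 0); have /andP[v0 v1] := fr01 (z 0 1).
have ex := frE (z 0 0); have ey := frE (z 0 1).
rewrite -/j in ey.
move: (fr (z 0 0)) (fr (z 0 1)) u0 u1 v0 v1 ex ey => u v u0 u1 v0 v1 ex ey.
suff [s [a0 [a1 [a2 [p0 p1 p2 [su eu ev]]]]]] : exists s a0 a1 a2, [/\ 0 <= a0, 0 <= a1, 0 <= a2 &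
    [/\ a0 + a1 + a2 = 1,
        u = (nat_of_bool (offset s false).1)%:R * a0 +
            (nat_of_bool (offset s true).1)%:R * a1 + a2 / 2 &
        v = (nat_of_bool (offset s false).2)%:R * a0 +
            (nat_of_bool (offset s true).2)%:R * a1 + a2 / 2 :> R]].
  exists (i, j, s), (fun l => if l == 0 then a0 else if l == 1 then a1 else a2).
  split=> [l||].
  - by case: ifP => // _; case: ifP.
  - by rewrite sum3.
  - rewrite tpt_sum sum3 /= su !mulr1 (pt_eta z) ex ey.
    by congr (pt (_ / _) (_ / _)); rewrite ?eu ?ev.
(* The two diagonals cut the square into four triangles; the weight of the center is twice the
   distance to the side. *)
have [uv|uv] := leP v u; have [uv1|uv1] := leP (u + v) 1.
- exists (true, false), (1 - u - v), (u - v), (2 * v); rewrite /offset /=.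
  by split; [| | |split]; move: u0 u1 v0 v1 uv uv1; clear -m_ge2 M0 M3; lra.
- exists (false, true), (u - v), (u + v - 1), (2 * (1 - u)); rewrite /offset /=.
  by split; [| | |split]; move: u0 u1 v0 v1 uv uv1; clear -m_ge2 M0 M3; lra.
- exists (false, false), (1 - u - v), (v - u), (2 * u); rewrite /offset /=.
  by split; [| | |split]; move: u0 u1 v0 v1 uv uv1; clear -m_ge2 M0 M3; lra.
- exists (true, true), (v - u), (u + v - 1), (2 * (1 - v)); rewrite /offset /=.
  by split; [| | |split]; move: u0 u1 v0 v1 uv uv1; clear -m_ge2 M0 M3; lra.
Qed.

Lemma center_hat (x y c : R) : 0 <= c -> `|x - 2^-1| <= (1 - c) / 2 ->
  `|y - 2^-1| = (1 - c) / 2 -> Num.max 0 (1 - 2 * Num.max `|x - 2^-1| `|y - 2^-1|) = c.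
Proof.
move=> c0 hx hy; rewrite hy (max_r hx) max_r; first by field.
by move: c0; clear -m_ge2 M0 M3; lra.
Qed.

Lemma psi_tri t (a : 'I_3 -> R) : (forall l, 0 <= a l) -> \sum_l a l = 1 ->
  psi (\sum_l a l *: tpt t l) = \sum_l a l *: evec R (tvx t l).
Proof.
case: t => -[i j] s a0 a1; apply: co_ext => w.
rewrite co_psi tpt_sum a1 co_sum [RHS]sum3 !coZ !co_evec !mulr1.
have [p0 p1 p2] : [/\ 0 <= a 0, 0 <= a 1 & 0 <= a 2] by split; exact: a0.
rewrite sum3 in a1; move: (a 0) (a 1) (a 2) p0 p1 p2 a1 => x y z x0 y0 z0 e1.
have bd (u : R) : 0 <= u -> u <= 1 -> 0 <= u <= 1 by move=> -> ->.
rewrite hat_at_eval; last 2 first.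
- case: s => -[] [] /=; apply: bd; move: x0 y0 z0 e1; clear -m_ge2 M0 M3; lra.
- case: s => -[] [] /=; apply: bd; move: x0 y0 z0 e1; clear -m_ge2 M0 M3; lra.
case: w => -[p q] c.
have pos r t : r = t -> 0 <= t -> Num.max 0 r = t :> R by move=> -> h; rewrite max_r.
have neg r : r <= 0 -> Num.max 0 r = 0 :> R by move=> h; rewrite max_l.
have eqE (p' p1 q' q1 : 'I_M) (c' c1 : bool) :
    ((p', q', c') == (p1, q1, c1)) = [&& p1 == p', q1 == q' & c1 == c'].
  by rewrite !xpair_eqE (eq_sym p') (eq_sym q') (eq_sym c') andbA.
clear a a0 bd; rewrite /tvx /= !eqE; case: c => /=.
  rewrite !andbF !andbT !mulr0 !add0r; case: (_ && _); rewrite ?mulr1 ?mulr0 //.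
  case: s => -[] f; rewrite /offset /=; last rewrite [Num.max `|_| _]maxC; apply: center_hat => //.
  - by rewrite ler_norml; move: x0 y0 z0 e1; clear -m_ge2 M0 M3 => *; apply/andP; split; lra.
  - case: f => /=; [rewrite ger0_norm|rewrite ler0_norm];
      by move: x0 y0 z0 e1; clear -m_ge2 M0 M3; lra.
  - by rewrite ler_norml; move: x0 y0 z0 e1; clear -m_ge2 M0 M3 => *; apply/andP; split; lra.
  - case: f => /=; [rewrite ger0_norm|rewrite ler0_norm];
      by move: x0 y0 z0 e1; clear -m_ge2 M0 M3; lra.
have ni := negPf (idx_succ_neq i); have nj := negPf (idx_succ_neq j).
have ni' := ni; have nj' := nj; rewrite eq_sym in ni'; rewrite eq_sym in nj'.
have [->|/negPf pn'] := eqVneq p (idx i); [|case: (eqVneq p (idx (i + 1))) => [->|/negPf pn]];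
  (have [->|/negPf qn'] := eqVneq q (idx j); [|case: (eqVneq q (idx (j + 1))) => [->|/negPf qn]]).
all: case: s => -[] [] /=; rewrite ?addr0 ?eqxx ?ni ?nj ?ni' ?nj' ?pn ?qn ?pn' ?qn' /=.
all: rewrite ?mulr0 ?mulr1 ?addr0 ?add0r ?mul0r ?mul1r //.
all: clear -m_ge2 M0 M3 pos neg x0 y0 z0 e1.
all: try by (apply: pos; lra).
all: by apply: neg; lra.
Qed.

End Hats.

(** * The uniformization of the surface *)

Section SmoothTools.
Variables (R : realType).

Lemma near_eq_continuous (X Y : topologicalType) (f g : X -> Y) (a : X) :
  (\near a, f a = g a) -> {for a, continuous f} -> {for a, continuous g}.
Proof.
move=> fg cf; have fa := nbhs_singleton fg.
by apply: (cvg_trans (near_eq_cvg fg)); rewrite -fa; exact: cf.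
Qed.

Lemma near_eq_diff (V W : normedModType R) (f g : V -> W) (a : V) :
  (\near a, f a = g a) -> differentiable f a -> 'd f a = 'd g a :> (V -> W).
Proof.
move=> fg df; have dg := near_eq_differentiable fg df.
apply/funext => v.
transitivity ('D_v f a); first exact: (esym (deriveE v df)).
transitivity ('D_v g a); last exact: (deriveE v dg).
exact: near_eq_derive.
Qed.

Lemma smooth_differentiable (V W : normedModType R) (U : set V) (f : V -> W) x :
  smooth_on U f -> U x -> differentiable f x.
Proof. by move=> sf Ux; have [h _] := sf 1%N; exact: h. Qed.

Lemma smooth_derive_continuous (V W : normedModType R) (U : set V) (f : V -> W) x v :
  smooth_on U f -> U x -> {for x, continuous ('D_v f)}.
Proof.
by move=> sf Ux; have [_ h] := sf 1%N; exact: (h v).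
Qed.

Lemma smooth_on_local (V W : normedModType R) (U : set V) (f : V -> W) :
  (forall x, U x -> exists N g, [/\ open N, N x, smooth_on N g &
     forall y, N y -> f y = g y]) -> smooth_on U f.
Proof.
move=> h k; apply: Ck_on_local => x /h [N [g [oN Nx sg fg]]].
by exists N, g; split.
Qed.

Lemma Ck_on_subset (V W : normedModType R) (U U' : set V) k (f : V -> W) :
  U' `<=` U -> Ck_on k U f -> Ck_on k U' f.
Proof.
move=> sub; elim: k f => [|k IH] f /=; first by move=> h x /sub; exact: h.
by move=> [df dd]; split=> [x /sub|v]; [exact: df|apply: IH].
Qed.

Lemma smooth_on_subset (V W : normedModType R) (U U' : set V) (f : V -> W) :
  U' `<=` U -> smooth_on U f -> smooth_on U' f.
Proof. by move=> sub sf k; exact: Ck_on_subset (sf k). Qed.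

Lemma small_int_vec (k : 'rV[int]_2) : `|map_mx intr k : 'rV[R]_2| < 1 -> k = 0.
Proof.
move=> k1; apply/rowP => i; rewrite mxE.
have := le_lt_trans (coord_le_norm (map_mx intr k : 'rV[R]_2) i) k1.
rewrite mxE -intr_norm -[1]/(1%:~R) ltr_int; lia.
Qed.

End SmoothTools.

Section Uniformization.
Variables (R : realType) (S : smoothSurface R).
Variables (F : S -> torus R) (G : torus R -> S).
Hypothesis sF : smooth_surface_map F.
Hypothesis sG : smooth_surface_map G.
Hypothesis FK : cancel F G.
Hypothesis GK : cancel G F.
Local Notation E := 'rV[R]_2.

(** The universal covering of the surface by the plane. *)
Definition unif (z : E) : S := G (torus_proj z).

Lemma unif_periodic : zperiodic unif.
Proof.
move=> z k; rewrite /unif; congr G; apply/torus_projE; rewrite lattice_equiv_sym.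
by apply/asboolP; exists (- k); rewrite opprD addrA subrr add0r; apply/rowP => i; rewrite !mxE rmorphN.
Qed.

Lemma unif_eq z w : unif z = unif w -> exists k : 'rV[int]_2, z = w + map_mx intr k.
Proof.
move=> /(can_inj GK) /torus_projE /asboolP[k zw]; exists k.
by rewrite -zw addrC subrK.
Qed.

Lemma unif_surj x : exists z, x = unif z.
Proof. by have [z zE] := torus_projP (F x); exists z; rewrite /unif -zE FK. Qed.

Lemma unif_map_continuous : continuous unif.
Proof.
move=> z; apply: continuous_comp; first exact: torus_proj_continuous.
by case: sG => cG _; exact: cG.
Qed.

(** Two points of a ball of radius [1 / 4] differ by less than [1 / 2], hence by no nonzero integer
    vector. *)
Definition unif_chart (z : E) := torus_chart (ball z (4^-1 : R)).

Lemma unif_chart_inj (z : E) : set_inj (ball z (4^-1 : R)) (@torus_proj R).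
Proof.
move=> u v; rewrite !inE -ball_normE /= => bu bv /torus_projE /asboolP[k uv].
have k0 : k = 0.
  apply: (@small_int_vec R); rewrite -uv.
  have -> : u - v = (z - v) - (z - u) by rewrite opprB [RHS]addrC addrA subrK.
  by apply: (le_lt_trans (ler_normB _ _)); move: bu bv; lra.
apply/eqP; rewrite -subr_eq0 uv k0; apply/eqP/rowP => i; by rewrite !mxE.
Qed.

Lemma unif_chart_atlas z : atlas (unif_chart z : chart R (torus R)).
Proof.
by exists (ball z (4^-1 : R)); split; [exact: ball_open|exact: unif_chart_inj|].
Qed.

Lemma chart_unif_smooth (c : chart R S) : atlas c ->
  smooth_on (unif @^-1` dom c) (chart_map c \o unif).
Proof.
move=> ac; have [oc _ _ _ _] := atlas_chart ac.
have oU : open (unif @^-1` dom c).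
  by apply: open_comp => // z _; exact: unif_map_continuous.
apply: smooth_on_local => z zc.
exists (ball z (4^-1 : R) `&` unif @^-1` dom c), (chart_map c \o unif); split => //.
- by apply: openI => //; exact: ball_open.
- by split=> //; apply: ballxx; rewrite invr_gt0.
have [_ h] := sG; have := h _ _ (unif_chart_atlas z) ac.
apply: smooth_on_subset => w [bw wc]; exists (torus_proj w); last first.
  exact: (torus_chartK (@unif_chart_inj z) bw).
by split=> //; exists w.
Qed.

(* The local inverse of [unif] with values in the ball of radius 1/4 at [z]. *)
Definition ulift (z : E) : S -> E := chart_map (unif_chart z) \o F.
Definition ulift_dom (z : E) : set S := F @^-1` dom (unif_chart z).

Lemma ulift_dom_open z : open (ulift_dom z).
Proof.
apply: open_comp; first by move=> x _; case: sF => cF _; exact: cF.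
exact: torus_proj_open (ball_open _ _).
Qed.

Lemma ulift_smooth z : smooth_map_on (ulift_dom z) (ulift z).
Proof.
move=> c ac; have [_ h] := sF.
exact: (h c _ ac (unif_chart_atlas z)).
Qed.

Lemma mem_ulift_dom z w : ball z (4^-1 : R) w -> ulift_dom z (unif w).
Proof. by move=> bw; rewrite /ulift_dom /unif /= GK; exists w. Qed.

Lemma uliftK z w : ball z (4^-1 : R) w -> ulift z (unif w) = w.
Proof.
move=> bw; rewrite /ulift /unif /comp GK.
exact: (torus_chartK (@unif_chart_inj z) bw).
Qed.

Lemma ulift_ball z x : ulift_dom z x -> ball z (4^-1 : R) (ulift z x) /\ unif (ulift z x) = x.
Proof.
move=> dx; have [h1 h2] := torus_chartP dx; split; first exact: h1.
by rewrite /unif /ulift /= h2 FK.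
Qed.

Lemma descend (X : topologicalType) (g : E -> X) : continuous g -> zperiodic g ->
  exists2 h : S -> X, continuous h & forall z, h (unif z) = g z.
Proof.
move=> cg pg; pose h0 (q : torus R) : X := g (repr q).
have h0E z : h0 (torus_proj z) = g z.
  have [/torus_projE] : torus_proj (repr (torus_proj z)) = torus_proj z.
    by rewrite {1}/torus_proj reprK.
  move=> /asboolP[k zk]; rewrite /h0 -(pg z k); congr g.
  by rewrite -zk addrC subrK.
have ch : continuous h0.
  apply/continuousP => A oA; rewrite /open /= /quotient_open.
  have -> : (\pi_(quotient_topology {eq_quot lattice_equiv (R := R)}%qT))%qT @^-1` (h0 @^-1` A) = g @^-1` A.
    by apply/seteqP; split => z /=; rewrite -[X in h0 X]/(torus_proj z) h0E.
  by move/continuousP: cg; apply.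
exists (h0 \o F) => [x|z]; last by rewrite /= /unif GK h0E.
apply: continuous_comp; last exact: ch.
by case: sF => cF _; exact: cF.
Qed.

Lemma diff_chart_unif (V : normedModType R) (h : S -> V) (W : set S) (c : chart R S) z :
  open W -> smooth_map_on W h -> atlas c -> W (unif z) -> dom c (unif z) ->
  differentiable (h \o unif) z /\
  forall u, 'd (h \o unif) z u =
    diff_in h c (unif z) ('d (chart_map c \o unif) z u).
Proof.
move=> oW sh ac Wz cz; have [oc _ cK _ _] := atlas_chart ac.
have dk : differentiable (chart_map c \o unif) z.
  exact: smooth_differentiable (chart_unif_smooth ac) cz.
have dh : differentiable (h \o chart_inv c) ((chart_map c \o unif) z).
  by apply: smooth_differentiable (sh c ac) _; exists (unif z).
have eqn : \forall w \near z, ((h \o chart_inv c) \o (chart_map c \o unif)) w = (h \o unif) w.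
  have : \forall w \near z, dom c (unif w).
    by apply: unif_map_continuous; exact: open_nbhs_nbhs.
  by apply: filterS => w /= /cK ->.
have dcomp := differentiable_comp dk dh.
split; first exact: near_eq_differentiable eqn dcomp.
move=> u; rewrite -(near_eq_diff eqn dcomp).
by rewrite (diff_comp dk dh).
Qed.

End Uniformization.

Lemma diff_comp_at (R : realType) (U V W : normedModType R) (f : U -> V) (g : V -> W)
  (x : U) (y : V) : f x = y -> differentiable f x -> differentiable g y ->
  forall u, 'd (g \o f) x u = 'd g y ('d f x u).
Proof. by move=> <- df dg u; exact: (congr1 (@^~ u) (diff_comp df dg)). Qed.

(** * Differentials and metrics read in the plane *)

Section Transport.
Variables (R : realType) (S : smoothSurface R).
Variables (F : S -> torus R) (G : torus R -> S).
Hypothesis sF : smooth_surface_map F.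
Hypothesis sG : smooth_surface_map G.
Hypothesis FK : cancel F G.
Hypothesis GK : cancel G F.
Local Notation E := 'rV[R]_2.
Local Notation unif := (unif G).

Lemma diff_plane (V : normedModType R) (f : E -> V) (z u : E) :
  'd f z u = u 0 0 *: 'd f z (pt 1 0) + u 0 1 *: 'd f z (pt 0 1).
Proof.
rewrite -[X in _ = X + _]linearZ -[X in _ = _ + X]linearZ -linearD !ptZ ptD.
by rewrite !mulr1 !mulr0 addr0 add0r -pt_eta.
Qed.

(** Differentiate the two identities saying that [ulift] and [unif] are locally inverse; tangent
    vectors given in any chart can then be moved to the plane and back. *)
Lemma chart_unif_diff_inv (c : chart R S) (z : E) : atlas c -> dom c (unif z) ->
  (forall u, diff_in (ulift F z) c (unif z) ('d (chart_map c \o unif) z u) = u) /\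
  (forall u, 'd (chart_map c \o unif) z (diff_in (ulift F z) c (unif z) u) = u).
Proof.
move=> ac cz; have bz : ball z (4^-1 : R) z by apply: ballxx; rewrite invr_gt0.
have Wz : ulift_dom F z (unif z) by exact: (mem_ulift_dom GK).
have oW := ulift_dom_open sF z.
have [dl dlE] := diff_chart_unif sG oW (ulift_smooth sF z) ac Wz cz.
have [oc oim cK cc ci] := atlas_chart ac.
have dk : differentiable (chart_map c \o unif) z.
  exact: smooth_differentiable (chart_unif_smooth sG ac) cz.
have dc : differentiable (ulift F z \o chart_inv c) (chart_map c (unif z)).
  by apply: smooth_differentiable (ulift_smooth sF z ac) _; exists (unif z).
have id_diff (x : E) : differentiable (@id E) x by exact: ex_diff.
have id_val (x u : E) : 'd (@id E) x u = u.
  by have := @diff_val _ _ _ _ _ _ _ (is_diff_id x) => ->.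
split=> u.
  rewrite -dlE.
  have eqn : \forall w \near z, id w = (ulift F z \o unif) w.
    have b4 : 0 < 4^-1 :> R by rewrite invr_gt0.
    by have := nbhsx_ballx z _ b4; apply: filterS => w /(uliftK GK) /= ->.
  by rewrite -(near_eq_diff eqn (id_diff z)) id_val.
have liftz : (ulift F z \o chart_inv c) (chart_map c (unif z)) = z.
  by rewrite /= cK // (uliftK GK).
pose y := chart_map c (unif z).
have imy : (chart_map c @` dom c) y by exists (unif z).
have eqn : \forall w \near y, id w = ((chart_map c \o unif) \o (ulift F z \o chart_inv c)) w.
  have n1 : \forall w \near y, (chart_map c @` dom c) w by exact: open_nbhs_nbhs.
  have n2 : \forall w \near y, ulift_dom F z (chart_inv c w).
    by apply: (ci y imy); apply: open_nbhs_nbhs; split=> //; rewrite /y cK.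
  near=> w.
  have [x cx xw] : (chart_map c @` dom c) w by near: w; exact: n1.
  have : ulift_dom F z (chart_inv c w) by near: w; exact: n2.
  by rewrite -xw /= cK // => /(ulift_ball FK)[_ ->].
have h1 := congr1 (@^~ u) (near_eq_diff eqn (id_diff y)).
have h2 := diff_comp_at liftz dc dk u.
exact: (etrans (esym h2) (etrans (esym h1) (id_val y u))).
Unshelve. all: by end_near. Qed.

Lemma diff_zperiodic (V : normedModType R) (f : E -> V) (z v : E) (k : 'rV[int]_2) :
  zperiodic f -> differentiable f z -> differentiable f (z + map_mx intr k) ->
  'd f (z + map_mx intr k) v = 'd f z v.
Proof.
move=> pf df df'; transitivity ('D_v f (z + map_mx intr k)).
  exact: (esym (deriveE v df')).
transitivity ('D_v f z); last exact: (deriveE v df).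
rewrite /derive; have -> : f \o shift (z + map_mx intr k) = f \o shift z.
  by apply/funext => h /=; rewrite addrA pf.
by rewrite pf.
Qed.

Lemma bformE (A : 'M[R]_2) (u v : E) : bform A u v =
  u 0 0 * A 0 0 * v 0 0 + u 0 1 * A 1 0 * v 0 0 +
  (u 0 0 * A 0 1 * v 0 1 + u 0 1 * A 1 1 * v 0 1).
Proof.
rewrite /bform !mxE !big_ord_recl big_ord0 !mxE !big_ord_recl !big_ord0 !addr0.
by rewrite (_ : lift ord0 ord0 = 1) ?mulrDl //; apply: val_inj.
Qed.

Lemma smooth_diff_continuous (V : normedModType R) (U : set E) (f : E -> V) (z v : E) :
  open U -> smooth_on U f -> U z -> {for z, continuous (fun w : E => 'd f w v)}.
Proof.
move=> oU sf Uz; have cD := smooth_derive_continuous (v := v) sf Uz.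
have eqn : \forall w \near z, 'D_v f w = 'd f w v.
  have : \forall w \near z, U w by exact: open_nbhs_nbhs.
  by apply: filterS => w Uw; apply: deriveE; exact: smooth_differentiable sf Uw.
exact: near_eq_continuous eqn cD.
Qed.

Lemma metric_chart_free (g : riemannian S) (c c0 : chart R S) (z w : E) :
  atlas c -> atlas c0 -> dom c (unif z) -> dom c0 (unif z) ->
  bform (gram g c (unif z)) ('d (chart_map c \o unif) z w) ('d (chart_map c \o unif) z w) =
  bform (gram g c0 (unif z)) ('d (chart_map c0 \o unif) z w) ('d (chart_map c0 \o unif) z w).
Proof.
move=> ac ac0 cz c0z; rewrite (gram_change g ac ac0 cz c0z).
have [oc0 _ _ _ _] := atlas_chart ac0.
have sc : smooth_map_on (dom c0) (chart_map c0).
  by move=> c' ac'; exact: (atlas_compatible ac' ac0).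
by have [_ <-] := diff_chart_unif sG oc0 sc ac c0z cz.
Qed.

(** Cayley-Hamilton for a symmetric 2 x 2 matrix [A]: trace times the form, minus determinant times
    [|v|^2], equals [|A v|^2]. Thus determinant over trace bounds the form from below. *)
Lemma pos_quad_form (al be ga x y : R) :
  (al * ga - be * be) * (x * x + y * y) <= (al + ga) * (al * (x * x) + 2 * be * (x * y) + ga * (y * y)).
Proof.
rewrite -subr_ge0.
have -> : (al + ga) * (al * (x * x) + 2 * be * (x * y) + ga * (y * y)) -
    (al * ga - be * be) * (x * x + y * y) = (al * x + be * y) ^+ 2 + (be * x + ga * y) ^+ 2.
  by rewrite !expr2; ring.
by rewrite addr_ge0 // sqr_ge0.
Qed.

Lemma quad_form_lower (al be ga x y D T N : R) : 0 < T -> 0 < D ->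
  D <= al * ga - be * be -> 0 < al + ga -> al + ga <= T -> 0 <= N ->
  N <= x * x + y * y ->
  D / T * N <= al * (x * x) + 2 * be * (x * y) + ga * (y * y).
Proof.
move=> T0 D0 hD t0 hT N0 hN; have := pos_quad_form al be ga x y.
move: (_ + _ + ga * _) => Q hQ; have s0 := le_trans N0 hN.
have Q0 : 0 <= Q.
  rewrite -(pmulr_rge0 _ t0); apply: le_trans hQ; apply: mulr_ge0 => //.
  exact: le_trans (ltW D0) hD.
rewrite mulrAC ler_pdivrMr //.
apply: (@le_trans _ _ ((al * ga - be * be) * (x * x + y * y))).
  by apply: ler_pM => //; exact: ltW.
by rewrite (le_trans hQ) // mulrC; apply: ler_wpM2l.
Qed.

(** In a fixed chart [c0] the pulled back metric has continuous coefficients [al], [be], [ga], so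
    determinant over trace stays away from 0 near [z0]; other charts give the same form. *)
Lemma metric_local_bound (g : riemannian S) (z0 : E) : exists2 lam, 0 < lam &
  \forall z \near z0, forall c, atlas c -> dom c (unif z) -> forall w,
    lam * `|w| ^+ 2 <= bform (gram g c (unif z)) ('d (chart_map c \o unif) z w)
                        ('d (chart_map c \o unif) z w).
Proof.
have [c0 ac0 cz0] := atlas_cover (unif z0).
have [oc0 oim cK cc ci] := atlas_chart ac0.
pose kk := chart_map c0 \o unif.
have skk := chart_unif_smooth sG ac0.
have oU : open (unif @^-1` dom c0).
  by apply: open_comp => // z _; exact: (unif_map_continuous sG).
pose p (z : E) : E := 'd kk z (pt 1 0); pose q (z : E) : E := 'd kk z (pt 0 1).
pose Gm (z : E) := gram g c0 (unif z).
have cp : {for z0, continuous p} by exact: smooth_diff_continuous oU skk cz0.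
have cq : {for z0, continuous q} by exact: smooth_diff_continuous oU skk cz0.
have nU : \forall z \near z0, dom c0 (unif z) by exact: open_nbhs_nbhs.
have cG : {for z0, continuous Gm}.
  have h : {for z0, continuous ((gram g c0 \o chart_inv c0) \o kk)}.
    apply: continuous_comp.
      by apply: differentiable_continuous; exact: smooth_differentiable skk cz0.
    by apply: (gram_smooth g ac0 0%N); exists (unif z0).
  have eqn : \forall z \near z0, ((gram g c0 \o chart_inv c0) \o kk) z = Gm z.
    by apply: filterS nU => z /cK; rewrite /= /kk /= => ->.
  exact: near_eq_continuous eqn h.
pose bf (u v : E -> E) (z : E) := bform (Gm z) (u z) (v z).
have cbf u v : {for z0, continuous u} -> {for z0, continuous v} -> {for z0, continuous (bf u v)}.
  move=> cu cv; have cu' i := continuous_comp cu (@coord_continuous R 1 2 0 i (u z0)).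
  have cv' i := continuous_comp cv (@coord_continuous R 1 2 0 i (v z0)).
  have cG' i j := continuous_comp cG (@coord_continuous R 2 2 i j (Gm z0)).
  have -> : bf u v = fun z => u z 0 0 * Gm z 0 0 * v z 0 0 + u z 0 1 * Gm z 1 0 * v z 0 0 +
    (u z 0 0 * Gm z 0 1 * v z 0 1 + u z 0 1 * Gm z 1 1 * v z 0 1).
    by apply/funext => z; exact: bformE.
  have cM i j k : {for z0, continuous (fun z => u z 0 i * Gm z i j * v z 0 k)}.
    apply: (@continuousM _ _ (fun z => u z 0 i * Gm z i j) (fun z => v z 0 k)); last exact: cv'.
    by apply: (@continuousM _ _ (fun z => u z 0 i) (fun z => Gm z i j)); [exact: cu'|exact: cG'].
  by do 2 (apply: continuousD); exact: cM.
pose al := bf p p; pose be := bf p q; pose ga := bf q q.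
have Eform (z w : E) : dom c0 (unif z) -> bform (Gm z) ('d kk z w) ('d kk z w) =
    al z * (w 0 0 * w 0 0) + 2 * be z * (w 0 0 * w 0 1) + ga z * (w 0 1 * w 0 1).
  move=> cz; rewrite /al /be /ga /bf diff_plane -/(p z) -/(q z).
  have /matrixP/(_ 0 1) := gram_sym g ac0 cz; rewrite mxE -/(Gm z) => sG01.
  rewrite !bformE !mxE sG01.
  move: (p z 0 0) (p z 0 1) (q z 0 0) (q z 0 1) (Gm z 0 0) (Gm z 0 1) (Gm z 1 1) (w 0 0) (w 0 1).
  by clear; move=> *; ring.
have inj0 (z w : E) : dom c0 (unif z) -> 'd kk z w = 0 -> w = 0.
  move=> cz w0; have [h _] := chart_unif_diff_inv ac0 cz.
  by rewrite -(h w) -/kk w0 [LHS]linear0.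
have fpos (z w : E) : dom c0 (unif z) -> w != 0 -> 
    0 < al z * (w 0 0 * w 0 0) + 2 * be z * (w 0 0 * w 0 1) + ga z * (w 0 1 * w 0 1).
  move=> cz w0; have <- := Eform z w cz; apply: (gram_pos g ac0 cz).
  by apply: contra_neq w0; exact: inj0.
have npt x y : (x != 0) || (y != 0) -> pt x y != 0 :> E.
  apply: contraTneq => h; have := congr1 (fun w : E => w 0 0) h.
  have := congr1 (fun w : E => w 0 1) h; rewrite pt_x pt_y !mxE => -> ->.
  by rewrite eqxx.
have al0 : 0 < al z0.
  have := fpos z0 (pt 1 0) cz0 (npt _ _ _); rewrite oner_eq0 => /(_ isT).
  by rewrite pt_x pt_y !(mulr0, mul0r, mulr1, addr0, add0r).
have ga0 : 0 < ga z0.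
  have := fpos z0 (pt 0 1) cz0 (npt _ _ _); rewrite oner_eq0 orbT => /(_ isT).
  by rewrite pt_x pt_y !(mulr0, mul0r, mulr1, addr0, add0r).
(* On the vector [(be, - al)] the form equals [al] times the determinant. *)
have det0 : 0 < al z0 * ga z0 - be z0 * be z0.
  have n0 : (be z0 != 0) || (- al z0 != 0) by rewrite oppr_eq0 (gt_eqF al0) orbT.
  have := fpos z0 _ cz0 (npt _ _ n0); rewrite pt_x pt_y.
  move: (al z0) (be z0) (ga z0) al0 => a b e a0.
  rewrite (_ : _ + _ = a * (a * e - b * b)); last by ring.
  by rewrite pmulr_rgt0.
have cal : {for z0, continuous al} by exact: cbf.
have cbe : {for z0, continuous be} by exact: cbf.
have cga : {for z0, continuous ga} by exact: cbf.
clearbody al be ga.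
pose dt z := al z * ga z - be z * be z; pose tr z := al z + ga z.
have cdt : {for z0, continuous dt}.
  by apply: continuousB; apply: continuousM.
have ctr : {for z0, continuous tr} by exact: continuousD.
have tr0 : 0 < tr z0 by rewrite addr_gt0.
exists (dt z0 / 2 / (tr z0 + 1)).
  by rewrite !divr_gt0 // addr_gt0.
have n1 : \forall z \near z0, dt z0 / 2 < dt z.
  by apply: (cvgr_gt (dt z0) cdt); rewrite gtr_pMr ?invf_lt1 // ltr1n.
have n2 : \forall z \near z0, tr z < tr z0 + 1.
  by apply: (cvgr_lt (tr z0) ctr); rewrite ltrDl.
have n3 : \forall z \near z0, 0 < tr z by exact: (cvgr_gt (tr z0) ctr).
near=> z => c ac cz w; have cz0' : dom c0 (unif z) by near: z.
rewrite (metric_chart_free g w ac ac0 cz cz0') -/kk -/(Gm z) Eform //.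
have h1 : dt z0 / 2 < dt z by near: z.
have h2 : tr z < tr z0 + 1 by near: z.
have h3 : 0 < tr z by near: z.
have hw : `|w| ^+ 2 <= w 0 0 * w 0 0 + w 0 1 * w 0 1.
  have : `|w| <= Num.max `|w 0 0| `|w 0 1|.
    apply: norm_le_coord => [|i]; first by rewrite le_max normr_ge0.
    have [->|->] : i = 0 \/ i = 1.
      by case: i => -[|[|]] //= hi; [left|right]; apply: val_inj.
    - by rewrite le_max lexx.
    - by rewrite le_max lexx orbT.
  rewrite le_max => /orP[] h.
    rewrite (le_trans (lerXn2r 2 _ _ h)) ?nnegrE // real_normK ?num_real //.
    by rewrite expr2 lerDl -expr2 sqr_ge0.
  rewrite (le_trans (lerXn2r 2 _ _ h)) ?nnegrE // real_normK ?num_real //.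
  by rewrite expr2 lerDr -expr2 sqr_ge0.
have D0 : 0 < dt z0 / 2 by rewrite divr_gt0.
have T0 : 0 < tr z0 + 1 by rewrite addr_gt0.
exact (quad_form_lower T0 D0 (ltW h1) h3 (ltW h2) (sqr_ge0 _) hw).
Unshelve. all: by end_near. Qed.

End Transport.

Section Pullback.
Variables (R : realType) (S : smoothSurface R).
Variables (F : S -> torus R) (G : torus R -> S).
Hypothesis sF : smooth_surface_map F.
Hypothesis sG : smooth_surface_map G.
Hypothesis FK : cancel F G.
Hypothesis GK : cancel G F.
Local Notation E := 'rV[R]_2.
Local Notation unif := (unif G).

(** The converter from planar estimates to operator norms for [g]: compactness of the unit box makes
    the local lower bounds uniform, and periodicity spreads them. *)
Lemma metric_bound (g : riemannian S) : exists2 C, 0 < C &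
  forall z (c : chart R S) u, atlas c -> dom c (unif z) ->
    bform (gram g c (unif z)) u u <= 1 -> `|diff_in (ulift F z) c (unif z) u| <= C.
Proof.
pose B (z : E) (c : chart R S) (w : E) := bform (gram g c (unif z))
  ('d (chart_map c \o unif) z w) ('d (chart_map c \o unif) z w).
pose P (lam : R) (z : E) := forall c : chart R S, atlas c -> dom c (unif z) ->
  forall w, lam * `|w| ^+ 2 <= B z c w.
have := (compact_near_coveringP _).1 (@unit_box_compact R) R (0^'+) P _.
case=> [x _|d /= d0 hd].
  have [lam lam0 hl] := metric_local_bound sF sG FK GK g x.
  near=> z d => c ac cz w.
  have dl : d <= lam by near: d; exact: nbhs_right_le.
  have hz : P lam z by near: z.
  by apply: (le_trans _ (hz c ac cz w)); apply: ler_wpM2r => //; exact: sqr_ge0.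
have d2 : 0 < d / 2 by exact: divr_gt0.
have bd : `|0 - d / 2| < d.
  by rewrite sub0r normrN ger0_norm ?ltr_pdivrMr ?ltr_pMr ?ltr1n // ltW.
have {}hd z : P (d / 2) z.
  move=> c ac cz w; have [k zk] := unit_box_rep z.
  have pz := unif_periodic G z k.
  have cz' : dom c (unif (z + map_mx intr k)) by rewrite pz.
  have hw := hd (d / 2) bd d2 _ zk c ac cz' w.
  have per : zperiodic (chart_map c \o unif).
    by move=> y j; rewrite /= (unif_periodic G y j).
  have df y : dom c (unif y) -> differentiable (chart_map c \o unif) y.
    exact: smooth_differentiable (chart_unif_smooth sG ac).
  have eD := diff_zperiodic w per (df _ cz) (df _ cz').
  have eB : B (z + map_mx intr k) c w = B z c w.
    transitivity (bform (gram g c (unif z)) ('d (chart_map c \o unif) (z + map_mx intr k) w)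
      ('d (chart_map c \o unif) (z + map_mx intr k) w)).
      by rewrite /B pz.
    exact: (congr1 (fun v => bform (gram g c (unif z)) v v) eD).
  by rewrite -eB.
(* If [|w| > 1 + 2 / d], then [|w|^2 >= |w| > 2 / d], against [d / 2 * |w|^2 <= 1]. *)
exists (1 + 2 / d) => [|z c u ac cz u1]; first by rewrite addr_gt0 ?divr_gt0.
have [_ h] := chart_unif_diff_inv sF sG FK GK ac cz.
have hw := hd z c ac cz (diff_in (ulift F z) c (unif z) u).
have {}hw : d / 2 * `|diff_in (ulift F z) c (unif z) u| ^+ 2 <= 1.
  apply: (le_trans hw); apply: le_trans u1.
  by rewrite le_eqVlt; apply/orP; left; apply/eqP;
    exact: (congr1 (fun v => bform (gram g c (unif z)) v v) (h u)).
move: {h u1}(diff_in _ _ _ u) hw => w hw.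
rewrite leNgt; apply/negP => lt.
have w0 : 0 <= `|w| by [].
have D0 : 0 < 2 / d by rewrite divr_gt0.
have : d / 2 * (2 / d) < d / 2 * `|w| ^+ 2.
  rewrite ltr_pM2l // expr2.
  apply: (@lt_le_trans _ _ `|w|); first by move: lt; apply: lt_trans; rewrite ltrDr.
  by rewrite ler_peMr //; apply/ltW/(le_lt_trans _ lt); rewrite lerDl ltW.
rewrite mulrC mulrA divfK ?gt_eqF // divff ?pnatr_eq0 // ltNge.
by rewrite hw.
Unshelve. all: by end_near. Qed.

Variables (n : nat) (l : S -> 'rV[R]_(n * 2)).
Hypothesis il : immersion l.
Hypothesis isol : isotropic l.
Local Notation lu := (l \o unif).

Lemma pullback_diff (c : chart R S) z : atlas c -> dom c (unif z) ->
  differentiable lu z /\ forall u, 'd lu z u = diff_in l c (unif z) ('d (chart_map c \o unif) z u).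
Proof. by move=> ac cz; exact: (diff_chart_unif sG openT il.1 ac I cz). Qed.

Lemma pullback_differentiable z : differentiable lu z.
Proof. by have [c ac cz] := atlas_cover (unif z); have [] := pullback_diff ac cz. Qed.

Lemma pullback_periodic : zperiodic lu.
Proof. by move=> z k; rewrite /= (unif_periodic G z k). Qed.

Lemma pullback_diff_continuous (v : E) : continuous (fun z : E => 'd lu z v).
Proof.
move=> z0; have [c ac cz0] := atlas_cover (unif z0).
have [oc oim cK cc ci] := atlas_chart ac.
pose kk := chart_map c \o unif; pose lc := l \o chart_inv c.
have skk := chart_unif_smooth sG ac.
have oU : open (unif @^-1` dom c).
  by apply: open_comp => // z _; exact: (unif_map_continuous sG).
have nU : \forall z \near z0, dom c (unif z) by exact: open_nbhs_nbhs.
have slc : smooth_on (chart_map c @` dom c) lc.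
  by have := il.1 c ac; rewrite setIT.
have cp : {for z0, continuous (fun z : E => 'd kk z v)} by exact: smooth_diff_continuous oU skk cz0.
have ckk : {for z0, continuous kk}.
  by apply: differentiable_continuous; exact: smooth_differentiable skk cz0.
have cl w : {for z0, continuous (fun z : E => 'd lc (kk z) w)}.
  apply: (continuous_comp ckk (g := fun y : E => 'd lc y w)).
  by apply: smooth_diff_continuous oim slc _; exists (unif z0).
have cp' i := continuous_comp cp (@coord_continuous R 1 2 0 i ('d kk z0 v)).
have eqn : \forall z \near z0, 'd kk z v 0 0 *: 'd lc (kk z) (pt 1 0) +
   'd kk z v 0 1 *: 'd lc (kk z) (pt 0 1) = 'd lu z v.
  apply: filterS nU => z cz; have [_ h] := pullback_diff ac cz.
  exact (etrans (esym (diff_plane lc (kk z) ('d kk z v))) (esym (h v))).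
apply: (near_eq_continuous eqn).
have cZ i w : {for z0, continuous (fun z => 'd kk z v 0 i *: 'd lc (kk z) w)}.
  by apply: (@continuousZ _ _ _ (fun z : E => 'd kk z v 0 i) (fun z : E => 'd lc (kk z) w));
    [exact: cp'|exact: cl].
by apply: (@continuousD _ _ _ (fun z : E => 'd kk z v 0 0 *: 'd lc (kk z) (pt 1 0))
 (fun z : E => 'd kk z v 0 1 *: 'd lc (kk z) (pt 0 1))); exact: cZ.
Qed.

Lemma pullback_torus_immersion :
  torus_immersion lu (fun z => 'd lu z (pt 1 0)) (fun z => 'd lu z (pt 0 1)).
Proof.
have linE z u : lin ('d lu z (pt 1 0)) ('d lu z (pt 0 1)) u = 'd lu z u.
  exact (esym (diff_plane lu z u)).
split; split.
- exact: pullback_periodic.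
- by move=> z k; exact: (diff_zperiodic _ pullback_periodic (pullback_differentiable _) (pullback_differentiable _)).
- by move=> z k; exact: (diff_zperiodic _ pullback_periodic (pullback_differentiable _) (pullback_differentiable _)).
- exact: pullback_diff_continuous.
- exact: pullback_diff_continuous.
- move=> z e e0; have := diff_near_bound (pullback_differentiable z) e0.
  by apply: filterS => s hs; rewrite linE.
- move=> z; have [c ac cz] := atlas_cover (unif z); have [_ h] := pullback_diff ac cz.
  rewrite (h (pt 1 0)) (h (pt 0 1)); exact: (isol ac cz).
- move=> z x y h0; have [c ac cz] := atlas_cover (unif z); have [_ h] := pullback_diff ac cz.
  have h1 : 'd lu z (pt x y) = 0.
    by rewrite -(linE z (pt x y)) /lin pt_x pt_y.
  have [h2 _] := chart_unif_diff_inv sF sG FK GK ac cz.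
  have h3 : 'd (chart_map c \o unif) z (pt x y) = 0.
    apply: (il.2 _ _ ac cz); rewrite -(h (pt x y)) h1; exact: (esym (linear0 _)).
  have h4 : pt x y = 0 :> E.
    rewrite -(h2 (pt x y)) h3; exact: (linear0 _).
  have := congr1 (fun w : E => w 0 0) h4; have := congr1 (fun w : E => w 0 1) h4.
  by rewrite pt_x pt_y !mxE => -> ->.
Qed.

End Pullback.

(** * Homeomorphisms of compact sets; smoothness under affine operations *)

Lemma homeomorphism_on_sub (X Y : topologicalType) (A A' : set X) (B B' : set Y) (f : X -> Y) :
  A' `<=` A -> B' = f @` A' -> homeomorphism_on A B f -> homeomorphism_on A' B' f.
Proof.
move=> AA -> [cf [g [cg fK gK]]]; split; first exact: continuous_subspaceW cf.
exists g; split.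
- by apply: continuous_subspaceW cg => _ [x /AA /fK[Bx _] <-].
- by move=> x A'x; split; [exists x|have [] := fK x (AA x A'x)].
- by move=> _ [x A'x <-]; have [_ ->] := fK x (AA x A'x).
Qed.

Lemma homeomorphism_on_sym (X Y : topologicalType) (A : set X) (B : set Y) (f : X -> Y) :
  homeomorphism_on A B f -> exists2 g, homeomorphism_on B A g &
   forall x, A x -> g (f x) = x.
Proof.
move=> [cf [g [cg fK gK]]]; exists g; last by move=> x /fK[].
by split=> //; exists f; split.
Qed.

Lemma compact_injective_homeomorphism (X Y : topologicalType) (x0 : X) (K : set X)
    (f : X -> Y) : compact K -> hausdorff_space Y -> {within K, continuous f} ->
  (forall x y, K x -> K y -> f x = f y -> x = y) -> homeomorphism_on K (f @` K) f.
Proof.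
move=> cK hY cf inj; split=> //.
pose g (y : Y) : X := xget x0 [set x | K x /\ f x = y].
have gP y : (f @` K) y -> K (g y) /\ f (g y) = y.
  move=> [x Kx fx]; have h : exists x, [set x | K x /\ f x = y] x by exists x.
  exact: (xgetPex x0 h).
have fK x : K x -> g (f x) = x.
  by move=> Kx; have [Kg fg] := gP _ (imageP f Kx); exact: inj.
exists g; split=> [|x Kx|y /gP//]; last by split; [exists x|exact: fK].
apply/continuous_closedP => C oC; apply/closed_subspaceP; exists (f @` (K `&` C)).
  apply: (compact_closed hY); apply: continuous_compact.
    by apply: continuous_subspaceW cf => x [].
  exact: compact_closedI.
apply/seteqP; split => y /=.
  move=> [[x [Kx Cx] <-] _]; split; last by exists x.
  exact: (eq_ind_r C Cx (fK x Kx)).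
by move=> [Cy fKy]; have [Kg fg] := gP y fKy; split=> //; exists (g y).
Qed.

Lemma Ck_on_ext (R : realType) (U V : normedModType R) k (O : set U) (f h : U -> V) : open O ->
  (forall x, O x -> f x = h x) -> Ck_on k O h -> Ck_on k O f.
Proof. by move=> oO e ch; apply: Ck_on_local => x Ox; exists O, h; split. Qed.

Section SmoothAlgebra.
Variables (R : realType) (U V W : normedModType R).

Lemma smooth_on_precomp (A : {linear U -> V}) (O : set V) (f : V -> W) :
  continuous A -> smooth_on O f -> smooth_on (A @^-1` O) (f \o A).
Proof.
move=> cA sf k; elim: k f {sf}(sf k) => [|k IH] f /=.
  by move=> cf x Ox; apply: continuous_comp; [exact: cA|exact: cf].
move=> [df dd]; split=> [x Ox|v].
  by apply: (differentiable_comp (f := A)); [exact: (linear_differentiable x cA)|exact: df].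
have -> : 'D_v (f \o A) = 'D_(A v) f \o A.
  apply/funext => x; rewrite /= /derive.
  apply: (congr1 (fun q : R -> W => lim (q @ 0^'))).
  by apply/funext => h /=; congr (_ *: (f _ - _)); rewrite linearD linearZ.
exact: IH.
Qed.

Lemma smooth_on_postcomp (A : {linear V -> W}) (b : W) (O : set U) (f : U -> V) :
  continuous A -> open O -> smooth_on O f -> smooth_on O (fun x => A (f x) + b).
Proof.
move=> cA oO sf k; elim: k f b {sf}(sf k) => [|k IH] f b /=.
  move=> cf x Ox; apply: (@continuousD _ _ _ (A \o f) (cst b)).
    by apply: continuous_comp; [exact: cf|exact: cA].
  exact: cst_continuous.
move=> [df dd].
have dA x : O x -> differentiable (A \o f) x.
  by move=> Ox; apply: (differentiable_comp (f := f)); [exact: df|exact: (linear_differentiable (f x) cA)].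
split=> [x Ox|v]; first by apply: differentiableD => //; exact: dA.
apply: (Ck_on_ext (h := fun x => A ('D_v f x) + 0) oO) => [x Ox|]; last exact: IH.
rewrite addr0 (deriveD (f := A \o f) (g := cst b)); last first.
- exact: derivable_cst.
- by apply: diff_derivable; exact: dA.
rewrite derive_cst addr0 !deriveE; [|exact: df|exact: dA].
by rewrite diff_comp; [rewrite diff_lin|exact: df|exact: linear_differentiable].
Qed.

Lemma smooth_onB (O : set U) (f h : U -> V) :
  open O -> smooth_on O f -> smooth_on O h -> smooth_on O (f \- h).
Proof.
move=> oO sf sh k; elim: k f h {sf}(sf k) {sh}(sh k) => [|k IH] f h /=.
  by move=> cf ch x Ox; apply: continuousB; [exact: cf|exact: ch].
move=> [df ddf] [dh ddh]; split=> [x Ox|v].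
  by apply: differentiableB; [exact: df|exact: dh].
apply: (Ck_on_ext (h := 'D_v f \- 'D_v h) oO) => [x Ox|]; last exact: IH.
by apply: deriveB; apply: diff_derivable; [exact: df|exact: dh].
Qed.

End SmoothAlgebra.

Lemma linear_rV_bound (R : realType) p (W : normedModType R) (A : {linear 'rV[R]_p -> W}) :
  exists2 C, 0 <= C & forall v, `|A v| <= C * `|v|.
Proof.
exists (\sum_i `|A (delta_mx 0 i)|) => [|v]; first exact: sumr_ge0.
have -> : A v = \sum_i v 0 i *: A (delta_mx 0 i).
  by rewrite {1}(row_sum_delta v) linear_sum; apply: eq_bigr => i _; rewrite linearZ.
rewrite mulr_suml; apply: (le_trans (ler_norm_sum _ _ _)); apply: ler_sum => i _.
by rewrite normrZ mulrC; apply: ler_wpM2l => //; exact: coord_le_norm.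
Qed.

Lemma linear_rV_continuous (R : realType) p (W : normedModType R)
  (A : {linear 'rV[R]_p -> W}) : continuous A.
Proof.
have [C C0 hC] := linear_rV_bound A; apply: (lipschitz_continuous C0) => z w.
by rewrite -linearB; exact: hC.
Qed.

(** * The simplicial complex of the torus *)

Section TorusComplex.
Variables (R : realType) (m : nat).
Hypothesis m_ge2 : (2 <= m)%N.
Local Notation E := 'rV[R]_2.
Local Notation V := ('I_m.+1 * 'I_m.+1 * bool)%type.
Local Notation tvx := (tvx m).
Local Notation tpt := (tpt R m).
Local Notation psi := (@psi R m).

Definition tri_set (t : tri) : {set V} := [set tvx t l | l : 'I_3]%SET.

Lemma tri_setP t v : reflect (exists l, v = tvx t l) (v \in tri_set t).
Proof.
apply: (iffP imsetP) => [[l _ ->]|[l ->]]; first by exists l.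
by exists l; rewrite ?inE.
Qed.

Lemma big_tri_set t (T : nmodType) (H : V -> T) :
  \sum_(v in tri_set t) H v = \sum_l H (tvx t l).
Proof.
rewrite big_imset /=; last by move=> x y _ _; exact: (tvx_inj m_ge2).
by apply: eq_bigl => l; rewrite ?inE.
Qed.

(** The affine parametrization of a triangle, extended linearly to the ambient space so that linear
    calculus applies; on the simplex it is inverted by [psi]. *)
Definition tri_lin t (p : 'rV[R]_#|{: V}|) : E := \sum_l co p (tvx t l) *: tpt t l.

Fact tri_lin_is_linear t : linear (tri_lin t).
Proof.
move=> k p q; rewrite /tri_lin scaler_sumr -big_split /=; apply: eq_bigr => l _.
by rewrite coD coZ scalerDl scalerA.
Qed.

HB.instance Definition _ t :=
  GRing.isLinear.Build R 'rV[R]_#|{: V}| E *:%R (tri_lin t) (tri_lin_is_linear t).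

Lemma tri_lin_comb t (a : 'I_3 -> R) :
  tri_lin t (\sum_l a l *: evec R (tvx t l)) = \sum_l a l *: tpt t l.
Proof.
apply: eq_bigr => l _; congr (_ *: _); rewrite co_sum (bigD1 l) //= big1.
  by rewrite coZ co_evec eqxx mulr1 addr0.
by move=> l' nl; rewrite coZ co_evec (inj_eq (@tvx_inj _ m_ge2 t)) (negPf nl) mulr0.
Qed.

Lemma hull_tri_comb t (a : 'I_3 -> R) : (forall l, 0 <= a l) -> \sum_l a l = 1 ->
  hull (simp R (tri_set t)) (\sum_l a l *: evec R (tvx t l)).
Proof.
move=> a0 a1.
pose b v := \sum_l a l * (tvx t l == v)%:R.
have cE v : co (\sum_l a l *: evec R (tvx t l)) v = b v.
  by rewrite co_sum; apply: eq_bigr => l _; rewrite coZ co_evec.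
apply/hull_simpP; split.
- by move=> v; rewrite cE; apply: sumr_ge0 => l _; rewrite mulr_ge0.
- under eq_bigr do rewrite cE; rewrite exchange_big /= -[RHS]a1.
  apply: eq_bigr => l _; rewrite (bigD1 (tvx t l)) //= eqxx mulr1 big1 ?addr0 //.
  by move=> v nv; rewrite eq_sym (negPf nv) mulr0.
- move=> v vt; rewrite cE; apply: big1 => l _; case: eqVneq => [e|]; last by rewrite mulr0.
  by move: vt; rewrite -e; case/tri_setP; exists l.
Qed.

Lemma hull_triP t p : hull (simp R (tri_set t)) p ->
  [/\ forall l, 0 <= co p (tvx t l), \sum_l co p (tvx t l) = 1 &
      p = \sum_l co p (tvx t l) *: evec R (tvx t l)].
Proof.
move=> /hull_simpP[p0 p1 pt]; split=> //.
  rewrite -[RHS]p1 -(big_tri_set t (co p)) [RHS](bigID (mem (tri_set t))) /=.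
  by rewrite [X in _ + X]big1 ?addr0.
rewrite -(big_tri_set t (fun v => co p v *: evec R v)).
apply: co_ext => v; rewrite co_comb; case: ifPn => // /pt; exact.
Qed.

Lemma hull_sub (S S' : {set V}) (p : 'rV[R]_#|{: V}|) : S \subset S' ->
  hull (simp R S) p -> hull (simp R S') p.
Proof.
move=> /fintype.subsetP SS /hull_simpP[p0 p1 pS]; apply/hull_simpP; split=> // v vS'.
by apply: pS; apply: contra vS'; exact: SS.
Qed.

Lemma psi_tri_lin t p : hull (simp R (tri_set t)) p -> psi (tri_lin t p) = p.
Proof.
move=> /hull_triP[p0 p1 pE]; rewrite [RHS]pE.
exact: (psi_tri m_ge2 t p0 p1).
Qed.

Lemma psi_cover (z : E) : exists t, hull (simp R (tri_set t)) (psi z) /\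
  z = tri_lin t (psi z).
Proof.
have [t [a [a0 a1 ->]]] := tri_cover m z; exists t.
by rewrite (psi_tri m_ge2 t a0 a1) tri_lin_comb; split=> //; exact: hull_tri_comb.
Qed.

(** Vertices in the support of [p] belong to both triangles up to integer translations. Two such
    translations differ by at most [2 / M < 1], as [M >= 3], so a single one serves for all
    vertices. *)
Lemma tri_lin_overlap t t' p : hull (simp R (tri_set t)) p ->
  hull (simp R (tri_set t')) p ->
  exists k : 'rV[int]_2, tri_lin t p = tri_lin t' p + map_mx intr k.
Proof.
move=> /hull_simpP[p0 p1 pt] /hull_simpP[_ _ pt'].
(* The position of the vertex [v] in the triangle [u], and 0 when [v] is not one of its vertices. *)
pose D u v := \sum_l (tvx u l == v)%:R *: tpt u l.
have DE u l : D u (tvx u l) = tpt u l.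
  rewrite /D (bigD1 l) //= eqxx scale1r big1 ?addr0 // => l' nl.
  by rewrite (inj_eq (@tvx_inj _ m_ge2 u)) (negPf nl) scale0r.
have linE u : tri_lin u p = \sum_v co p v *: D u v.
  under eq_bigr do rewrite scaler_sumr; rewrite exchange_big; apply: eq_bigr => l _.
  rewrite (bigD1 (tvx u l)) //= eqxx scale1r big1 ?addr0 // => v nv.
  by rewrite eq_sym (negPf nv) scale0r scaler0.
have [v0 pv0] : exists v, co p v != 0.
  apply: contrapT => h; have := oner_neq0 R; rewrite -p1 big1 ?eqxx // => v _.
  by apply/eqP; apply: contrapT => /negP nv; apply: h; exists v.
have vtx v : co p v != 0 -> exists l l', [/\ v = tvx t l, v = tvx t' l', D t v = tpt t l & D t' v = tpt t' l'].
  move=> pv; have /tri_setP[l vl] : v \in tri_set t by apply: contraNT pv => /pt ->.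
  have /tri_setP[l' vl'] : v \in tri_set t' by apply: contraNT pv => /pt' ->.
  by exists l, l'; split=> //; [rewrite vl DE|rewrite vl' DE].
have [l0 [l0' [e0 e0' d0 d0']]] := vtx v0 pv0.
have [k hk] := tpt_vertex R m_ge2 (etrans (esym e0) e0').
exists k; apply/eqP; rewrite addrC -subr_eq; apply/eqP; rewrite !linE -sumrB.
rewrite (eq_bigr (fun v => co p v *: map_mx intr k)); last first.
  move=> v _; rewrite -scalerBr; have [->|pv] := eqVneq (co p v) 0.
    by rewrite !scale0r.
  congr (_ *: _); have [l [l' [e e' d d']]] := vtx v pv.
  have [k' hk'] := tpt_vertex R m_ge2 (etrans (esym e) e').
  rewrite d d' hk' addrC addKr.
  have kk : k' - k = 0.
    apply: (@small_int_vec R); rewrite map_mxB.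
    have -> : map_mx intr k' - map_mx intr k = (tpt t l - tpt t l0) - (tpt t' l' - tpt t' l0').
      rewrite hk hk'; move: (tpt t' l') (tpt t' l0') (map_mx intr k) (map_mx intr k').
      by move=> x y u v'; apply/rowP => i; rewrite !mxE; ring.
    apply: (le_lt_trans (ler_normB _ _)).
    apply: (@le_lt_trans _ _ (m.+1%:R^-1 + m.+1%:R^-1)); first by apply: lerD; exact: tpt_diam.
    by rewrite -mulr2n -[_ *+ 2]mulr_natl ltr_pdivrMr ?ltr0n // mul1r ltr_nat.
  by move/eqP: kk; rewrite subr_eq0 => /eqP ->.
by rewrite -scaler_suml p1 scale1r.
Qed.

Lemma psi_eq (z w : E) : psi z = psi w -> exists k : 'rV[int]_2, z = w + map_mx intr k.
Proof.
move=> zw; have [t [ht zE]] := psi_cover z; have [t' [ht' wE]] := psi_cover w.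
rewrite zE wE zw; rewrite zw in ht; exact: tri_lin_overlap.
Qed.

Lemma tri_lin_direction t (S : {set V}) w : S \subset tri_set t ->
  direction (simp R S) w -> tri_lin t w = 0 -> w = 0.
Proof.
move=> /fintype.subsetP St [a [a0 wE]] w0.
rewrite big_simp in a0; rewrite big_simp in wE.
have cE v : co w v = if v \in S then a (evec R v) else 0.
  by rewrite wE (co_comb S (fun v => a (evec R v))).
have s0 : \sum_l co w (tvx t l) = 0.
  rewrite -(big_tri_set t (co w)) -[RHS]a0 big_mkcond [RHS]big_mkcond /=.
  apply: eq_bigr => v _; rewrite cE; case: ifPn => // vt.
  by case: ifPn => // /St; rewrite (negPf vt).
apply: co_ext => v; rewrite [RHS]mxE; case: (boolP (v \in tri_set t)).
  by case/tri_setP => l ->; exact: (tpt_indep w0 s0).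
by move=> vt; rewrite cE; case: ifPn => // /St; rewrite (negPf vt).
Qed.

Definition torus_faces : {set {set V}} :=
  [set S | (S != finset.set0) && `[< exists t, S \subset tri_set t >]]%SET.

Lemma torus_facesP S : reflect (S != finset.set0 /\ exists t, S \subset tri_set t) (S \in torus_faces).
Proof.
rewrite inE; apply: (iffP andP) => -[S0 h]; split=> //; first by move/asboolP: h.
exact/asboolP.
Qed.

Lemma torus_complex : simplicial_complex (realization R torus_faces).
Proof.
apply: realization_complex; first by move=> S /torus_facesP[].
move=> S S' /torus_facesP[_ [t St]] S'S S'0; apply/torus_facesP; split=> //.
by exists t; exact: fintype.subset_trans St.
Qed.

Lemma torus_polyhedron : polyhedron (realization R torus_faces) = range psi.
Proof.
apply/seteqP; split => p /=.
  move=> [_ /realizationP[S /torus_facesP[_ [t St]] ->]] /(hull_sub St) pt.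
  by exists (tri_lin t p) => //; exact: psi_tri_lin.
move=> [z _ <-]; have [t [ht _]] := psi_cover z.
exists (simp R (tri_set t)) => //; apply/realizationP; exists (tri_set t) => //.
apply/torus_facesP; split; last by exists t.
by apply/set0Pn; exists (tvx t 0); apply/tri_setP; exists 0.
Qed.

End TorusComplex.

Section Lin.
Variables (R : realType) (n : nat) (a b : 'rV[R]_(n * 2)).

Fact lin_is_linear : linear (lin a b).
Proof.
move=> k u v; rewrite linD; congr (_ + _).
by rewrite /lin !mxE scalerDr !scalerA.
Qed.

HB.instance Definition _ :=
  GRing.isLinear.Build R 'rV[R]_2 'rV[R]_(n * 2) *:%R (lin a b) lin_is_linear.

Lemma omega_lin u v : omega a b = 0 -> omega (lin a b u) (lin a b v) = 0.
Proof.
move=> ab; rewrite /lin omegaDl !omegaDr !omegaZl !omegaZr !omegavv (omega_skew b a) ab.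
by ring.
Qed.

End Lin.

(** * Piecewise linear interpolation *)

Section Triangles.
Variables (R : realType) (m : nat).
Hypothesis m_ge2 : (2 <= m)%N.
Local Notation E := 'rV[R]_2.
Local Notation MR := (m.+1%:R : R).
Local Notation V := ('I_m.+1 * 'I_m.+1 * bool)%type.
Local Notation tpt := (tpt R m).
Local Notation psi := (@psi R m).
Local Notation tri_set := (@tri_set m).
Local Notation tri_lin := (@tri_lin R m).

(** One side is parallel to an axis, of length [1 / M], and the third vertex lies at [(1, s)] or
    [(s, 1)] over [2 M] from the first, with [s] a sign. So one partial derivative is [q1] and the
    other [s (q2 - q1)]; their errors [d] and [3 d] add up to [4 d]. *)
Lemma triangle_affine n (t : tri) (P : 'I_3 -> 'rV[R]_(n * 2)) :
  exists a b, [/\ forall l, lin a b (tpt t l - tpt t 0) = P l - P 0,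
    omega (P 1 - P 0) (P 2 - P 0) = 0 -> omega a b = 0 &
    forall a0 b0 d, (forall l, `|P l - P 0 - lin a0 b0 (tpt t l - tpt t 0)| <= d / MR) ->
      forall u, `|lin a b u - lin a0 b0 u| <= 4 * d * `|u|].
Proof.
case: t => -[i j] [h f].
have M0 : MR != 0 by rewrite pnatr_eq0.
pose s : R := (-1) ^+ f.
have ss : s * s = 1 by rewrite /s -expr2 sqrr_sign.
have d1E : tpt (i, j, (h, f)) 1 - tpt (i, j, (h, f)) 0 =
    MR^-1 *: (if h then pt 1 0 else pt 0 1).
  rewrite /tpt /offset /= ptB; case: h; rewrite ptZ /=; apply: eq_pt;
    by rewrite ?(pt_x, pt_y); field.
have d2E : tpt (i, j, (h, f)) 2 - tpt (i, j, (h, f)) 0 =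
    (2 * MR)^-1 *: (if h then pt 1 s else pt s 1).
  by rewrite /tpt /offset /s /= ptB; case: (h); case: (f); rewrite ptZ /=; apply: eq_pt;
    rewrite ?(pt_x, pt_y) ?expr1 ?expr0; field.
pose q1 := MR *: (P 1 - P 0); pose q2 := (2 * MR) *: (P 2 - P 0).
pose c := s *: (q2 - q1).
exists (if h then q1 else c), (if h then c else q1); split.
- move=> l; case: (ord3 l) => [->|[->|->]]; first by rewrite !subrr [LHS]linear0.
    rewrite d1E; case: (h); rewrite [LHS]linearZ /= /lin pt_x pt_y scale1r scale0r ?addr0 ?add0r;
    by rewrite /q1 scalerA mulVf // scale1r.
  have M20 : 2 * MR != 0 by rewrite mulf_neq0 // pnatr_eq0.
  rewrite d2E; case: (h); rewrite [LHS]linearZ /= /lin pt_x pt_y scale1r /c scalerA ss scale1r.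
    by rewrite addrC subrK /q2 scalerA mulVf // scale1r.
  by rewrite subrK /q2 scalerA mulVf // scale1r.
- move=> h0; have q12 : omega q1 c = 0.
    by rewrite /c omegaZr omegaDr omegaNr omegavv /q1 /q2 omegaZl omegaZr h0 !(mulr0, subr0).
  by case: (h) => //; rewrite omega_skew q12 oppr0.
move=> a0 b0 d hd u; rewrite lin_subl.
have d0 : 0 <= d.
  by have := le_trans (normr_ge0 _) (hd 0); rewrite pmulr_lge0 // invr_gt0 ltr0n.
have e1 : `|q1 - lin a0 b0 (if h then pt 1 0 else pt 0 1)| <= d.
  have := hd 1; rewrite d1E [lin _ _ (_ *: _)]linearZ /= => e.
  have -> : q1 - lin a0 b0 (if h then pt 1 0 else pt 0 1) =
    MR *: (P 1 - P 0 - MR^-1 *: lin a0 b0 (if h then pt 1 0 else pt 0 1)).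
    by rewrite scalerBr scalerA divff // scale1r.
  by rewrite normrZ ger0_norm // mulrC -ler_pdivlMr // ltr0n.
have e2 : `|q2 - lin a0 b0 (if h then pt 1 s else pt s 1)| <= 2 * d.
  have := hd 2; rewrite d2E [lin _ _ (_ *: _)]linearZ /= => e.
  have -> : q2 - lin a0 b0 (if h then pt 1 s else pt s 1) =
    (2 * MR) *: (P 2 - P 0 - (2 * MR)^-1 *: lin a0 b0 (if h then pt 1 s else pt s 1)).
    by rewrite scalerBr scalerA divff ?scale1r // mulf_neq0 // pnatr_eq0.
  rewrite normrZ ger0_norm ?mulr_ge0 // -mulrA ler_pM2l // mulrC -ler_pdivlMr // ltr0n //.
have ns : `|s| = 1 by rewrite /s normr_sign.
apply: (le_trans (norm_lin _ _ _)); apply: ler_wpM2r => //.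
have key (x y z : 'rV[R]_(n * 2)) : `|x| <= d -> `|y| <= 2 * d -> z = s *: (y - x) -> `|x| + `|z| <= 4 * d.
  move=> hx hy ->; rewrite normrZ ns mul1r; have := ler_normB y x.
  by move: hx hy; clear; move: `|x| `|y| `|y - x| => X Y Z; lra.
move: e1 e2; case: (h) => /=; rewrite /lin !(pt_x, pt_y) !(scale1r, scale0r, addr0, add0r) => e1 e2.
  apply: (key _ _ _ e1 e2); rewrite /c.
  have {1}-> : b0 = s *: (s *: b0) by rewrite scalerA ss scale1r.
  rewrite -scalerBr; congr (_ *: _).
  by apply/rowP => k; rewrite !mxE; ring.
rewrite addrC; apply: (key _ _ _ e1 e2); rewrite /c.
have {1}-> : a0 = s *: (s *: a0) by rewrite scalerA ss scale1r.
rewrite -scalerBr; congr (_ *: _).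
by apply/rowP => k; rewrite !mxE; ring.
Qed.

Definition triangle (t : tri) : set E :=
  [set z | exists2 p, hull (simp R (tri_set t)) p & z = tri_lin t p].

Lemma triangleP t z : triangle t z ->
  hull (simp R (tri_set t)) (psi z) /\ z = tri_lin t (psi z).
Proof. by move=> [p hp ->]; rewrite psi_tri_lin. Qed.

Lemma triangle_vertex t l : triangle t (tpt t l).
Proof.
have e1 (T : lmodType R) (x : 'I_3 -> T) : \sum_k (k == l)%:R *: x k = x l.
  rewrite (bigD1 l) //= eqxx scale1r big1 ?addr0 // => k /negPf ->.
  by rewrite scale0r.
exists (\sum_k (k == l)%:R *: evec R (tvx m t k)).
  apply: hull_tri_comb => [k|]; first by rewrite ler0n.
  by rewrite (bigD1 l) //= eqxx big1 ?addr0 // => k /negPf ->.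
by rewrite (tri_lin_comb m_ge2 t (fun k => (k == l)%:R)) e1.
Qed.

Lemma triangle_convex t x y (h : R) : triangle t x -> triangle t y ->
  0 <= h <= 1 -> triangle t (x + h *: (y - x)).
Proof.
move=> [p /hull_simpP[p0 p1 pt] ->] [q /hull_simpP[q0 q1 qt] ->] /andP[h0 h1].
exists (p + h *: (q - p)); last by rewrite [RHS]linearD [X in _ = _ + X]linearZ [X in _ = _ + _ X]linearB.
have cE v : co (p + h *: (q - p)) v = (1 - h) * co p v + h * co q v.
  by rewrite /co !mxE; ring.
apply/hull_simpP; split=> [v||v vt].
- by rewrite cE addr_ge0 // mulr_ge0 // subr_ge0.
- under eq_bigr do rewrite cE.
  by rewrite big_split /= -!mulr_sumr p1 q1 !mulr1 subrK.
- by rewrite cE pt // qt // !mulr0 addr0.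
Qed.

Lemma triangle_diam t x y : triangle t x -> triangle t y -> `|x - y| <= MR^-1.
Proof.
have key (a : 'I_3 -> R) (z : E) : (forall l, 0 <= a l) -> \sum_l a l = 1 ->
    (forall l, `|tpt t l - z| <= MR^-1) -> `|\sum_l a l *: tpt t l - z| <= MR^-1.
  move=> a0 a1 hz.
  have -> : \sum_l a l *: tpt t l - z = \sum_l a l *: (tpt t l - z).
    rewrite [RHS](eq_bigr (fun l => a l *: tpt t l - a l *: z)) => [|l _]; last by rewrite scalerBr.
    by rewrite sumrB -scaler_suml a1 scale1r.
  apply: (@le_trans _ _ (\sum_l a l * MR^-1)); last by rewrite -mulr_suml a1 mul1r.
  apply: (le_trans (ler_norm_sum _ _ _)).
  apply: ler_sum => l _; rewrite normrZ (ger0_norm (a0 l)).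
  exact: (ler_wpM2l (a0 l) (hz l)).
move=> [p /(hull_triP m_ge2)[p0 p1 _] ->] [q /(hull_triP m_ge2)[q0 q1 _] ->].
apply: (key _ _ p0 p1) => l; rewrite -normrN opprB; apply: (key _ _ q0 q1) => l'.
exact: tpt_diam.
Qed.

Lemma triangle_cover z : exists t, triangle t z.
Proof. by have [t [ht zE]] := psi_cover m_ge2 z; exists t, (psi z). Qed.

(* For [s] near [z] the support of [psi s] contains that of [psi z], so that any
   triangle containing [s] contains [z]. *)
Lemma near_triangle z : \forall s \near z, exists2 t, triangle t s & triangle t z.
Proof.
have near_supp : \forall s \near z, forall v : V, co (psi z) v != 0 -> co (psi s) v != 0.
  apply: (@filter_forall _ _ (fun (v : V) (s : E) =>
    co (psi z) v != 0 -> co (psi s) v != 0)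
    (nbhs z) (nbhs_filter z)) => v /=.
  have [v0|pv] := eqVneq (co (psi z) v) 0; first by apply: nearW.
  have cv : {for z, continuous (fun s => co (psi s) v)}.
    exact: (continuous_comp (@psi_continuous R m z) (@coord_continuous R 1 _ 0 (enum_rank v) (psi z))).
  have : \forall s \near z, co (psi s) v != 0.
    apply: (cvgr_neq0 (co (psi z) v) cv).
    by move: pv.
  by apply: filterS => s h _.
have near_dist : \forall s \near z, `|z - s| < 1 - MR^-1.
  have M1 : 0 < 1 - MR^-1.
    by rewrite subr_gt0 invf_lt1 ?ltr0n // ltr1n; move: m_ge2; case: (m).
  by have := nbhsx_ballx z _ M1; rewrite -ball_normE.
near=> s.
have hs : forall v : V, co (psi z) v != 0 -> co (psi s) v != 0 by near: s.
have zs : `|z - s| < 1 - MR^-1 by near: s.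
have [t [ts sE]] := psi_cover m_ge2 s; exists t; first by exists (psi s).
have tz : hull (simp R (tri_set t)) (psi z).
  have [t' [/hull_simpP[p0 p1 _] _]] := psi_cover m_ge2 z.
  have /hull_simpP[_ _ st] := ts; apply/hull_simpP; split=> // v /st v0.
  by apply/eqP; apply: contraT => /hs; rewrite v0 eqxx.
exists (psi z) => //.
have [k zk] := psi_eq m_ge2 (esym (psi_tri_lin m_ge2 tz)).
have k0 : k = 0.
  apply: (@small_int_vec R).
  have -> : map_mx intr k = (z - s) + (s - tri_lin t (psi z)).
    by rewrite addrA subrK {1}zk addrC addKr.
  have d1 : `|s - tri_lin t (psi z)| <= MR^-1.
    by apply: (@triangle_diam t); [exists (psi s)|exists (psi z)].
  apply: (le_lt_trans (ler_normD _ _)).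
  by apply: (lt_le_trans (ltr_leD zs d1)); rewrite subrK.
by rewrite {1}zk k0; apply/rowP => i; rewrite !mxE addr0.
Unshelve. all: by end_near. Qed.

(** Also at a boundary point [z], the directions from [z] to the vertices stay in the triangle and
    span the plane. Hence the differential along a facet does not depend on the extension. *)
Lemma triangle_diff0 n t z (D : E -> 'rV[R]_(n * 2)) : triangle t z ->
  differentiable D z -> (\forall y \near z, triangle t y -> D y = 0) ->
  forall u, 'd D z u = 0.
Proof.
move=> tz dD D0.
have along y : triangle t y -> 'd D z (y - z) = 0.
  move=> ty; apply/eqP; rewrite -normr_le0; apply/ler_addgt0Pr => e e0; rewrite add0r.
  pose e' := e / (`|y - z| + 1).
  have e'0 : 0 < e' by rewrite divr_gt0 // ltr_wpDl.
  have nb := diff_near_bound dD e'0.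
  have [r /= r0 hr] := (nbhs_ballP _ _).1 (filterI D0 nb).
  pose h := Num.min 1 (r / 2 / (`|y - z| + 1)).
  have h0 : 0 < h by rewrite lt_min ltr01 !divr_gt0 // ltr_wpDl.
  have h1 : h <= 1 by rewrite ge_min lexx.
  have zt : triangle t (z + h *: (y - z)) by apply: triangle_convex => //; rewrite ltW.
  have bz : ball z r (z + h *: (y - z)).
    rewrite -ball_normE /= opprD addrA subrr add0r normrN normrZ ger0_norm ?ltW //.
    apply: (@le_lt_trans _ _ (r / 2 / (`|y - z| + 1) * `|y - z|)).
      by apply: ler_wpM2r => //; rewrite ge_min lexx orbT.
    apply: (@le_lt_trans _ _ (r / 2)); last by rewrite ltr_pdivrMr // ltr_pMr // ltr1n.
    rewrite mulrAC ler_pdivrMr ?ltr_wpDl //; apply: ler_wpM2l; rewrite ?lerDl //.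
    by rewrite divr_ge0 // ltW.
  have [/= hD hb] := hr _ bz.
  have Dz : D z = 0 by exact: (nbhs_singleton D0 tz).
  move: hb; rewrite (hD zt) Dz subrr sub0r normrN (addrC z) addrK.
  have hE : `|'d D z (h *: (y - z))| = h * `|'d D z (y - z)|.
    by rewrite [X in `|X|]linearZ normrZ ger0_norm // ltW.
  rewrite hE normrZ (ger0_norm (ltW h0)) mulrCA ler_pM2l // => hb.
  apply: (le_trans hb); rewrite /e' mulrAC ler_pdivrMr ?ltr_wpDl //.
  by apply: ler_wpM2l; rewrite ?lerDl // ltW.
have dE v : 'd D z v = lin ('d D z (pt 1 0)) ('d D z (pt 0 1)) v.
  exact (diff_plane D z v).
(* With zero data and [d = 0] the estimate says that a linear map vanishing on the edges is
   determined. *)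
have [a [b [_ _ hab]]] := triangle_affine t (fun=> 0 : 'rV[R]_(n * 2)).
have lin0 a0 b0 : (forall l, lin a0 b0 (tpt t l - tpt t 0) = 0) -> forall u, lin a b u = lin a0 b0 u.
  move=> hl u; apply/eqP; rewrite -subr_eq0 -normr_le0.
  have := hab a0 b0 0 _ u; rewrite mulr0 mul0r; apply => l.
  by rewrite hl mul0r !subr0 normr0.
move=> u; rewrite (dE u) -(lin0 ('d D z (pt 1 0)) ('d D z (pt 0 1))); last first.
  move=> l; rewrite -(dE (tpt t l - tpt t 0)).
  have -> : tpt t l - tpt t 0 = (tpt t l - z) - (tpt t 0 - z).
    by rewrite opprB addrA subrK.
  rewrite [LHS]linearB; rewrite (along _ (triangle_vertex t l)) (along _ (triangle_vertex t 0)).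
  exact: subr0.
rewrite (lin0 0 0); first by rewrite /lin !scaler0 addr0.
by move=> l; rewrite /lin !scaler0 addr0.
Qed.

End Triangles.

(** * The triangulation of the surface *)

Section SurfaceTriangulation.
Variables (R : realType) (S : smoothSurface R).
Variables (F : S -> torus R) (G : torus R -> S).
Hypothesis sF : smooth_surface_map F.
Hypothesis sG : smooth_surface_map G.
Hypothesis FK : cancel F G.
Hypothesis GK : cancel G F.
Local Notation E := 'rV[R]_2.
Local Notation unif := (unif G).

Lemma surface_compact : compact [set: S].
Proof.
have -> : [set: S] = unif @` @unit_box R.
  apply/esym/seteqP; split => // x _; have [z ->] := unif_surj FK x.
  by have [k hk] := unit_box_rep z; exists (z + map_mx intr k) => //; rewrite unif_periodic.
apply: continuous_compact; last exact: unit_box_compact.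
by apply: continuous_subspaceT; exact: (unif_map_continuous sG).
Qed.

Variable (m : nat).
Hypothesis m_ge2 : (2 <= m)%N.
Local Notation V := ('I_m.+1 * 'I_m.+1 * bool)%type.
Local Notation psi := (@psi R m).
Local Notation tri_set := (@tri_set m).
Local Notation tri_lin := (@tri_lin R m).
Local Notation triangle := (@triangle R m).
Local Notation faces := (torus_faces m).

Section Barycentric.
Variable Psi : S -> 'rV[R]_#|{: V}|.
Hypothesis Psi_continuous : continuous Psi.
Hypothesis PsiE : forall z, Psi (unif z) = psi z.

Lemma Psi_inj x y : Psi x = Psi y -> x = y.
Proof.
have [z ->] := unif_surj FK x; have [w ->] := unif_surj FK y.
by rewrite !PsiE => /(psi_eq m_ge2)[k ->]; exact: unif_periodic.
Qed.

Lemma Psi_homeomorphism : homeomorphism_on setT (polyhedron (realization R faces)) Psi.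
Proof.
have -> : polyhedron (realization R faces) = Psi @` setT.
  rewrite torus_polyhedron //; apply/seteqP; split => p [z _ <-].
    by exists (unif z).
  by have [w ->] := unif_surj FK z; exists w.
apply: (compact_injective_homeomorphism (unif 0) surface_compact).
- exact: norm_hausdorff.
- by apply: continuous_subspaceT; exact: Psi_continuous.
- by move=> x y _ _; exact: Psi_inj.
Qed.

Variable phi : 'rV[R]_#|{: V}| -> S.
Hypothesis phi_homeo : homeomorphism_on (polyhedron (realization R faces)) setT phi.
Hypothesis phiK : forall x, phi (Psi x) = x.

Lemma phi_tri t p : hull (simp R (tri_set t)) p -> phi p = unif (tri_lin t p).
Proof. by move=> hp; rewrite -[in LHS](psi_tri_lin m_ge2 hp) -PsiE phiK. Qed.

Lemma phi_immersion s : s \in realization R faces -> immersion_on_simplex phi s.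
Proof.
move=> /realizationP[S0 /torus_facesP[_ [t St]] ->] p c hp ac cp.
have tE q : hull (simp R S0) q -> phi q = unif (tri_lin t q).
  by move=> /(hull_sub St); exact: phi_tri.
have [oc _ _ _ _] := atlas_chart ac.
have ct : continuous (tri_lin t) by exact: linear_rV_continuous.
have skk := chart_unif_smooth sG ac.
have oU : open (unif @^-1` dom c).
  by apply: open_comp => // z _; exact: (unif_map_continuous sG).
rewrite (tE _ hp) in cp.
exists (tri_lin t @^-1` (unif @^-1` dom c)), ((chart_map c \o unif) \o tri_lin t); split.
- by apply: open_comp => // q _; exact: ct.
- by [].
- exact: smooth_on_precomp ct skk.
- by move=> q Wq hq; rewrite (tE _ hq).
- move=> w dw.
  have dkk : differentiable (chart_map c \o unif) (tri_lin t p).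
    exact: smooth_differentiable skk cp.
  have dt : differentiable (tri_lin t) p by exact: (linear_differentiable p ct).
  move=> h0; have {}h0 := etrans (esym (diff_comp_at erefl dt dkk w)) h0.
  have tE' : 'd (tri_lin t) p w = tri_lin t w.
    exact: (congr1 (@^~ w) (diff_lin p ct)).
  have [h _] := chart_unif_diff_inv sF sG FK GK ac cp.
  apply: (tri_lin_direction m_ge2 St dw); apply: (etrans (esym tE')).
  apply: (etrans (esym (h _))).
  exact: (etrans (congr1 (diff_in (ulift F _) c _) h0) (linear0 _)).
Qed.

Definition surface_triangulation : smoothTriangulation S :=
  SmoothTriangulation (torus_complex R m) phi_homeo phi_immersion.

Lemma surface_facet A : facet surface_triangulation A -> exists t, A = unif @` triangle t.
Proof.
move=> [s [/realizationP[S0 /torus_facesP[_ [t St]] ->]]]; rewrite card_simp => c3 ->.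
have SE : S0 = tri_set t.
  apply/eqP; rewrite eqEcard St c3 card_imset ?card_ord //.
  exact: (tvx_inj m_ge2).
exists t; rewrite SE; apply/seteqP; split => x.
  by move=> [p hp <-]; exists (tri_lin t p); [exists p|exact: (esym (phi_tri hp))].
by move=> [_ [p hp ->] <-]; exists p => //; exact: phi_tri hp.
Qed.

End Barycentric.

(** [psi] descends to a homeomorphism of the surface onto the realization, whose inverse is the
    triangulating map. As coordinates there are barycentric, arbitrary vertex values extend by one
    matrix common to all simplices. *)
Lemma exists_triangulation : exists T : smoothTriangulation S,
  (forall A, facet T A -> exists t, A = unif @` triangle t) /\
  forall n (Pv : V -> 'rV[R]_n), exists f : S -> 'rV[R]_n, [/\ continuous f,
    forall z, f (unif z) = \sum_v co (psi z) v *: Pv v &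
    forall s, s \in tri_complex T -> exists (A : 'M[R]_(tri_dim T, n)) (b : 'rV[R]_n),
      forall p, hull s p -> f (@tri_map R S T p) = p *m A + b].
Proof.
have [Psi cPsi PsiE] := descend sF GK (@psi_continuous R m) (@psi_periodic R m).
have hPsi := Psi_homeomorphism cPsi PsiE.
have [phi hphi phiK'] := homeomorphism_on_sym hPsi.
have phiK x : phi (Psi x) = x by exact: phiK'.
exists (surface_triangulation PsiE hphi phiK); split; first exact: surface_facet.
move=> n Pv; pose A : 'M[R]_(#|{: V}|, n) := \matrix_(i, j) Pv (enum_val i) 0 j.
have AE p : p *m A = \sum_v co p v *: Pv v.
  apply/rowP => j; rewrite !mxE summxE (reindex enum_rank) /=; last first.
    by apply: onW_bij; exact: enum_rank_bij.
  by apply: eq_bigr => v _; rewrite !mxE enum_rankK.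
exists (fun x => Psi x *m A); split.
- move=> x; exact: (continuous_comp (cPsi x) (@linear_rV_continuous R _ _ (mulmxr A) (Psi x))).
- by move=> z; rewrite PsiE AE.
- move=> s sK; exists A, 0 => p hp; rewrite addr0 /=.
  have : polyhedron (realization R faces) p by exists s.
  by rewrite torus_polyhedron // => -[z _ <-]; rewrite -PsiE phiK.
Qed.

End SurfaceTriangulation.

Lemma int_periodic (T : Type) (g : int -> T) (N : int) :
  (forall i, g (i + N) = g i) -> forall i k, g (i + N * k) = g i.
Proof.
move=> h i k; have hn (j : int) (q : nat) : g (j + N * q%:Z) = g j.
  elim: q => [|q IH]; first by rewrite mulr0 addr0.
  by rewrite -[RHS]IH -[RHS]h; congr g; rewrite intS; lia.
case: k => q; first exact: hn.
by rewrite -[LHS](hn _ q.+1); congr g; rewrite NegzE; lia.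
Qed.

Section Interpolation.
Variables (R : realType) (n m : nat).
Hypothesis m_ge2 : (2 <= m)%N.
Local Notation E := 'rV[R]_2.
Local Notation W := 'rV[R]_(n * 2).
Local Notation MR := (m.+1%:R : R).
Local Notation V := ('I_m.+1 * 'I_m.+1 * bool)%type.
Local Notation tpt := (tpt R m).
Local Notation psi := (@psi R m).
Local Notation triangle := (@triangle R m).
Variable Pv : V -> W.

Definition interp (z : E) : W := \sum_v co (psi z) v *: Pv v.

Lemma interp_triangle t z (p q : W) :
  (forall l, lin p q (tpt t l - tpt t 0) = Pv (tvx m t l) - Pv (tvx m t 0)) ->
  triangle t z -> interp z = Pv (tvx m t 0) + lin p q (z - tpt t 0).
Proof.
move=> hl tz; have [hp zE] := triangleP m_ge2 tz.
have [p0 p1 pE] := hull_triP m_ge2 hp.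
have /hull_simpP[_ _ pS] := hp.
have -> : interp z = \sum_l co (psi z) (tvx m t l) *: Pv (tvx m t l).
  rewrite -(big_tri_set m_ge2 t (fun v => co (psi z) v *: Pv v)) [RHS]big_mkcond /=.
  by apply: eq_bigr => v _; case: ifPn => // /pS ->; rewrite scale0r.
have -> : z - tpt t 0 = \sum_l co (psi z) (tvx m t l) *: (tpt t l - tpt t 0).
  rewrite [RHS](eq_bigr (fun l => co (psi z) (tvx m t l) *: tpt t l - co (psi z) (tvx m t l) *: tpt t 0)).
    by rewrite sumrB -scaler_suml p1 scale1r {1}zE.
  by move=> l _; rewrite scalerBr.
rewrite [X in _ = _ + X]linear_sum.
rewrite [X in _ = _ + X](eq_bigr (fun l =>
  co (psi z) (tvx m t l) *: Pv (tvx m t l) - co (psi z) (tvx m t l) *: Pv (tvx m t 0))).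
  by rewrite sumrB -scaler_suml p1 scale1r addrC subrK.
by move=> l _; rewrite -scalerBr -hl; exact: linearZ.
Qed.

End Interpolation.

Lemma exists_interpolation (R : realType) (n : nat) (f a b : 'rV[R]_2 -> 'rV[R]_(n * 2))
    (e : R) (N0 : nat) : torus_immersion f a b -> 0 < e ->
  exists m (Pv : 'I_m.+1 * 'I_m.+1 * bool -> 'rV[R]_(n * 2)),
    (N0 < m)%N /\ forall t, exists p q, omega p q = 0 /\ forall z, @triangle R m t z ->
    [/\ interp Pv z = Pv (tvx m t 0) + lin p q (z - tpt R m t 0),
        forall u, `|lin p q u - lin (a z) (b z) u| <= e * `|u| &
        `|interp Pv z - f z| <= e].
Proof.
(* The differential costs [4 * 3 e1], from two vertex errors and the expansion of [f]; the values
   cost [14 e1]. *)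
move=> tf e0; pose e1 := e / 16.
have e10 : 0 < e1 by rewrite divr_gt0.
have [d d0 hd] := strict_diff tf e10.
have [N1] := ltr_add_invr d0; rewrite add0r => hN1.
have [M [G0 [G1 [MN [[g0x g0y g1x g1y] hG]]]]] := exists_isotropic_grid (maxn N0 (maxn N1 1)).+1 tf e10.
case: M MN g0x g0y g1x g1y hG => [//|m]; rewrite ltnS => MN g0x g0y g1x g1y hG.
have [N0m N1m m_ge2] : [/\ (N0 < m)%N, (N1 <= m)%N & (2 <= m)%N].
  by move: MN; rewrite !gtn_max => /and3P[h1 h2 h3]; split; lia.
have Md : m.+1%:R^-1 < d.
  by apply: le_lt_trans hN1; rewrite lef_pV2 ?posrE ?ltr0n // ler_nat ltnS.
have M1 : m.+1%:R^-1 <= 1 :> R by rewrite invf_le1 ?ltr0n // ler1n.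
have per (H : int -> int -> 'rV[R]_(n * 2)) (i j : int) : (forall i j, H (i + m.+1%:Z) j = H i j) ->
    (forall i j, H i (j + m.+1%:Z) = H i j) -> H (idx m i : nat)%:Z (idx m j : nat)%:Z = H i j.
  move=> hx hy.
  have [k ek] := (idx_eq m_ge2 _ _).1 (idxK m_ge2 (idx m i)).
  have [k' ek'] := (idx_eq m_ge2 _ _).1 (idxK m_ge2 (idx m j)).
  rewrite ek ek'.
  rewrite (int_periodic (g := H (i + m.+1%:Z * k)) (hy _)).
  exact: (int_periodic (g := H^~ j) (hx^~ j)).

pose Pv (w : 'I_m.+1 * 'I_m.+1 * bool) : 'rV[R]_(n * 2) :=
  let: (i, j, c) := w in
  if c then G1 (i : nat)%:Z (j : nat)%:Z else G0 (i : nat)%:Z (j : nat)%:Z.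
exists m, Pv; split=> // t.
have Pf l : `|Pv (tvx m t l) - f (tpt R m t l)| <= e1 / m.+1%:R.
  case: t => -[i j] s; rewrite /tvx /tpt; case: ifP => _; [|case: ifP => _]; rewrite /Pv per //.
  - have [h _ _] := hG (i + (nat_of_bool (offset s false).1)%:Z) (j + (nat_of_bool (offset s false).2)%:Z).
    by move: h; rewrite !intrD.
  - have [h _ _] := hG (i + (nat_of_bool (offset s true).1)%:Z) (j + (nat_of_bool (offset s true).2)%:Z).
    by move: h; rewrite !intrD.
  - by have [_ h _] := hG i j.
have [p [q [hl hpq hest]]] := @triangle_affine R m n t (fun l => Pv (tvx m t l)).
exists p, q; split.
  apply: hpq; case: (t) => -[i j] [h far].
  have [_ _ [p01 p12 p23 p30]] := hG i j.
  (* Isotropy of a triangle can be tested at any vertex: a pyramid does it at the apex,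
     [triangle_affine] at vertex 0. *)
  have key (A B C : 'rV[R]_(n * 2)) : omega (A - C) (B - C) = 0 -> omega (B - A) (C - A) = 0.
    have -> : B - A = (B - C) - (A - C) by rewrite opprB addrA subrK.
    have -> : C - A = - (A - C) by rewrite opprB.
    move=> h0; rewrite omegaNr omegaDl omegaNl omegavv omega_skew h0.
    by rewrite !oppr0 addr0 oppr0.
  have skew (A B : 'rV[R]_(n * 2)) : omega A B = 0 -> omega B A = 0.
    by move=> h0; rewrite omega_skew h0 oppr0.
  rewrite /tvx /= /Pv !per //; apply: key; rewrite /offset.
  by case: h; case: far => /=; rewrite ?addr0 //; apply: skew.
move=> z tz; have lu u : `|lin p q u - lin (a z) (b z) u| <= 12 * e1 * `|u|.
  rewrite (_ : 12 * e1 = 4 * (3 * e1)); last by ring.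
  apply: hest => l.
  have c1 : `|tpt R m t 0 - z| < d.
    by apply: le_lt_trans Md; apply: (triangle_diam m_ge2 (triangle_vertex R m_ge2 t _) tz).
  have c2 : `|tpt R m t l - z| < d.
    by apply: le_lt_trans Md; apply: (triangle_diam m_ge2 (triangle_vertex R m_ge2 t _) tz).
  have h1 := hd z _ _ c1 c2; have h2 := Pf l; have h3 := Pf 0.
  have h4 : e1 * `|tpt R m t l - tpt R m t 0| <= e1 / m.+1%:R.
    by rewrite ler_pM2l // tpt_diam.
  have {h4}h1 := le_trans h1 h4.
  have -> : Pv (tvx m t l) - Pv (tvx m t 0) - lin (a z) (b z) (tpt R m t l - tpt R m t 0) =
    (f (tpt R m t l) - f (tpt R m t 0) - lin (a z) (b z) (tpt R m t l - tpt R m t 0)) +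
    (Pv (tvx m t l) - f (tpt R m t l)) - (Pv (tvx m t 0) - f (tpt R m t 0)).
    by apply/rowP => k; rewrite !mxE; ring.
  apply: (le_trans (ler_normB _ _)); apply: (@le_trans _ _ (e1 / m.+1%:R + e1 / m.+1%:R + e1 / m.+1%:R)).
    by apply: lerD => //; apply: (le_trans (ler_normD _ _)); apply: lerD.
  by rewrite le_eqVlt; apply/orP; left; apply/eqP; ring.
have iz := interp_triangle m_ge2 hl tz.
split=> // [u|].
  apply: (le_trans (lu u)); apply: ler_wpM2r => //.
  by rewrite /e1; move: (e) e0; clear; move=> x x0; lra.
pose v := z - tpt R m t 0.
have v1 : `|v| <= m.+1%:R^-1 by exact: (triangle_diam m_ge2 tz (triangle_vertex R m_ge2 t _)).
have v2 := le_trans v1 M1.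
have zd : `|z - z| < d by rewrite subrr normr0.
have c1 : `|tpt R m t 0 - z| < d by rewrite distrC (le_lt_trans v1).
have h1 := hd z _ _ c1 zd; have h2 := lu v; have h3 := Pf 0.
have -> : interp Pv z - f z = (Pv (tvx m t 0) - f (tpt R m t 0)) +
  (lin p q v - lin (a z) (b z) v) - (f z - f (tpt R m t 0) - lin (a z) (b z) v).
  by rewrite iz -/v; move: (lin _ _ _) (lin _ _ _) => x y; apply/rowP => k; rewrite !mxE; ring.
have k3 : `|Pv (tvx m t 0) - f (tpt R m t 0)| <= e1.
  by apply: (le_trans h3); rewrite ger_pMr.
have k2 : `|lin p q v - lin (a z) (b z) v| <= 12 * e1.
  by apply: (le_trans h2); rewrite ger_pMr // mulr_gt0.
have k1 : `|f z - f (tpt R m t 0) - lin (a z) (b z) v| <= e1.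
  by apply: (le_trans h1); rewrite ger_pMr.
apply: (le_trans (ler_normB _ _)); apply: (@le_trans _ _ (e1 + 12 * e1 + e1)).
  by apply: lerD => //; apply: (le_trans (ler_normD _ _)); apply: lerD.
by rewrite /e1; move: (e) e0; clear; move=> x x0; lra.
Qed.

(** * Quantitative injectivity and Lipschitz estimates in the plane *)

Section Planar.
Variables (R : realType) (n : nat).
Local Notation E := 'rV[R]_2.
Local Notation W := 'rV[R]_(n * 2).
Variables f a b : E -> W.
Hypothesis tf : torus_immersion f a b.

(** The coordinates of [u] are recovered by pairing its image with [mu] and [nu]. *)
Lemma immersion_bound : exists2 K, 0 < K &
  forall z u, `|u| <= K * `|lin (a z) (b z) u|.
Proof.
have [B [mu [nu [B0 _ _ _ fr]]]] := exists_frame tf.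
exists ((n * 2)%:R * B + 1) => [|z u].
  by apply: ltr_wpDl => //; apply: mulr_ge0 => //; exact: ltW.
have [[ab am an bm bn] [mn _ _ hm hn]] := fr z.
set v := lin _ _ u.
have n0 : 0 <= (n * 2)%:R * `|v| :> R by apply: mulr_ge0.
apply: (@le_trans _ _ ((n * 2)%:R * B * `|v|)); last first.
  by apply: ler_wpM2r => //; rewrite lerDl.
apply: norm_le_coord => [|i]; first by rewrite !mulr_ge0 // ltW.
have hu (w : W) (r : R) : omega v w = r -> `|w| <= B -> `|r| <= (n * 2)%:R * B * `|v|.
  move=> <- hw; apply: (le_trans (omega_bound v w)).
  by rewrite [leRHS]mulrAC; apply: ler_wpM2l.
have [->|->] : i = 0 \/ i = 1.
  by case: i => -[|[|]] //= hi; [left|right]; apply: val_inj.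
- apply: (hu (mu z)) => //.
  by rewrite /v /lin omegaDl !omegaZl am bm mulr1 mulr0 addr0.
- apply: (hu (nu z)) => //.
  by rewrite /v /lin omegaDl !omegaZl an bn mulr1 mulr0 add0r.
Qed.

Lemma torus_immersion_continuous : continuous f.
Proof.
have [_ [hf _ _]] := tf; move=> z; apply: (iffRL (@cvgrPdist_lt _ _ _ (nbhs z) (nbhs_filter z) f (f z))) => e e0.
pose M := `|a z| + `|b z| + 1.
have M0 : 0 < M by rewrite ltr_wpDl // addr_ge0.
have hz : \forall s \near z, `|z - s| < e / M.
  by have := nbhsx_ballx z _ (divr_gt0 e0 M0); rewrite -ball_normE.
have h1 := hf z 1 ltr01.
near=> s.
have h : `|f s - f z - lin (a z) (b z) (s - z)| <= 1 * `|s - z| by near: s.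
have hs : `|z - s| < e / M by near: s; exact: hz.
rewrite distrC; apply: (@le_lt_trans _ _ (M * `|s - z|)).
  rewrite -(subrK (lin (a z) (b z) (s - z)) (f s - f z)).
  apply: (le_trans (ler_normD _ _)); apply: (le_trans (lerD h (norm_lin _ _ _))).
  by rewrite -mulrDl addrC.
by rewrite mulrC -ltr_pdivlMr // distrC.
Unshelve. all: by end_near. Qed.

(** Being within [d] of a lattice translate is an open condition on the pair; elsewhere [f]
    separates the points, and half the gap persists nearby. Compactness of the product of unit boxes
    makes the gap uniform. *)
Lemma torus_separation (d : R) : 0 < d ->
  (forall z w, f z = f w -> exists k : 'rV[int]_2, z = w + map_mx intr k) ->
  exists2 c, 0 < c & forall z w, (exists k : 'rV[int]_2, `|z - (w + map_mx intr k)| < d) \/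
    c <= `|f z - f w|.
Proof.
move=> d0 inj; have cf := torus_immersion_continuous; have [[pf _ _ _ _] _] := tf.
pose P (c : R) (p : E * E) := (exists k : 'rV[int]_2, `|p.1 - (p.2 + map_mx intr k)| < d) \/
    c <= `|f p.1 - f p.2|.
have cK := compact_setX (@unit_box_compact R) (@unit_box_compact R).
have := (compact_near_coveringP _).1 cK R (0^'+) P _.
case=> [[z0 w0] _|c /= c0 hc].
  have [[k hk]|nk] := EM (exists k : 'rV[int]_2, `|z0 - (w0 + map_mx intr k)| < d).
    have ck : {for (z0, w0), continuous (fun p : E * E => `|p.1 - (p.2 + map_mx intr k)|)}.
      apply: cvg_norm; apply: cvgB; first exact: cvg_fst.
      by apply: cvgD; [exact: cvg_snd|exact: cvg_cst].
    have near_p : \forall p \near (z0, w0), `|p.1 - (p.2 + map_mx intr k)| < d.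
      exact: (cvgr_lt _ ck).
    have near_q : \forall p \near (z0, w0) & c \near (0^'+ : set_system R), P c p.
      near=> p c; left; exists k.
      have h : `|p.1 - (p.2 + map_mx intr k)| < d by near: p; exact: near_p.
      exact: h.
    exact: near_q.
  have v0 : 0 < `|f z0 - f w0|.
    rewrite normr_gt0 subr_eq0; apply/eqP => /inj[k zw]; apply: nk; exists k.
    by rewrite zw subrr normr0.
  have ck : {for (z0, w0), continuous (fun p : E * E => `|f p.1 - f p.2|)}.
    apply: cvg_norm; apply: cvgB.
      by apply: (continuous_comp (g := f) (f := fst)); [exact: cvg_fst|exact: cf].
    by apply: (continuous_comp (g := f) (f := snd)); [exact: cvg_snd|exact: cf].
  have v2 : `|f z0 - f w0| / 2 < `|f z0 - f w0| by rewrite ltr_pdivrMr // ltr_pMr // ltr1n.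
  have near_p : \forall p \near (z0, w0), `|f z0 - f w0| / 2 < `|f p.1 - f p.2|.
    exact: (cvgr_gt _ ck).
  have v20 : 0 < `|f z0 - f w0| / 2 by exact: divr_gt0.
  near=> p c; right.
  have h2 : c <= `|f z0 - f w0| / 2 by near: c; exact: nbhs_right_le.
  have h1 : `|f z0 - f w0| / 2 < `|f p.1 - f p.2| by near: p; exact: near_p.
  exact: le_trans h2 (ltW h1).
have c2 : 0 < c / 2 by exact: divr_gt0.
have bc : `|0 - c / 2| < c.
  by rewrite sub0r normrN ger0_norm ?ltr_pdivrMr ?ltr_pMr ?ltr1n // ltW.
exists (c / 2) => // z w; have [k zk] := unit_box_rep z; have [k' wk'] := unit_box_rep w.
have := hc (c / 2) bc c2 (z + map_mx intr k, w + map_mx intr k') (conj zk wk').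
rewrite /P /= !pf => -[[j hj]|h]; [left|by right].
exists (k' + j - k); congr (`|_| < d): hj.
by apply/rowP => i; rewrite !mxE !intrD rmorphN /=; ring.
Unshelve. all: by end_near. Qed.

Variables (m : nat) (Pv : 'I_m.+1 * 'I_m.+1 * bool -> W) (e : R).
Hypothesis m_ge2 : (2 <= m)%N.
Hypothesis e0 : 0 < e.
Hypothesis Pv_approx : forall t, exists p q, omega p q = 0 /\ forall z, @triangle R m t z ->
    [/\ interp Pv z = Pv (tvx m t 0) + lin p q (z - tpt R m t 0),
        forall u, `|lin p q u - lin (a z) (b z) u| <= e * `|u| &
        `|interp Pv z - f z| <= e].

Lemma interp_dist z : `|interp Pv z - f z| <= e.
Proof.
have [t tz] := triangle_cover m_ge2 z; have [p [q [_ h]]] := Pv_approx t.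
by have [_ _] := h z tz.
Qed.

(** The interpolation has corners, so the mean value inequality is used in its pointwise form:
    points near [z] share a triangle with [z], where the linear parts differ by [e], and expanding
    [f] costs another [e]. *)
Lemma interp_lipschitz x y :
  `|(interp Pv y - f y) - (interp Pv x - f x)| <= 2 * e * `|y - x|.
Proof.
apply: (lipschitz_segment (g := fun z => interp Pv z - f z)) => r _.
move: (x + _) => z; have [_ [hf _ _]] := tf; have hz := hf z e e0.
have nt := near_triangle m_ge2 z.
near=> s.
have [t ts tz] : exists2 t, @triangle R m t s & @triangle R m t z by near: s; exact: nt.
have h : `|f s - f z - lin (a z) (b z) (s - z)| <= e * `|s - z| by near: s.
have [p [q [_ hpq]]] := Pv_approx t; have [iz hl _] := hpq z tz; have [is_ _ _] := hpq s ts.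
have -> : interp Pv s - f s - (interp Pv z - f z) =
  (lin p q (s - z) - lin (a z) (b z) (s - z)) - (f s - f z - lin (a z) (b z) (s - z)).
  have -> : s - z = (s - tpt R m t 0) - (z - tpt R m t 0) by rewrite opprB addrA subrK.
  rewrite iz is_ [lin p q (_ - (z - _))]linB; move: (lin _ _ _) (lin _ _ _) (lin _ _ _) => u v w.
  by apply/rowP => k; rewrite !mxE; ring.
apply: (le_trans (ler_normB _ _)); rewrite mulr2n mulrDl mul1r mulrDl; apply: lerD => //; exact: hl.
Unshelve. all: by end_near. Qed.

End Planar.

Lemma enorm_le (R : realType) p (v : 'rV[R]_p) : enorm v <= p%:R * `|v|.
Proof.
rewrite /enorm -[leRHS]ger0_norm ?mulr_ge0 // -sqrtr_sqr ler_wsqrtr //.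
have h : \sum_i v 0 i ^+ 2 <= p%:R * `|v| ^+ 2.
  apply: (@le_trans _ _ (\sum_(i < p) `|v| ^+ 2)); last first.
    by rewrite sumr_const card_ord mulr_natl.
  apply: ler_sum => i _.
  by rewrite -real_normK ?num_real // lerXn2r ?nnegrE // coord_le_norm.
apply: (le_trans h); rewrite exprMn; apply: ler_wpM2r; first exact: sqr_ge0.
by rewrite -natrX ler_nat; case: (p) => // q; rewrite expnS expn1 leq_pmulr.
Qed.

(** * Smoothness and differentials along facets *)

Section Within.
Variables (R : realType) (S : smoothSurface R) (V : normedModType R).

Lemma chart_image_open (c : chart R S) (W : set S) : atlas c -> open W ->
  open (chart_map c @` (dom c `&` W)).
Proof.
move=> ac oW; have [oc oim cK cc ci] := atlas_chart ac.
rewrite openE => _ [x [cx Wx] <-].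
have imx : (chart_map c @` dom c) (chart_map c x) by exists x.
have n1 : \forall y \near chart_map c x, (chart_map c @` dom c) y.
  exact: open_nbhs_nbhs.
have n2 : \forall y \near chart_map c x, W (chart_inv c y).
  by apply: (ci _ imx); apply: open_nbhs_nbhs; split=> //; rewrite cK.
apply: filterS2 n1 n2 => _ [x' cx' <-]; rewrite cK // => Wx'.
by exists x'.
Qed.

Lemma smooth_map_on_sub (W W' : set S) (h : S -> V) : W' `<=` W ->
  smooth_map_on W h -> smooth_map_on W' h.
Proof.
move=> sub sh c ac; apply: smooth_on_subset (sh c ac) => _ [x [cx W'x] <-].
by exists x => //; split=> //; exact: sub.
Qed.

Lemma smooth_within_map (A : set S) (h : S -> V) : smooth_map h -> smooth_within A h.
Proof. by move=> sh x Ax; exists setT, h; split=> //; exact: openT. Qed.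

Lemma smooth_withinB (A : set S) (h h' : S -> V) :
  smooth_within A h -> smooth_within A h' -> smooth_within A (h \- h').
Proof.
move=> sh sh' x Ax; have [W [k [oW Wx sk ek]]] := sh x Ax.
have [W' [k' [oW' W'x sk' ek']]] := sh' x Ax.
exists (W `&` W'), (k \- k'); split=> //; first exact: openI.
  move=> c ac; have oI := chart_image_open ac (openI oW oW').
  apply: (smooth_onB oI).
    by have := smooth_map_on_sub (@subIsetl _ W W') sk ac.
  by have := smooth_map_on_sub (@subIsetr _ W W') sk' ac.
by move=> y Ay [Wy W'y] /=; rewrite ek // ek'.
Qed.

End Within.

Section Facets.
Variables (R : realType) (S : smoothSurface R).
Variables (F : S -> torus R) (G : torus R -> S).
Hypothesis sF : smooth_surface_map F.
Hypothesis sG : smooth_surface_map G.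
Hypothesis FK : cancel F G.
Hypothesis GK : cancel G F.
Local Notation E := 'rV[R]_2.
Local Notation unif := (unif G).
Variable (m : nat).
Hypothesis m_ge2 : (2 <= m)%N.
Local Notation triangle := (@triangle R m).
Variables (n : nat).
Local Notation W := 'rV[R]_(n * 2).

(** Any local extension, read in the plane, agrees with [H] on the triangle, so [triangle_diff0]
    identifies the differentials. *)
Lemma facet_diff (t : tri) (h : S -> W) (H : E -> W) (c : chart R S) z (L : E -> W) :
  triangle t z -> differentiable H z -> (forall y, triangle t y -> h (unif y) = H y) ->
  atlas c -> dom c (unif z) -> is_diff_within (unif @` triangle t) h c (unif z) L ->
  forall u, L u = 'd H z (diff_in (ulift F z) c (unif z) u).
Proof.
move=> tz dH hH ac cz [N [k [[] oN Nz sk ek ->]]] u.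
have [dk dkE] := diff_chart_unif sG oN sk ac Nz cz.
have [_ hinv] := chart_unif_diff_inv sF sG FK GK ac cz.
have dD : differentiable ((k \o unif) - H) z by exact: differentiableB.
have D0 : \forall y \near z, triangle t y -> ((k \o unif) - H) y = 0.
  have nN : \forall y \near z, N (unif y).
    by apply: (unif_map_continuous sG); exact: open_nbhs_nbhs.
  apply: filterS nN => y Ny ty; have Ay : (unif @` triangle t) (unif y) by exists y.
  rewrite !fctE /= (ek _ Ay Ny).
  by rewrite hH // subrr.
have e0 := triangle_diff0 m_ge2 tz dD D0 (diff_in (ulift F z) c (unif z) u).
have eB := congr1 (@^~ (diff_in (ulift F z) c (unif z) u)) (diffB dk dH).
have e1 := etrans (esym eB) e0.
rewrite -[LHS]/(diff_in k c (unif z) u).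
transitivity (diff_in k c (unif z) ('d (chart_map c \o unif) z (diff_in (ulift F z) c (unif z) u))).
  exact: (congr1 (diff_in k c (unif z)) (esym (hinv u))).
apply: (etrans (esym (dkE _))); apply/eqP; rewrite -subr_eq0; apply/eqP; exact: e1.
Qed.

Lemma affine_diff (p q w : W) z0 z u :
  differentiable (fun y : E => w + lin p q (y - z0)) z /\
  'd (fun y : E => w + lin p q (y - z0)) z u = lin p q u.
Proof.
have cl : continuous (lin p q) by exact: linear_rV_continuous.
have dl x : differentiable (lin p q) x by exact: linear_differentiable.
have -> : (fun y : E => w + lin p q (y - z0)) = cst (w - lin p q z0) + lin p q.
  by apply/funext => y; rewrite fctE /= linB addrA addrAC.
have i1 : is_diff z (lin p q) (lin p q).
  apply: DiffDef; first exact: dl.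
  by rewrite (@diff_lin _ _ _ (lin p q) z).
have i2 := is_diffD (is_diff_cst (w - lin p q z0) z) i1.
split; first exact: ex_diff.
exact: (etrans (congr1 (@^~ u) (@diff_val _ _ _ _ _ _ _ i2)) (add0r _)).
Qed.

(** The extension is the affine map after the local lift at [z]; a diameter below [1 / 4] keeps the
    facet in the ball where the lift inverts [unif]. *)
Lemma facet_smooth (t : tri) (h : S -> W) (p q w : W) (z0 : E) :
  m.+1%:R^-1 < 4^-1 :> R ->
  (forall y, triangle t y -> h (unif y) = w + lin p q (y - z0)) ->
  smooth_within (unif @` triangle t) h.
Proof.
move=> M4 hh _ [z tz <-].
exists (ulift_dom F z), (fun x => lin p q (ulift F z x) + (w - lin p q z0)); split.
- exact: (ulift_dom_open sF).
- by apply: (mem_ulift_dom GK); apply: ballxx; rewrite invr_gt0.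
- move=> c ac; have oI := chart_image_open ac (ulift_dom_open sF z).
  have cl : continuous (lin p q) by exact: linear_rV_continuous.
  exact: (smooth_on_postcomp (w - lin p q z0) cl oI (ulift_smooth sF z ac)).
- move=> _ [y ty <-] _; have b4 : ball z (4^-1 : R) y.
    rewrite -ball_normE /=; apply: le_lt_trans M4; exact (triangle_diam m_ge2 tz ty).
  by rewrite (uliftK GK b4) hh // linB addrCA.
Qed.

End Facets.

(** * The approximation *)

Section Approximation.
Variables (R : realType) (S : smoothSurface R).
Variables (F : S -> torus R) (G : torus R -> S).
Hypothesis sF : smooth_surface_map F.
Hypothesis sG : smooth_surface_map G.
Hypothesis FK : cancel F G.
Hypothesis GK : cancel G F.
Local Notation E := 'rV[R]_2.
Local Notation unif := (unif G).
Variables (n : nat) (l : S -> 'rV[R]_(n * 2)).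
Hypothesis il : immersion l.
Hypothesis isol : isotropic l.
Local Notation W := 'rV[R]_(n * 2).
Local Notation lu := (l \o unif).
Local Notation a := (fun z : E => 'd lu z (pt 1 0)).
Local Notation b := (fun z : E => 'd lu z (pt 0 1)).

Lemma exists_pl_approximation (g : riemannian S) (C e : R) : 0 < C -> 0 < e ->
  (forall z (c : chart R S) u, atlas c -> dom c (unif z) ->
    bform (gram g c (unif z)) u u <= 1 -> `|diff_in (ulift F z) c (unif z) u| <= C) ->
  exists f : S -> W,
    [/\ piecewise_linear f, piecewise_isotropic f, continuous f &
        C1_norm_le g (l \- f) ((n * 2)%:R * (e + e * C))] /\
    (forall z, `|f (unif z) - lu z| <= e) /\
    forall x y, `|(f (unif y) - lu y) - (f (unif x) - lu x)| <= 2 * e * `|y - x|.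
Proof.
move=> C0 e0 hC; have tf := pullback_torus_immersion sF sG FK GK il isol.
have [m [Pv [m4 hPv]]] := exists_interpolation 4 tf e0.
have m_ge2 : (2 <= m)%N by apply: leq_trans m4.
have M4 : m.+1%:R^-1 < 4^-1 :> R.
  by rewrite ltf_pV2 ?posrE ?ltr0n // ltr_nat; apply: leq_trans m4 _.
have [T [hT hf]] := exists_triangulation sF sG FK GK m_ge2.
have [f [cf fE fpl]] := hf _ Pv; exists f.
have fi z : f (unif z) = interp Pv z by exact: fE.
have ft t p q : omega p q = 0 /\ (forall z, triangle m t z ->
    [/\ interp Pv z = Pv (tvx m t 0) + lin p q (z - tpt R m t 0),
        forall u, `|lin p q u - lin (a z) (b z) u| <= e * `|u| &
        `|interp Pv z - lu z| <= e]) ->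
  forall z, triangle m t z -> f (unif z) = Pv (tvx m t 0) + lin p q (z - tpt R m t 0).
  by move=> [_ h] z tz; rewrite fi; have [] := h z tz.
have luD := pullback_differentiable sG il.
have fsm A : facet T A -> smooth_within A f.
  move=> /hT[t ->]; have [p [q hpq]] := hPv t.
  exact (facet_smooth sF GK m_ge2 M4 (ft _ _ _ hpq)).
have ad : adapted T f by split.
have adl : adapted T (l \- f).
  split; last first.
    by move=> A fA; apply: smooth_withinB; [exact: (smooth_within_map il.1)|exact: fsm].
  move=> x; apply: continuousB; last exact: cf.
  have [c ac cx] := atlas_cover x; have [oc oim cK cc ci] := atlas_chart ac.
  have h1 : {for x, continuous ((l \o chart_inv c) \o chart_map c)}.
    apply: continuous_comp; first exact: cc.
    by apply: (il.1 c ac 0%N); exists x.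
  apply: near_eq_continuous h1.
  have : \forall y \near x, dom c y by exact: open_nbhs_nbhs.
  by apply: filterS => y /cK /= ->.
split; last first.
  split=> [z|x y]; first by rewrite fi; exact: (interp_dist m_ge2 hPv).
  by rewrite !fi; exact: (interp_lipschitz tf m_ge2 e0 hPv).
split => //.
- by split=> //; exists T; exact: fpl.
- exists T; split=> // A x c L /hT[t AE]; rewrite AE => -[z tz <-] ac cz hL u v.
  have [p [q hpq]] := hPv t.
  have dH w := affine_diff p q (Pv (tvx m t 0)) (tpt R m t 0) z w.
  have LE := facet_diff sF sG FK GK m_ge2 tz (dH 0).1 (ft _ _ _ hpq) ac cz hL.
  rewrite (etrans (LE u) (dH _).2) (etrans (LE v) (dH _).2).
  exact: (omega_lin _ _ hpq.1).
(* The factor [n * 2] passes from the sup norm to the Euclidean one; [e] bounds the values and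
   [e * C] the differential on [g]-unit vectors. *)
exists T; split=> //; rewrite mulrDr EFinD; apply: leeD.
  apply: ge_ereal_sup => _ [x _ <-]; have [z ->] := unif_surj FK x.
  rewrite lee_fin; apply: (le_trans (enorm_le _)); apply: ler_wpM2l => //.
  by rewrite /= distrC fi; exact: (interp_dist m_ge2 hPv).
apply: ge_ereal_sup => _ [A [x [c [L [/hT[t ->] [z tz <-] [ac cz] hL ->]]]]].
have [p [q hpq]] := hPv t.
have [dA _] := affine_diff p q (Pv (tvx m t 0)) (tpt R m t 0) z 0.
have dAE w := (affine_diff p q (Pv (tvx m t 0)) (tpt R m t 0) z w).2.
pose B := (fun y : E => Pv (tvx m t 0) + lin p q (y - tpt R m t 0)).
have dH : differentiable (lu - B) z by exact: (differentiableB (luD z) dA).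
have hH y : triangle m t y -> (l \- f) (unif y) = (lu - B) y.
  by move=> ty; rewrite !fctE /= (ft _ _ _ hpq y ty).
have LE := facet_diff sF sG FK GK m_ge2 tz dH hH ac cz hL.
have HE w : 'd (lu - B) z w = lin (a z) (b z) w - lin p q w.
  apply: (etrans (congr1 (@^~ w) (diffB (luD z) dA))).
  apply: (etrans (congr1 (fun x => 'd lu z w - x) (dAE w))).
  exact: (congr1 (fun x => x - lin p q w) (diff_plane lu z w)).
apply: ge_ereal_sup => _ [u /= hu <-]; rewrite lee_fin.
apply: (le_trans (enorm_le _)); apply: ler_wpM2l => //.
rewrite (etrans (LE u) (HE _)) distrC.
have [_ hest _] := hpq.2 z tz.
apply: (le_trans (hest _)); apply: ler_wpM2l; first exact: ltW.
exact: (hC z c u ac cz hu).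
Qed.

(** With [K] from [immersion_bound], strict differentiability and the perturbation cost [1 / (4 K)]
    each. If the values agree, then [|y - x| <= |y - x| / 2]. *)
Lemma surface_local_injectivity : exists d e, [/\ 0 < d, 0 < e &
  forall f : S -> W, (forall x y, `|(f (unif y) - lu y) - (f (unif x) - lu x)| <= 2 * e * `|y - x|) ->
  forall x y, `|y - x| < d -> f (unif x) = f (unif y) -> x = y].
Proof.
have tf := pullback_torus_immersion sF sG FK GK il isol.
have [K K0 hK] := immersion_bound tf.
have e0 : 0 < (4 * K)^-1 by rewrite invr_gt0 mulr_gt0.
have [d d0 hd] := strict_diff tf e0.
exists d, (8 * K)^-1; split=> //; first by rewrite invr_gt0 mulr_gt0.
move=> f hf x y yx fxy; apply/eqP; rewrite eq_sym -subr_eq0 -normr_le0.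
have xx : `|x - x| < d by rewrite subrr normr0.
have h1 := hd x x y xx yx; have h2 := hf x y; rewrite fxy in h2.
have h3 := hK x (y - x).
move: h1 h2 h3; set w := lin _ _ _; set N := `|y - x| => h1 h2 h3.
have {}h2 : `|lu y - lu x| <= 2 * (8 * K)^-1 * N.
  have eq2 : (f (unif y) - lu y) - (f (unif y) - lu x) = lu x - lu y.
    by rewrite opprB addrC addrA subrK.
  by rewrite distrC -eq2.
have h4 : `|w| <= (4 * K)^-1 * N + 2 * (8 * K)^-1 * N.
  have -> : w = (lu y - lu x) - (lu y - lu x - w) by rewrite opprB addrC subrK.
  by apply: (le_trans (ler_normB _ _)); rewrite addrC; apply: lerD.
have h5 : N <= K * ((4 * K)^-1 * N + 2 * (8 * K)^-1 * N).
  by apply: (le_trans h3); rewrite ler_pM2l.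
have h6 : K * ((4 * K)^-1 * N + 2 * (8 * K)^-1 * N) = N / 2.
  by field; rewrite gt_eqF.
by move: h5; rewrite h6 ler_pdivlMr // mulr_natr mulr2n gerDl.
Qed.

Lemma local_injectivity_immersion (f : S -> W) (d : R) : 0 < d -> continuous f ->
  (forall x y, `|y - x| < d -> f (unif x) = f (unif y) -> x = y) -> topological_immersion f.
Proof.
move=> d0 cf inj x; have [z ->] := unif_surj FK x.
(* Points of the closed box [K] of side [d / 2] are closer than [d], so [f] is injective on its
   compact image, hence a homeomorphism there. *)
pose r := d / 4; have r0 : 0 < r by rewrite divr_gt0.
pose K := [set w : E | forall i, `[z 0 i - r, z 0 i + r]%classic (w 0 i)].
have cK : compact K.
  exact: (@rV_compact R 2 (fun i => `[z 0 i - r, z 0 i + r]%classic)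
    (fun i => @segment_compact R _ _)).
have Kd v w : K v -> K w -> `|w - v| < d.
  move=> Kv Kw; apply: (@le_lt_trans _ _ (d / 2)); last first.
    by rewrite ltr_pdivrMr // ltr_pMr // ltr1n.
  apply: norm_le_coord => [|i]; first by rewrite divr_ge0 // ltW.
  have := Kv i; have := Kw i; rewrite /= !in_itv /= !mxE /r => /andP[h1 h2] /andP[h3 h4].
  rewrite ler_norml; move: (z 0 i) (v 0 i) (w 0 i) h1 h2 h3 h4 => z1 v1 w1 h1 h2 h3 h4.
  by apply/andP; split; lra.
exists (F @^-1` (@torus_proj R @` ball z r)); split.
- apply: open_comp; first by move=> y _; case: sF => cF _; exact: cF.
  exact: torus_proj_open (ball_open _ _).
- by rewrite /= /unif GK; exists z => //; exact: ballxx.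
apply: (@homeomorphism_on_sub _ _ (unif @` K) _ (f @` (unif @` K))) => //.
  move=> y [w]; rewrite -ball_normE /= => zw Fy; exists w; last by rewrite /unif Fy FK.
  move=> i /=; rewrite in_itv /=.
  have := le_lt_trans (coord_le_norm (z - w) i) zw; rewrite !mxE ltr_norml => /andP[h1 h2].
  by apply/andP; split; move: h1 h2; move: (r) (z 0 i) (w 0 i) => r' z1 w1; lra.
apply: (compact_injective_homeomorphism (unif 0)).
- apply: continuous_compact => //.
  by apply: continuous_subspaceT; exact: (unif_map_continuous sG).
- exact: norm_hausdorff.
- exact: continuous_subspaceT.
- by move=> _ _ [v Kv <-] [w Kw <-] /(inj _ _ (Kd _ _ Kv Kw)) ->.
Qed.

Lemma injective_embedding (f : S -> W) : continuous f -> injective f ->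
  topological_embedding f.
Proof.
move=> cf inj; apply: (compact_injective_homeomorphism (unif 0) (surface_compact sG FK)).
- exact: norm_hausdorff.
- exact: continuous_subspaceT.
- by move=> x y _ _; exact: inj.
Qed.

(** Points near each other modulo the lattice are left to local injectivity; the others have images
    under [l] at distance at least [c], and two moves of [c / 4] cannot join them. *)
Lemma embedding_separation (d : R) : 0 < d -> injective l ->
  exists2 c, 0 < c & forall f : S -> W,
    (forall x y, `|y - x| < d -> f (unif x) = f (unif y) -> x = y) ->
    (forall z, `|f (unif z) - lu z| <= c) -> injective f.
Proof.
move=> d0 injl; have tf := pullback_torus_immersion sF sG FK GK il isol.
have inju z w : lu z = lu w -> exists k : 'rV[int]_2, z = w + map_mx intr k.
  by move=> /injl /(unif_eq GK).
have [c c0 hc] := torus_separation tf d0 inju.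
exists (c / 4); first by rewrite divr_gt0.
move=> f inj hf x y; have [z ->] := unif_surj FK x; have [w ->] := unif_surj FK y => fzw.
have [[k zk]|lc] := hc z w.
  rewrite -(unif_periodic G w k); congr unif; apply: inj; first by rewrite distrC.
  by rewrite (unif_periodic G w k).
have h1 := hf z; have h2 := hf w; rewrite fzw in h1.
have h3 : `|lu z - lu w| <= c / 4 + c / 4.
  have -> : lu z - lu w = (f (unif w) - lu w) - (f (unif w) - lu z).
    by rewrite opprB [RHS]addrC addrA subrK.
  by apply: (le_trans (ler_normB _ _)); exact: lerD.
have := le_trans lc h3; rewrite (_ : c / 4 + c / 4 = c / 2); last by field.
by rewrite ler_pdivlMr // mulr_natr mulr2n gerDl leNgt c0.
Qed.

End Approximation.

Theorem theorem1 (R : realType) (n : nat) (n_ge2 : (2 <= n)%N)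
    (Sigma : smoothSurface R)
    (Sigma_torus : diffeomorphic Sigma (torus R))
    (g : riemannian Sigma)
    (l : Sigma -> 'rV[R]_(n * 2)) :
  (immersion l -> isotropic l ->
     forall eps : R, 0 < eps ->
     exists f : Sigma -> 'rV[R]_(n * 2),
       [/\ piecewise_linear f, piecewise_isotropic f,
           topological_immersion f & C1_norm_le g (l \- f) eps]) /\
  (smooth_embedding l -> isotropic l ->
     forall eps : R, 0 < eps ->
     exists f : Sigma -> 'rV[R]_(n * 2),
       [/\ piecewise_linear f, piecewise_isotropic f,
           topological_embedding f & C1_norm_le g (l \- f) eps]).
Proof.
have [F [G [sF sG FK GK]]] := Sigma_torus.
have [C C0 hC] := metric_bound sF sG FK GK g.
have approx (eps e1 : R) : immersion l -> isotropic l -> 0 < eps -> 0 < e1 ->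
    exists f : Sigma -> 'rV[R]_(n * 2),
    [/\ piecewise_linear f, piecewise_isotropic f, continuous f & C1_norm_le g (l \- f) eps] /\
    (forall z, `|f (unif G z) - l (unif G z)| <= e1) /\
    forall x y, `|(f (unif G y) - l (unif G y)) - (f (unif G x) - l (unif G x))| <= 2 * e1 * `|y - x|.
  (* [D] is the constant of the C^1 estimate; the error is taken below both [eps / D] and the [e1]
     that injectivity demands. *)
  move=> il isol eps0 e10; pose D := (n * 2)%:R * (1 + C).
  have D0 : 0 < D by rewrite mulr_gt0 ?addr_gt0 // ltr0n muln_gt0 andbT ltnW.
  pose e := Num.min e1 (eps / D).
  have e0 : 0 < e by rewrite lt_min e10 divr_gt0.
  have ee1 : e <= e1 by rewrite ge_min lexx.
  have [f [[pl pi cf C1] [hd hl]]] := exists_pl_approximation sF sG FK GK il isol C0 e0 hC.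
  exists f; split; [split=> //|split=> [z|x y]].
  - have [T [aT hT]] := C1; exists T; split=> //; apply: (le_trans hT).
    rewrite lee_fin (_ : _ * _ = D * e); last by rewrite /D; ring.
    by rewrite mulrC -ler_pdivlMr // ge_min lexx orbT.
  - exact: le_trans (hd z) ee1.
  - by apply: (le_trans (hl x y)); apply: ler_wpM2r => //; rewrite ler_pM2l.
split=> [il isol eps eps0|[il [_ [l' [_ lK _]]]] isol eps eps0].
  have [d [e1 [d0 e10 inj]]] := surface_local_injectivity sF sG FK GK il isol.
  have [f [[pl pi cf C1] [_ hl]]] := approx eps e1 il isol eps0 e10.
  exists f; split=> //.
  exact (local_injectivity_immersion sF sG FK GK d0 cf (inj f hl)).
have injl : injective l.
  by move=> x y lxy; have [_ <-] := lK x I; have [_ <-] := lK y I; rewrite lxy.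
have [d [e1 [d0 e10 inj]]] := surface_local_injectivity sF sG FK GK il isol.
have [c c0 hc] := embedding_separation sF sG FK GK il isol d0 injl.
(* [e1] secures injectivity at distances below [d], and [c] the separation of the remaining
   pairs. *)
pose e := Num.min e1 c.
have e0 : 0 < e by rewrite lt_min e10.
have [f [[pl pi cf C1] [hd hl]]] := approx eps e il isol eps0 e0.
exists f; split=> //; apply: (injective_embedding sG FK cf); apply: (hc f).
  apply: inj => x y; apply: (le_trans (hl x y)); apply: ler_wpM2r => //.
  by rewrite ler_pM2l // ge_min lexx.
by move=> z; apply: (le_trans (hd z)); rewrite ge_min lexx orbT.
Qed.
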